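(* Let $\mathcal{H}$ be a finite-dimensional complex Hilbert space, let $\Theta_1,\Theta_2\in H^\infty(\mathcal{L}(\mathcal{H}))$ be two pure inner functions and let $A:K_{\Theta_1}\to K_{\Theta_2}$ be a bounded linear operator. Then $A$ belongs to $\mathcal{MT}(\Theta_1,\Theta_2)$ if and only if the following hold: (a) there exist bounded linear operators $\widehat B_1:\mathcal{D}_{\Theta_1}\to K_{\Theta_2}$ and $\widehat B_2:\widetilde{\mathcal{D}}_{\Theta_2}\to K_{\Theta_1}$ such that $$S_{\Theta_2}^*A-AS_{\Theta_1}^*=\widehat B_1D_{\Theta_1}+\widetilde D_{\Theta_2}\widehat B_2^*;$$ (b) there exist bounded linear operators $\widehat B_1:\widetilde{\mathcal{D}}_{\Theta_1}\to K_{\Theta_2}$ and $\widehat B_2:\mathcal{D}_{\Theta_2}\to K_{\Theta_1}$ such that $$S_{\Theta_2}A-AS_{\Theta_1}=\widehat B_1\widetilde D_{\Theta_1}+D_{\Theta_2}\widehat B_2^*.$$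
   Context: $\mathcal{H}$ is a finite-dimensional complex Hilbert space, $\mathcal{L}(\mathcal{H})$ is the algebra of linear operators on $\mathcal{H}$, $\mathbb{D}$ is the open unit disk, $\mathbb{T}$ the unit circle with normalized Lebesgue measure $m$. $L^2(\mathcal{H})$ is the Hilbert space of square-integrable $\mathcal{H}$-valued functions on $\mathbb{T}$, $H^2(\mathcal{H})\subset L^2(\mathcal{H})$ the Hardy space of functions whose Fourier coefficients with negative indices vanish; $H^\infty(\mathcal{H})$ the essentially bounded functions in $H^2(\mathcal{H})$. $L^2(\mathcal{L}(\mathcal{H}))$, $H^2(\mathcal{L}(\mathcal{H}))$, $H^\infty(\mathcal{L}(\mathcal{H}))$ are the analogous operator-valued spaces ($\mathcal{L}(\mathcal{H})$ with Hilbert–Schmidt norm for the $L^2$ spaces). Functions in Hardy spaces are identified with their analytic extensions to $\mathbb{D}$. An inner function is $\Theta\in H^\infty(\mathcal{L}(\mathcal{H}))$ whose boundary values $\Theta(z)$ are unitary for a.e. $z\in\mathbb{T}$; it is pure if $\|\Theta(0)\|<1$. The model space is $K_\Theta=H^2(\mathcal{H})\ominus\Theta H^2(\mathcal{H})$, $P_\Theta$ is the orthogonal projection of $L^2(\mathcal{H})$ onto $K_\Theta$, and $K_\Theta^\infty=K_\Theta\cap H^\infty(\mathcal{H})$, which is dense in $K_\Theta$. For $\Phi\in L^2(\mathcal{L}(\mathcal{H}))$, $A_\Phi^{\Theta_1,\Theta_2}f=P_{\Theta_2}(\Phi f)$ for $f\in K_{\Theta_1}^\infty$. If this densely defined operator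 is bounded it is identified with its bounded extension $K_{\Theta_1}\to K_{\Theta_2}$. $\mathcal{MT}(\Theta_1,\Theta_2)$ is the set of all such bounded operators $A_\Phi^{\Theta_1,\Theta_2}$, $\Phi\in L^2(\mathcal{L}(\mathcal{H}))$. The compressed shift on $K_\Theta$ is $S_\Theta f=P_\Theta(zf)$, with adjoint $S_\Theta^*f=P_\Theta(\bar zf)$. Put $D_\Theta=I_{K_\Theta}-S_\Theta S_\Theta^*$, $\widetilde D_\Theta=I_{K_\Theta}-S_\Theta^*S_\Theta$, $\mathcal{D}_\Theta=\{(I_{\mathcal{H}}-\Theta(z)\Theta(0)^* )x:\ x\in\mathcal{H}\}\subset K_\Theta$ and $\widetilde{\mathcal{D}}_\Theta=\{\bar z(\Theta(z)-\Theta(0))x:\ x\in\mathcal{H}\}\subset K_\Theta$; the operator $D_\Theta$ has range in $\mathcal{D}_\Theta$ and $\widetilde D_\Theta$ has range in $\widetilde{\mathcal{D}}_\Theta$. *)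

(* Defs.v *)
(* Complex scalars are [R[i]] over an arbitrary
   [R : realType], Hilbert spaces are [H : vectType R[i]] with a positive
   definite form [dot : {dot H for Num.conj}] (linear in the first argument),
   and operators on H are ['End(H)].

   Elements of L^2 spaces are represented by measurable functions on the
   circle, and equality of elements is equality almost everywhere.  *)
From HB Require Import structures.
From mathcomp Require Import all_boot all_order all_algebra.
From mathcomp Require Import sesquilinear.
From mathcomp Require Import all_classical all_reals all_analysis.
From mathcomp Require Import complex.

Set Implicit Arguments.
Unset Strict Implicit.
Unset Printing Implicit Defensive.
Import Order.TTheory GRing.Theory Num.Theory.
Import numFieldNormedType.Exports.

Local Open Scope classical_set_scope.
Local Open Scope ring_scope.

Section Circle.
Variable R : realType.

Definition circle := {z : R[i] | `|z| == 1}.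

Lemma cpoint_subproof (t : R) :
  `|(cos (2 * pi * t) +i* sin (2 * pi * t))%C| == 1 :> R[i].
Proof. by rewrite normc_def /= cos2Dsin2 sqrtr1. Qed.

(* t |-> exp (2 i pi t) *)
Definition cpoint (t : measurableTypeR R) : circle :=
  exist _ (cos (2 * pi * t) +i* sin (2 * pi * t))%C (cpoint_subproof t).

HB.instance Definition _ := gen_eqMixin circle.
HB.instance Definition _ := gen_choiceMixin circle.
HB.instance Definition _ := isPointed.Build circle (cpoint 0).

(* A set of the circle is Borel iff its preimage by the 1-periodic map [cpoint],
   which is a Borel isomorphism from [0, 1[, is Borel. *)
Definition circle_measurable : set (set circle) :=
  image_set_system setT cpoint measurable.

Lemma circle_sigma_algebra : sigma_algebra setT circle_measurable.
Proof. exact/sigma_algebra_image/sigma_algebra_measurable. Qed.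

Lemma circle_measurable0 : circle_measurable set0.
Proof. by have [] := circle_sigma_algebra. Qed.

Lemma circle_measurableC A :
  circle_measurable A -> circle_measurable (~` A).
Proof. by move=> mA; rewrite -setTD; have [_ + _] := circle_sigma_algebra; apply. Qed.

Lemma circle_measurable_bigcup (F : (set circle)^nat) :
  (forall i, circle_measurable (F i)) -> circle_measurable (\bigcup_i F i).
Proof. by have [_ _] := circle_sigma_algebra; apply. Qed.

HB.instance Definition _ := @isMeasurable.Build default_measure_display circle
  circle_measurable circle_measurable0 circle_measurableC
  circle_measurable_bigcup.

Lemma measurable_cpoint : measurable_fun [set: measurableTypeR R] cpoint.
Proof. by move=> _ A. Qed.

Lemma measurable_itv01 : measurable (`[0, 1[ : set (measurableTypeR R)).
Proof. exact: measurable_itv. Qed.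

(* the normalized Lebesgue measure m of the circle *)
Definition circle_measure : set circle -> \bar R :=
  pushforward (mrestr (@lebesgue_measure R) measurable_itv01) cpoint.

Let mrestr01 : {measure set (measurableTypeR R) -> \bar R} :=
  mrestr (@lebesgue_measure R) measurable_itv01.

Let circle_measure0 : circle_measure set0 = 0%E.
Proof. by rewrite /circle_measure /pushforward preimage_set0 (measure0 mrestr01). Qed.

Let circle_measure_ge0 A : (0 <= circle_measure A)%E.
Proof. exact: (measure_ge0 mrestr01). Qed.

Let circle_measure_sigma_additive : semi_sigma_additive circle_measure.
Proof.
move=> F mF tF mUF; rewrite /circle_measure /pushforward preimage_bigcup.
have mpre A : measurable A -> measurable (cpoint @^-1` A).
  by rewrite -[X in _ -> measurable X]setTI; exact: measurable_cpoint.
apply: (@measure_semi_sigma_additive _ _ _ mrestr01).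
- by move=> n; apply: mpre.
- apply/trivIsetP => /= i j _ _ ij; rewrite -preimage_setI.
  by move/trivIsetP : tF => /(_ _ _ _ _ ij) ->//; rewrite preimage_set0.
- by rewrite -preimage_bigcup; apply: mpre.
Qed.

HB.instance Definition _ := isMeasure.Build _ _ _ circle_measure
  circle_measure0 circle_measure_ge0 circle_measure_sigma_additive.

End Circle.

Arguments circle_measure R : clear implicits.

Section Integration.
Variable R : realType.
Local Notation m := (circle_measure R).

Definition cintegral (f : circle R -> R[i]) : R[i] :=
  ((\int[m]_z complex.Re (f z)) +i* (\int[m]_z complex.Im (f z)))%C.

Variable V : vectType R[i].
Implicit Type F : circle R -> V.

(* Measurability and integral are taken coordinatewise; neither depends on the
   basis. *)
Definition vcoord F (i : 'I_(\dim {:V})) (z : circle R) : R[i] :=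
  coord (vbasis {:V}) i (F z).

Definition vmeasurable F := forall i,
  measurable_fun setT (fun z => complex.Re (vcoord F i z)) /\
  measurable_fun setT (fun z => complex.Im (vcoord F i z)).

Definition vintegral F : V :=
  \sum_(i < \dim {:V}) cintegral (vcoord F i) *: (vbasis {:V})`_i.

Definition fourier F (n : int) : V :=
  vintegral (fun z => (sval z ^ (- n)) *: F z).

(* The value at 0 of the analytic extension
   F(w) = \sum_(n >= 0) (fourier F n) w^n of a function in a Hardy space. *)
Definition value0 F : V := fourier F 0.

(* L^2, H^2 and H^oo of V-valued functions. The norm N defining the L^2 norm and
   the norm N' defining essential boundedness are kept separate, since for
   operator-valued functions they are respectively the Hilbert-Schmidt and the
   operator norm. *)
Definition L2space (N : V -> R) : set (circle R -> V) :=
  [set F | vmeasurable F /\ (\int[m]_z ((N (F z)) ^+ 2)%:E < +oo)%E].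

Definition H2space (N : V -> R) : set (circle R -> V) :=
  [set F | L2space N F /\ forall n : int, n < 0 -> fourier F n = 0].

Definition Hoospace (N N' : V -> R) : set (circle R -> V) :=
  [set F | H2space N F /\ exists M : R, \forall z \ae m, N' (F z) <= M].

End Integration.

Section Operators.
Variables (R : realType) (H : vectType R[i]) (dot : {dot H for Num.conj}).
Local Notation m := (circle_measure R).

Definition hnorm (x : H) : R := Num.sqrt (complex.Re (dot x x)).

(* the adjoint of T; the set is a singleton since H is finite-dimensional *)
Definition adj (T : 'End(H)) : 'End(H) :=
  xget 0 [set T' : 'End(H) | forall x y, dot (T x) y = dot x (T' y)].

Definition unitary (T : 'End(H)) : Prop :=
  (adj T \o T = \1)%VF /\ (T \o adj T = \1)%VF.

Definition opnorm (T : 'End(H)) : R :=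
  sup [set hnorm (T x) | x in [set x | hnorm x <= 1]].

(* the trace of T^* T does not depend on the basis *)
Definition hsnorm (T : 'End(H)) : R :=
  Num.sqrt (complex.Re
    (\tr (passmx.mxof (vbasis {:H}) (vbasis {:H}) (adj T \o T)%VF))).

Definition L2H : set (circle R -> H) := L2space hnorm.
Definition H2H : set (circle R -> H) := H2space hnorm.
Definition HooH : set (circle R -> H) := Hoospace hnorm hnorm.

Definition L2L : set (circle R -> 'End(H)) := L2space hsnorm.
Definition HooL : set (circle R -> 'End(H)) := Hoospace hsnorm opnorm.

Definition ip (f g : circle R -> H) : R[i] :=
  cintegral (fun z => dot (f z) (g z)).

Definition L2norm (f : circle R -> H) : R := Num.sqrt (complex.Re (ip f f)).

Definition opmul (Phi : circle R -> 'End(H)) (f : circle R -> H) :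
  circle R -> H := fun z => Phi z (f z).

Definition inner (Theta : circle R -> 'End(H)) : Prop :=
  HooL Theta /\ \forall z \ae m, unitary (Theta z).

Definition pure (Theta : circle R -> 'End(H)) : Prop :=
  opnorm (value0 Theta) < 1.

Section ModelSpace.
Variable Theta : circle R -> 'End(H).

(* K_Theta = H^2(H) (-) Theta H^2(H) *)
Definition model : set (circle R -> H) :=
  [set f | H2H f /\ forall h, H2H h -> ip f (opmul Theta h) = 0].

Definition model_oo : set (circle R -> H) := model `&` HooH.

(* P_Theta f, for f in L^2(H); it is unique up to a.e. equality *)
Definition proj (f : circle R -> H) : circle R -> H :=
  xget 0 [set g | model g /\ forall h, model h -> ip (f - g) h = 0].

(* S_Theta and S_Theta^* *)
Definition cshift (f : circle R -> H) : circle R -> H :=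
  proj (fun z => sval z *: f z).
Definition cshift_adj (f : circle R -> H) : circle R -> H :=
  proj (fun z => (sval z)^* *: f z).

(* D_Theta = I - S S^* and D~_Theta = I - S^* S *)
Definition defect (f : circle R -> H) : circle R -> H :=
  f - cshift (cshift_adj f).
Definition defect_t (f : circle R -> H) : circle R -> H :=
  f - cshift_adj (cshift f).

(* the spaces {(I - Theta(z) Theta(0)^* ) x} and
   {conj(z) (Theta(z) - Theta(0)) x}, closed under a.e. equality *)
Definition defect_space : set (circle R -> H) :=
  [set f | L2H f /\ exists x : H,
     f = (fun z => x - Theta z (adj (value0 Theta) x)) %[ae m]].
Definition defect_space_t : set (circle R -> H) :=
  [set f | L2H f /\ exists x : H,
     f = (fun z => (sval z)^* *: (Theta z x - value0 Theta x)) %[ae m]].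

End ModelSpace.

(* A is (represents) a bounded linear operator from the subspace E to the
   subspace F of L^2(H); the values of A outside of E are irrelevant. *)
Definition bounded_linear (E F : set (circle R -> H))
    (A : (circle R -> H) -> circle R -> H) : Prop :=
  [/\ forall f, E f -> F (A f),
      forall f g, E f -> E g -> f = g %[ae m] -> A f = A g %[ae m],
      forall (a : R[i]) f g, E f -> E g ->
        A (a *: f + g) = a *: A f + A g %[ae m] &
      exists M : R, forall f, E f -> L2norm (A f) <= M * L2norm f].

(* the value at f of the adjoint B^* of a bounded operator B with domain E *)
Definition adjop (E : set (circle R -> H))
    (B : (circle R -> H) -> circle R -> H) (f : circle R -> H) :
    circle R -> H :=
  xget 0 [set g | E g /\ forall h, E h -> ip h g = ip (B h) f].

(* A_Phi^{Theta_1, Theta_2}, to be applied to bounded functions of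
   K_{Theta_1} *)
Definition trunc_toeplitz (Theta2 Phi : circle R -> 'End(H))
    (f : circle R -> H) : circle R -> H :=
  proj Theta2 (opmul Phi f).

(* The set MT(Theta_1, Theta_2): a bounded A is the bounded extension of
   A_Phi iff both agree on the dense subspace K_{Theta_1}^oo. *)
Definition MT (Theta1 Theta2 : circle R -> 'End(H)) :
    set ((circle R -> H) -> circle R -> H) :=
  [set A | bounded_linear (model Theta1) (model Theta2) A /\
     exists Phi, L2L Phi /\
       forall f, model_oo Theta1 f ->
         A f = trunc_toeplitz Theta2 Phi f %[ae m]].

End Operators.

(* Main.v *)
(* On K_Theta the adjoint S^* acts as the backward shift B f = (f - f(0)) / z, and
   S f = z f - Theta c(f), where c(f) is the coefficient of 1/z in Theta^* f. Hence
   D_Theta f = k0 (f(0)) and D~_Theta f = kt (c f), where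
   k0 x = (I - Theta Theta(0)^* ) x and kt x = (Theta - Theta(0)) x / z satisfy
   <k0 x, f> = <x, f(0)> and <kt x, f> = <x, c f> for f in K_Theta.

   Necessity. If A = A_Phi, then for bounded f the form
   <(S2^* A - A S1^* ) f, h> expands into <G f(0), h> + <f, G' c(h)>, with
   G x = Phi x / z and G' y = - Phi^* Theta2 y in L^2. Purity makes x |-> (k0 x)(0)
   and x |-> c (kt x) injective, hence invertible, so B1 (k0 x) and B2 (kt y) can be
   prescribed through G and G'; boundedness of A and density of K_Theta^oo remove the
   restriction to bounded f. Condition (b) is symmetric.

   Sufficiency. Condition (a) alone suffices. Pairing it with B h gives
   <A f, h> = <A B f, B h> + <Psi1 f(0), h> + <f, Psi2 h(0)>, where Psi1 and Psi2 have
   columns in H^2. Iterating, and since ||B^n f|| -> 0, the operator A is A_Phi with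
   Phi = Psi1 + Psi2^*. *)
Require Import Defs.
From HB Require Import structures.
From mathcomp Require Import all_boot all_order all_algebra.
From mathcomp Require Import sesquilinear.
From mathcomp Require Import all_classical all_reals all_analysis.
From mathcomp Require Import measurable_realfun.
From mathcomp Require Import complex.
From mathcomp Require Import ring lra.

Set Implicit Arguments.
Unset Strict Implicit.
Unset Printing Implicit Defensive.
Import Order.TTheory GRing.Theory Num.Theory.
Import numFieldNormedType.Exports.

Local Open Scope classical_set_scope.
Local Open Scope ring_scope.


(** Elements of L^2 are functions known up to null sets, so most identities between them are proved
    weakly: both sides are paired with test vectors through [ip], and [model_inj] or [model_oo_orth]
    turns the result back into an a.e. equality. The choices made by [xget] in [proj] and [adjop]
    carry information only once existence is known. For the projection this comes from Riesz
    representation on a closed subspace, hence from completeness of L^2; convergence of Taylor sums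
    in H^2 also rests on uniqueness of Fourier coefficients.

    The obstacle is that a symbol is only square integrable, so Phi f is known to lie in L^2 only
    for bounded f. In the necessity part, c has finite rank: for fixed h both sides of the identity
    are functionals of f represented by L^2 vectors, so agreement on bounded f propagates to all f.
    In the sufficiency part, Psi1 and Psi2 meet only Taylor polynomials during the iteration, and in
    the limit their adjoints are applied to the bounded functions h and f. *)

Section ComplexParts.
Variable R : realType.
Implicit Types x y : R[i].

Lemma Re_conj x : complex.Re x^* = complex.Re x.
Proof. by case: x. Qed.
Lemma Im_conj x : complex.Im x^* = - complex.Im x.
Proof. by case: x. Qed.
Lemma ReD x y : complex.Re (x + y) = complex.Re x + complex.Re y.
Proof. by case: x => a b; case: y. Qed.
Lemma ImD x y : complex.Im (x + y) = complex.Im x + complex.Im y.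
Proof. by case: x => a b; case: y. Qed.
Lemma ReN x : complex.Re (- x) = - complex.Re x.
Proof. by case: x. Qed.
Lemma ImN x : complex.Im (- x) = - complex.Im x.
Proof. by case: x. Qed.
Lemma ReB x y : complex.Re (x - y) = complex.Re x - complex.Re y.
Proof. by rewrite ReD ReN. Qed.
Lemma ReM x y : complex.Re (x * y) =
  complex.Re x * complex.Re y - complex.Im x * complex.Im y.
Proof. by case: x => a b; case: y. Qed.
Lemma ImM x y : complex.Im (x * y) =
  complex.Re x * complex.Im y + complex.Im x * complex.Re y.
Proof. by case: x => a b; case: y. Qed.
Lemma complex_eq x y :
  complex.Re x = complex.Re y -> complex.Im x = complex.Im y -> x = y.
Proof. by case: x => a b; case: y => c d /= -> ->. Qed.
Lemma Re_realM (t : R) x : complex.Re (t%:C%C * x) = t * complex.Re x.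
Proof. by rewrite ReM /= mul0r subr0. Qed.
Lemma conj_real (t : R) : (t%:C%C : R[i])^* = t%:C%C.
Proof. by apply: complex_eq => //=; rewrite oppr0. Qed.
Lemma Re_sum (I : Type) (r : seq I) (F : I -> R[i]) :
  complex.Re (\sum_(i <- r) F i) = \sum_(i <- r) complex.Re (F i).
Proof. by elim/big_rec2 : _ => // i a b _ <-; rewrite ReD. Qed.

Lemma sqr_Re_norm x : complex.Re x ^+ 2 + complex.Im x ^+ 2 = complex.Re (x * x^*).
Proof. by case: x => a b /=; ring. Qed.

End ComplexParts.

(** * Finite-dimensional Hilbert spaces *)

Section FiniteDim.
Variables (R : realType) (H : vectType R[i]) (dot : {dot H for Num.conj}).
Implicit Types x y : H.

Lemma dotDl x y w : dot (x + y) w = dot x w + dot y w.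
Proof. exact: linearDl. Qed.
Lemma dotBl x y w : dot (x - y) w = dot x w - dot y w.
Proof. exact: linearBl. Qed.
Lemma dotZl a x w : dot (a *: x) w = a * dot x w.
Proof. exact: linearZl_LR. Qed.
Lemma dotDr x y w : dot w (x + y) = dot w x + dot w y.
Proof. exact: linearDr. Qed.
Lemma dotZr a x w : dot w (a *: x) = a^* * dot w x.
Proof. exact: linearZr_LR. Qed.
Lemma dot0l w : dot 0 w = 0.
Proof. exact: linear0l. Qed.
Lemma dot0r w : dot w 0 = 0.
Proof. exact: linear0r. Qed.
Lemma dotC x y : dot x y = (dot y x)^*.
Proof. by rewrite hermC expr0 mul1r. Qed.
Lemma dot_suml (I : Type) (r : seq I) (P : pred I) (F : I -> H) w :
  dot (\sum_(i <- r | P i) F i) w = \sum_(i <- r | P i) dot (F i) w.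
Proof.
by elim/big_rec2 : _ => [|i a b _ <-]; rewrite ?dot0l ?dotDl.
Qed.
Lemma dot_sumr (I : Type) (r : seq I) (P : pred I) (F : I -> H) w :
  dot w (\sum_(i <- r | P i) F i) = \sum_(i <- r | P i) dot w (F i).
Proof.
by elim/big_rec2 : _ => [|i a b _ <-]; rewrite ?dot0r ?dotDr.
Qed.

Lemma dot_eq0 x : (forall y, dot x y = 0) -> x = 0.
Proof. by move=> /(_ x) /eqP; rewrite dnorm_eq0 => /eqP. Qed.

Lemma dot_inj x x' : (forall y, dot x y = dot x' y) -> x = x'.
Proof.
move=> h; apply/eqP; rewrite -subr_eq0; apply/eqP/dot_eq0 => y.
by rewrite dotBl h subrr.
Qed.

Lemma Re_dot_ge0 x : 0 <= complex.Re (dot x x).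
Proof. by have := dnorm_ge0 dot x; rewrite lecE => /andP[]. Qed.

Lemma dot_real x : dot x x = (complex.Re (dot x x))%:C%C.
Proof.
have := dnorm_ge0 dot x; rewrite lecE => /andP[/eqP].
by case: (dot x x) => a b /= -> _.
Qed.

Lemma hnorm_ge0 x : 0 <= hnorm dot x.
Proof. exact: sqrtr_ge0. Qed.

Lemma sqr_hnorm x : hnorm dot x ^+ 2 = complex.Re (dot x x).
Proof. by rewrite sqr_sqrtr// Re_dot_ge0. Qed.

Lemma hnorm0 : hnorm dot 0 = 0.
Proof. by rewrite /hnorm dot0l sqrtr0. Qed.

Lemma hnorm_eq0 x : hnorm dot x = 0 -> x = 0.
Proof.
move=> h; apply/eqP; rewrite -(dnorm_eq0 dot) dot_real -sqr_hnorm h.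
by rewrite expr0n.
Qed.

Lemma hnormZ a x : hnorm dot (a *: x) ^+ 2 =
  (complex.Re a ^+ 2 + complex.Im a ^+ 2) * hnorm dot x ^+ 2.
Proof.
rewrite !sqr_hnorm dotZl dotZr mulrA dot_real.
by case: a => a b /=; rewrite !(mulr0, subr0); ring.
Qed.

Lemma Re_dotC x y : complex.Re (dot x y) = complex.Re (dot y x).
Proof. by rewrite dotC Re_conj. Qed.

(** The discriminant criterion. It yields Cauchy-Schwarz in H and in L^2, and the first-order
    condition at an almost minimiser in [riesz]. *)
Lemma real_quad (a b c : R) : 0 <= a -> 0 <= c ->
  (forall t : R, 0 <= a + t * (2 * b) + t ^+ 2 * c) -> b ^+ 2 <= a * c.
Proof.
move=> a0 c0 h; have [c_eq0|c_gt0] := eqVneq c 0.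
  rewrite c_eq0 mulr0; have [->|b0] := eqVneq b 0; first by rewrite expr0n.
  (* With c = 0 the polynomial is affine; this t makes its value -1. *)
  have := h (- (a + 1) / (2 * b)); rewrite c_eq0 mulr0 addr0 divfK; last first.
    by rewrite mulf_neq0// pnatr_eq0.
  lra.
(* The minimum of the quadratic. *)
have := h (- b / c); have cp : 0 < c by rewrite lt_neqAle eq_sym c_gt0.
have -> : a + - b / c * (2 * b) + (- b / c) ^+ 2 * c = (a * c - b ^+ 2) / c.
  by field.
by rewrite pmulr_lge0 ?invr_gt0// subr_ge0.
Qed.

(** Testing x + t y with real t sees only the real part; [Im_dot_le] follows by replacing x with i
    x. *)
Lemma Re_dot_le x y : `|complex.Re (dot x y)| <= hnorm dot x * hnorm dot y.
Proof.
rewrite -(@ler_pXn2r _ 2%N)// ?nnegrE// ?mulr_ge0 ?hnorm_ge0// real_normK ?num_real//.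
rewrite exprMn !sqr_hnorm; apply: real_quad; rewrite ?Re_dot_ge0// => t.
have := Re_dot_ge0 (x + t%:C%C *: y).
rewrite dotDl !dotDr !dotZl !dotZr !ReD !ReM /= Re_dotC.
by rewrite (Re_dotC y x) !(mul0r, oppr0, subr0, mulrN, addr0); lra.
Qed.

Lemma hnormi x : hnorm dot ('i%C *: x) = hnorm dot x.
Proof.
apply/eqP; rewrite -(@eqrXn2 _ 2%N)// ?hnorm_ge0//.
by rewrite hnormZ /= expr0n add0r expr1n mul1r.
Qed.

Lemma Im_dot_le x y : `|complex.Im (dot x y)| <= hnorm dot x * hnorm dot y.
Proof.
have -> : complex.Im (dot x y) = - complex.Re (dot ('i%C *: x) y).
  by rewrite dotZl ReM /= mul0r mul1r sub0r opprK.
by rewrite normrN -(hnormi x) Re_dot_le.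
Qed.

Lemma hnormD x y : hnorm dot (x + y) <= hnorm dot x + hnorm dot y.
Proof.
rewrite -(@ler_pXn2r _ 2%N)// ?nnegrE ?addr_ge0 ?hnorm_ge0//.
have := Re_dot_le x y; rewrite sqrrD !sqr_hnorm dotDl !dotDr !ReD (Re_dotC y x).
by rewrite ler_norml => /andP[_]; lra.
Qed.

Lemma hnormN x : hnorm dot (- x) = hnorm dot x.
Proof.
apply/eqP; rewrite -(@eqrXn2 _ 2%N)// ?hnorm_ge0// -scaleN1r hnormZ/=.
by rewrite oppr0 expr0n addr0 sqrrN expr1n mul1r.
Qed.

Lemma hnorm_unit (a : R[i]) x : `|a| = 1 -> hnorm dot (a *: x) = hnorm dot x.
Proof.
move=> a1; apply/eqP; rewrite -(@eqrXn2 _ 2%N)// ?hnorm_ge0// hnormZ.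
have := add_Re2_Im2 a; rewrite a1 expr1n => /(congr1 (@complex.Re R)) /= ->.
by rewrite mul1r.
Qed.

(** Gram-Schmidt, one vector per induction step. *)
Lemma orthonormal_exists k : (k <= \dim {:H})%N ->
  exists u : 'I_k -> H, forall i j, dot (u i) (u j) = (i == j)%:R.
Proof.
elim: k => [_|k IH lek]; first by exists (fun=> 0) => -[].
have [u uP] := IH (ltnW lek).
pose U := span [seq u i | i : 'I_k].
(* The k vectors found so far span at most k dimensions, fewer than the dimension of H. *)
have [x /negP xU] : exists x, ~ x \in U.
  apply/not_existsP => h; have : (fullv <= U)%VS.
    by apply/subvP => x _; have := h x; case: (x \in U) => // /(_ _)[].
  move=> /dimvS; rewrite leqNgt (leq_ltn_trans (dim_span _))//.
  by rewrite size_map -cardT card_ord.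
pose y := x - \sum_i dot x (u i) *: u i.
have yu i : dot y (u i) = 0.
  rewrite dotBl dot_suml (bigD1 i)//= dotZl uP eqxx mulr1 big1 ?addr0 ?subrr//.
  by move=> j ji; rewrite dotZl uP (negbTE ji) mulr0.
have y0 : y != 0.
  apply: contra xU; rewrite subr_eq0 => /eqP ->; apply: memv_suml => i _.
  by apply/memvZ/memv_span/map_f; rewrite mem_enum.
pose w := ((hnorm dot y)^-1)%:C%C *: y.
have hy : hnorm dot y != 0 by apply: contra y0 => /eqP/hnorm_eq0 ->.
have ww : dot w w = 1.
  rewrite dot_real -sqr_hnorm hnormZ /= expr0n addr0 exprVn mulVf//.
  by rewrite expf_neq0.
have wu i : dot w (u i) = 0 by rewrite dotZl yu mulr0.
exists (fun i => if unlift ord_max i is Some j then u j else w) => i j.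
case: (unliftP ord_max i) => [i' ->|->]; case: (unliftP ord_max j) => [j' ->|->].
- by rewrite uP (inj_eq lift_inj).
- by rewrite dotC wu rmorph0 eq_sym (negbTE (neq_lift _ _)).
- by rewrite wu (negbTE (neq_lift _ _)).
- by rewrite ww eqxx.
Qed.

(** Measurability and integrals are defined in [vbasis], which has no relation to [dot]; in this
    basis coordinates become inner products. *)
Definition onb : 'I_(\dim {:H}) -> H := projT1 (cid (orthonormal_exists (leqnn _))).

Lemma onbP i j : dot (onb i) (onb j) = (i == j)%:R.
Proof. by rewrite /onb; case: cid. Qed.

Definition onb_tuple : (\dim {:H}).-tuple H := [tuple onb i | i < \dim {:H}].

Lemma nth_onb_tuple (i : 'I_(\dim {:H})) : onb_tuple`_i = onb i.
Proof. by rewrite -tnth_nth tnth_mktuple. Qed.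

Lemma dot_onb_tuple (c : 'I_(\dim {:H}) -> R[i]) j :
  dot (\sum_i c i *: onb_tuple`_i) (onb j) = c j.
Proof.
rewrite dot_suml (bigD1 j)//= nth_onb_tuple dotZl onbP eqxx mulr1 big1 ?addr0//.
by move=> i ij; rewrite nth_onb_tuple dotZl onbP (negbTE ij) mulr0.
Qed.

Lemma onb_tuple_basis : basis_of fullv onb_tuple.
Proof.
have fX : free onb_tuple.
  by apply/freeP => c h i; rewrite -(dot_onb_tuple c) h dot0l.
by rewrite basisEfree fX subvf size_tuple leqnn.
Qed.

Lemma coord_onb_tuple x i : coord onb_tuple i x = dot x (onb i).
Proof. by rewrite {2}(coord_basis onb_tuple_basis (memvf x)) dot_onb_tuple. Qed.

Lemma onb_sum x : x = \sum_i dot x (onb i) *: onb i.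
Proof.
rewrite {1}(coord_basis onb_tuple_basis (memvf x)); apply: eq_bigr => i _.
by rewrite nth_onb_tuple coord_onb_tuple.
Qed.

Lemma dot_onb x y : dot x y = \sum_i dot x (onb i) * (dot y (onb i))^*.
Proof.
rewrite {1}(onb_sum x) dot_suml; apply: eq_bigr => i _.
by rewrite dotZl [dot (onb i) y]dotC.
Qed.

Lemma sqr_hnorm_onb x : hnorm dot x ^+ 2 =
  \sum_i (complex.Re (dot x (onb i)) ^+ 2 + complex.Im (dot x (onb i)) ^+ 2).
Proof.
by rewrite sqr_hnorm dot_onb Re_sum; apply: eq_bigr => i _; rewrite sqr_Re_norm.
Qed.

Lemma hnorm_onb i : hnorm dot (onb i) = 1.
Proof. by rewrite /hnorm onbP eqxx sqrtr1. Qed.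

Lemma riesz_fin (l : H -> R[i]) :
  (forall a x y, l (a *: x + y) = a * l x + l y) ->
  exists w, forall x, l x = dot x w.
Proof.
move=> ll; have l0 : l 0 = 0.
  by have := ll 1 0 0; rewrite scale1r addr0 mul1r -[in LHS](addr0 (l 0)) => /addrI.
have lZ a x : l (a *: x) = a * l x by have := ll a x 0; rewrite !addr0 l0 addr0.
exists (\sum_i (l (onb i))^* *: onb i) => x.
rewrite {1}(onb_sum x) dot_sumr.
transitivity (\sum_i l (dot x (onb i) *: onb i)).
  elim/big_rec2 : _ => // i a b _ <-; have := ll 1 (dot x (onb i) *: onb i) b.
  by rewrite scale1r mul1r.
by apply: eq_bigr => i _; rewrite lZ dotZr conjCK mulrC.
Qed.

(** Rules out the default value 0 of [xget] in [adj]. *)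
Lemma adj_exists (T : 'End(H)) :
  exists T' : 'End(H), forall x y, dot (T x) y = dot x (T' y).
Proof.
pose f y := \sum_i dot y (T (onb i)) *: onb i.
have lf : linear f.
  move=> a x y; rewrite /f scaler_sumr -big_split; apply: eq_bigr => i _ /=.
  by rewrite dotDl dotZl scalerDl scalerA.
pose fL := GRing.isLinear.Build R[i] H H _ f lf.
pose F : {linear H -> H} := HB.pack f fL.
exists (linfun F) => x y; rewrite lfunE /= /f dot_sumr {1}(onb_sum x) linear_sum dot_suml.
by apply: eq_bigr => i _; rewrite linearZ /= dotZl dotZr -dotC mulrC.
Qed.

Lemma adjP (T : 'End(H)) x y : dot (T x) y = dot x (adj dot T y).
Proof.
rewrite /adj; case: xgetP => [T' _ ->//|/(_ _)].
by have [T' T'P] := adj_exists T => /(_ T').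
Qed.

Lemma adjPl (T : 'End(H)) x y : dot (adj dot T x) y = dot x (T y).
Proof. by rewrite dotC -adjP -dotC. Qed.

Lemma adj_adj (T : 'End(H)) : adj dot (adj dot T) = T.
Proof.
by apply/lfunP => x; apply: dot_inj => y; rewrite adjPl adjP.
Qed.

Lemma unitary_dot (T : 'End(H)) x y : unitary dot T -> dot (T x) (T y) = dot x y.
Proof.
by move=> [T1 _]; rewrite adjP -comp_lfunE T1 id_lfunE.
Qed.

Lemma unitary_hnorm (T : 'End(H)) x : unitary dot T -> hnorm dot (T x) = hnorm dot x.
Proof. by move=> uT; rewrite /hnorm unitary_dot. Qed.

Lemma hnorm_sum (I : Type) (r : seq I) (F : I -> H) :
  hnorm dot (\sum_(i <- r) F i) <= \sum_(i <- r) hnorm dot (F i).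
Proof.
elim/big_rec2 : _ => [|i a b _ h]; first by rewrite hnorm0.
by rewrite (le_trans (hnormD _ _))// lerD2l.
Qed.

Lemma hnormZ_le a x : hnorm dot (a *: x) <=
  (`|complex.Re a| + `|complex.Im a|) * hnorm dot x.
Proof.
rewrite -(@ler_pXn2r _ 2%N)// ?nnegrE ?mulr_ge0 ?addr_ge0 ?hnorm_ge0//.
rewrite hnormZ exprMn ler_wpM2r ?sqr_ge0//.
rewrite -(real_normK (num_real (complex.Re a))) -(real_normK (num_real (complex.Im a))).
have : 0 <= `|complex.Re a| * `|complex.Im a| by rewrite mulr_ge0.
by rewrite sqrrD; lra.
Qed.

Lemma linear_bounded (T : 'End(H)) : exists2 C, 0 <= C &
  forall x, hnorm dot (T x) <= C * hnorm dot x.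
Proof.
exists (\sum_i 2 * hnorm dot (T (onb i))).
  by apply: sumr_ge0 => i _; rewrite mulr_ge0// hnorm_ge0.
move=> x; rewrite {1}(onb_sum x) linear_sum mulr_suml.
apply: (le_trans (hnorm_sum _ _)); apply: ler_sum => i _.
rewrite linearZ /= (le_trans (hnormZ_le _ _))// -mulrA [hnorm _ _ * _]mulrC mulrA.
rewrite ler_wpM2r ?hnorm_ge0//.
have := Re_dot_le x (onb i); have := Im_dot_le x (onb i); rewrite hnorm_onb; lra.
Qed.

(** The supremum is meaningful because [linear_bounded] bounds the set from above; the rest is
    homogeneity. *)
Lemma opnormP (T : 'End(H)) x : hnorm dot (T x) <= opnorm dot T * hnorm dot x.
Proof.
have [C C0 hC] := linear_bounded T.
have ub y : hnorm dot y <= 1 -> hnorm dot (T y) <= opnorm dot T.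
  move=> y1; apply: sup_upper_bound; last by exists y.
  split; first by exists (hnorm dot (T y)), y.
  exists C => _ [z /= z1 <-]; apply: le_trans (hC z) _.
  by rewrite -[leRHS]mulr1 ler_wpM2l.
have [/hnorm_eq0 ->|x0] := eqVneq (hnorm dot x) 0.
  by rewrite linear0 hnorm0 mulr0.
have xp : 0 < hnorm dot x by rewrite lt_neqAle eq_sym x0 hnorm_ge0.
have scal (a : R) y : 0 <= a -> hnorm dot (a%:C%C *: y) = a * hnorm dot y.
  move=> a0; apply/eqP; rewrite -(@eqrXn2 _ 2%N)// ?mulr_ge0 ?hnorm_ge0//.
  by rewrite hnormZ /= expr0n addr0 exprMn.
have := ub ((hnorm dot x)^-1%:C%C *: x).
rewrite linearZ /= !scal ?invr_ge0 ?hnorm_ge0// mulVf// => /(_ (lexx _)).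
by rewrite mulrC ler_pdivrMr.
Qed.

Lemma tr_mxof (T : 'End(H)) :
  \tr (passmx.mxof (vbasis {:H}) (vbasis {:H}) T) = \sum_i dot (T (onb i)) (onb i).
Proof.
have vb := vbasisP (fullv : {vspace H}).
have ob := onb_tuple_basis.
transitivity (\tr (passmx.mxof onb_tuple onb_tuple T)).
  (* The identities become change-of-basis matrices, and cyclicity of the trace brings them together
     on the other side. *)
  have {1}-> : T = (\1 \o (T \o \1))%VF by rewrite comp_lfun1l comp_lfun1r.
  rewrite (passmx.mxof_comp _ _ ob) mxtrace_mulC -(passmx.mxof_comp _ _ vb).
  by rewrite !comp_lfun1r.
apply: eq_bigr => i _.
by rewrite mxE /= passmx.vecof_delta nth_onb_tuple mxE coord_onb_tuple.
Qed.

Lemma sqr_hsnorm (T : 'End(H)) :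
  hsnorm dot T ^+ 2 = \sum_i hnorm dot (T (onb i)) ^+ 2.
Proof.
have h : complex.Re (\tr (passmx.mxof (vbasis {:H}) (vbasis {:H})
    (adj dot T \o T)%VF)) = \sum_i hnorm dot (T (onb i)) ^+ 2.
  rewrite tr_mxof Re_sum; apply: eq_bigr => i _.
  by rewrite comp_lfunE adjPl sqr_hnorm.
by rewrite /hsnorm h sqr_sqrtr// sumr_ge0// => i _; rewrite sqr_ge0.
Qed.
End FiniteDim.

(** * Square-integrable real functions *)

Section SquareIntegrable.
Context d (T : measurableType d) (R : realType) (mu : {finite_measure set T -> \bar R}).
Implicit Types f g : T -> R.

Definition integr f := mu.-integrable setT (EFin \o f).

Definition sqint f := measurable_fun setT f /\ integr (fun x => f x ^+ 2).

Lemma integr_measurable f : integr f -> measurable_fun setT f.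
Proof. by move=> /integrableP[/measurable_EFinP]. Qed.

Lemma integrP f : measurable_fun setT f ->
  (\int[mu]_x (`|f x|)%:E < +oo)%E -> integr f.
Proof. by move=> mf h; apply/integrableP; split => //; exact/measurable_EFinP. Qed.

Lemma integr_le f g : measurable_fun setT f -> (forall x, `|f x| <= g x) ->
  integr g -> integr f.
Proof.
move=> mf fg ig; apply: (le_integrable _ _ _ ig) => //.
  exact/measurable_EFinP.
by move=> x _ /=; rewrite lee_fin (le_trans (fg x))// ler_norm.
Qed.

Lemma integrD f g : integr f -> integr g -> integr (fun x => f x + g x).
Proof.
move=> h1 h2; have := integrableD measurableT h1 h2.
by apply: eq_integrable => // x _; rewrite /= EFinD.
Qed.

Lemma integrZ a f : integr f -> integr (fun x => a * f x).
Proof.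
move=> h; have := integrableZl measurableT a h.
by apply: eq_integrable => // x _; rewrite /= EFinM.
Qed.

Lemma integrN f : integr f -> integr (fun x => - f x).
Proof. by move=> h; have := integrZ (-1) h; under eq_fun do rewrite mulN1r. Qed.

Lemma integrB f g : integr f -> integr g -> integr (fun x => f x - g x).
Proof. by move=> h1 h2; exact: (integrD h1 (integrN h2)). Qed.

Lemma integr_cst a : integr (fun=> a).
Proof. exact: finite_measure_integrable_cst. Qed.

Lemma integr_sum (I : Type) (s : seq I) (F : I -> T -> R) :
  (forall i, integr (F i)) -> integr (fun x => \sum_(i <- s) F i x).
Proof.
move=> h; elim: s => [|i s IH].
  by under eq_fun do rewrite big_nil; exact: integr_cst.
by under eq_fun do rewrite big_cons; exact: integrD.
Qed.

Lemma RintZ a f : integr f ->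
  \int[mu]_x (a * f x) = a * \int[mu]_x f x.
Proof. by move=> ?; rewrite RintegralZl. Qed.

Lemma RintD f g : integr f -> integr g ->
  \int[mu]_x (f x + g x) = \int[mu]_x f x + \int[mu]_x g x.
Proof. by move=> *; rewrite RintegralD. Qed.

Lemma RintN f : integr f -> \int[mu]_x (- f x) = - \int[mu]_x f x.
Proof.
by move=> h; rewrite -mulN1r -RintZ//; apply: eq_Rintegral => x _; rewrite mulN1r.
Qed.

Lemma RintB f g : integr f -> integr g ->
  \int[mu]_x (f x - g x) = \int[mu]_x f x - \int[mu]_x g x.
Proof. by move=> *; rewrite RintD ?RintN//; exact: integrN. Qed.

Lemma Rint_sum (I : Type) (s : seq I) (F : I -> T -> R) :
  (forall i, integr (F i)) ->
  \int[mu]_x (\sum_(i <- s) F i x) = \sum_(i <- s) \int[mu]_x F i x.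
Proof.
move=> h; elim: s => [|i s IH].
  under eq_Rintegral do rewrite big_nil; rewrite big_nil.
  by rewrite Rintegral_cst// mul0r.
under eq_Rintegral do rewrite big_cons; rewrite big_cons RintD ?IH//.
exact: integr_sum.
Qed.

Lemma Rint_ae f g : measurable_fun setT f -> measurable_fun setT g ->
  f = g %[ae mu] -> \int[mu]_x f x = \int[mu]_x g x.
Proof.
move=> mf mg fg; rewrite /Rintegral; congr fine.
apply: ae_eq_integral => //; try exact/measurable_EFinP.
by apply: filterS fg => x /(_ I) /= -> .
Qed.

Lemma integr_ae_le f g : measurable_fun setT f -> 
  (\forall x \ae mu, `|f x| <= g x) -> integr g -> integr f.
Proof.
move=> mf fg ig; apply: integrP => //.
move/integrableP : (ig) => [mg]; apply: le_lt_trans.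
apply: ae_ge0_le_integral => //.
- by apply/measurable_EFinP; exact: measurableT_comp.
- exact: measurableT_comp.
- by apply: filterS fg => x h _ /=; rewrite lee_fin (le_trans h)// ler_norm.
Qed.

Lemma sqint_mul f g : sqint f -> sqint g -> integr (fun x => f x * g x).
Proof.
move=> [mf f2] [mg g2]; apply: (integr_le _ _ (integrD f2 g2)).
  exact: measurable_funM.
move=> x; rewrite normrM -(real_normK (num_real (f x))) -(real_normK (num_real (g x))).
have := sqr_ge0 (`|f x| - `|g x|); have := sqr_ge0 (`|f x| + `|g x|).
by rewrite sqrrD sqrrB; lra.
Qed.

Lemma sqint_cst a : sqint (fun=> a).
Proof. by split; [exact: measurable_cst|exact: integr_cst]. Qed.

Lemma sqint_integr f : sqint f -> integr f.
Proof.
by move=> h; have := sqint_mul h (sqint_cst 1); under eq_fun do rewrite mulr1.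
Qed.

Lemma sqintZ a f : sqint f -> sqint (fun x => a * f x).
Proof.
move=> [mf f2]; split; first by apply: measurable_funM => //; exact: measurable_cst.
by under eq_fun do rewrite exprMn; exact: integrZ.
Qed.

Lemma sqintD f g : sqint f -> sqint g -> sqint (fun x => f x + g x).
Proof.
move=> hf hg; split; first by apply: measurable_funD; [case: hf|case: hg].
have := integrD (integrD hf.2 hg.2) (integrZ 2 (sqint_mul hf hg)).
by congr integr; apply/funext => x; ring.
Qed.

Lemma sqintN f : sqint f -> sqint (fun x => - f x).
Proof. by move=> h; have := sqintZ (-1) h; under eq_fun do rewrite mulN1r. Qed.

Lemma sqintB f g : sqint f -> sqint g -> sqint (fun x => f x - g x).
Proof. by move=> hf hg; exact: (sqintD hf (sqintN hg)). Qed.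

Lemma sqint_bounded_mul M f g : measurable_fun setT f ->
  (\forall x \ae mu, `|f x| <= M) -> sqint g -> sqint (fun x => f x * g x).
Proof.
move=> mf fM [mg g2]; split; first exact: measurable_funM.
apply: (integr_ae_le _ _ (integrZ (M ^+ 2) g2)).
  by apply: measurable_funX; exact: measurable_funM.
apply: filterS fM => x fx; rewrite ger0_norm ?sqr_ge0// exprMn ler_wpM2r ?sqr_ge0//.
by rewrite -(real_normK (num_real (f x))) lerXn2r// ?nnegrE// (le_trans _ fx).
Qed.

Lemma sqint0_ae f : sqint f -> \int[mu]_x (f x ^+ 2) = 0 -> f = (fun=> 0) %[ae mu].
Proof.
move=> [mf f2] h.
have m2 : measurable_fun setT (EFin \o (fun x => f x ^+ 2)).
  by apply/measurable_EFinP; exact: measurable_funX.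
have e0 : (\int[mu]_x `|(f x ^+ 2)%:E| = 0)%E.
  rewrite (_ : \int[mu]_x `|_| = \int[mu]_x (f x ^+ 2)%:E)%E; last first.
    by apply: eq_integral => x _; rewrite gee0_abs// lee_fin sqr_ge0.
  have /fineK <- : (\int[mu]_x (f x ^+ 2)%:E \is a fin_num)%E.
    exact: integrable_fin_num.
  by congr EFin.
have := (ae_eq_integral_abs mu measurableT m2).1 e0.
apply: filterS => x /(_ I) /= [] /eqP; rewrite expf_eq0 /= => /eqP -> //.
Qed.

(** An L^1 bound from an L^2 bound without square roots. For e = 2^k and an integral of the square
    at most 4^-k, both terms are of order 2^-k. *)
Lemma sqint_sq_le e f : sqint f -> 0 < e ->
  \int[mu]_x `|f x| <= e * \int[mu]_x (f x ^+ 2) + e^-1 * fine (mu setT).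
Proof.
move=> sf e0.
have ia : integr (fun x => `|f x|).
  have := sqint_integr sf => /integrable_norm; exact.
have i1 : integr (fun x => e * f x ^+ 2) by exact: integrZ sf.2.
have -> : e^-1 * fine (mu setT) = \int[mu]_x (fun=> e^-1) x.
  by rewrite Rintegral_cst.
rewrite -RintZ ?sf.2// -RintD//; last exact: integr_cst.
  apply: le_Rintegral => //; first by apply: integrD => //; exact: integr_cst.
  move=> x _; rewrite -(real_normK (num_real (f x))).
  have := sqr_ge0 (e * `|f x| - 1); have e1 : 0 < e^-1 by rewrite invr_gt0.
  have : 0 <= `|f x| by [].
  move: (`|f x|) => a a0 h.
  (* Expanding this nonnegative quantity gives e a^2 + e^-1 - a. *)
  suff : 0 <= e^-1 * ((e * a - 1) ^+ 2 + e * a).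
    by have -> : e^-1 * ((e * a - 1) ^+ 2 + e * a) = e * a ^+ 2 + e^-1 - a;
      [by field; rewrite lt0r_neq0 | lra].
  by rewrite mulr_ge0 ?(ltW e1)// addr_ge0// mulr_ge0// ltW.
Qed.

(** Summing the thresholds N i + 1 for i up to k gives at once monotonicity, a value at least k, and
    a value beyond N k. *)
Lemma subsequence_exists (P : nat -> nat -> Prop) :
  (forall k, exists N, forall n, (N <= n)%N -> P k n) ->
  exists phi : nat -> nat, [/\ forall k, (phi k <= phi k.+1)%N,
    forall k, (k <= phi k)%N & forall k n, (phi k <= n)%N -> P k n].
Proof.
move=> /choice[N NP]; exists (fun k => \sum_(i < k.+1) (N i).+1)%N; split.
- by move=> k; rewrite [leqRHS]big_ord_recr leq_addr.
- elim=> // k IH; rewrite big_ord_recr /= addnS ltnS.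
  by rewrite (leq_trans IH)// leq_addr.
- move=> k n h; apply: NP; apply: leq_trans h.
  by rewrite big_ord_recr /= addnS (leq_trans (leq_addl _ _) (leqnSn _)).
Qed.

(** The sum of the increments in absolute value has finite integral, hence is finite a.e.; there the
    telescoping series converges absolutely. *)
Lemma ae_cvg_of_fast_L1 (v : nat -> T -> R) :
  (forall k, sqint (v k)) ->
  (forall k, \int[mu]_x `|v k.+1 x - v k x| <= 2 ^- k * (1 + fine (mu setT))) ->
  \forall x \ae mu, cvgn (v ^~ x).
Proof.
move=> sv hv.
pose g k x := (`|v k.+1 x - v k x|)%:E.
have ig k : integr (fun x => `|v k.+1 x - v k x|).
  have /integrable_norm := sqint_integr (sqintB (sv k.+1) (sv k)); exact.
have mg k : measurable_fun setT (g k) by case/integrableP : (ig k).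
pose G x := (\sum_(0 <= k <oo) g k x)%E.
have G0 x : (0 <= G x)%E by apply: nneseries_ge0 => k _ _; rewrite lee_fin.
have mG : measurable_fun setT G.
  by apply: ge0_emeasurable_sum => // k x _ _; rewrite lee_fin.
have iG : mu.-integrable setT G.
  apply/integrableP; split => //.
  under eq_integral do rewrite gee0_abs//.
  rewrite integral_nneseries//; last by move=> k x _; rewrite lee_fin.
  pose c := 2 * (1 + fine (mu setT)).
  (* The factor 2 in c compensates the exponent k + 1 of the standard geometric series. *)
  apply: (@le_lt_trans _ _ (\sum_(0 <= k <oo) (c / (2 ^ (k + 1))%:R)%:E)%E).
    apply: lee_nneseries.
      by move=> k _ _; apply: integral_ge0 => x _; rewrite lee_fin.
    move=> k _; have /fineK <- : (\int[mu]_x g k x \is a fin_num)%E.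
      by apply: integrable_fin_num => //; exact: ig.
    rewrite lee_fin (le_trans (hv k))// addn1 natrX exprS invfM mulrA.
    by rewrite [c / 2]mulrAC mulfV ?pnatr_eq0// mul1r mulrC.
  have /cvg_lim -> // := @cvg_geometric_eseries_half R c 0.
  by rewrite ltry.
have := integrable_ae measurableT iG.
apply: filterS => x /(_ I) Gfin.
have /normed_cvg/cvg_ex[/= l hl] : cvgn (series (fun k => `|v k.+1 x - v k x|)).
  apply: nnseries_is_cvg => //.
  by rewrite ltey; move: Gfin; rewrite fin_numE => /andP[].
apply/cvg_ex; exists (v 0 x + l).
rewrite (_ : v ^~ x = fun n => v 0 x + series (telescope (v ^~ x)) n).
  by apply: cvgD => //; exact: cvg_cst.
by apply/funext => n; rewrite -eq_sum_telescope.
Qed.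

Lemma limn_einf_le (w : nat -> \bar R) e : (forall k, (w k <= e)%E) ->
  (limn_einf w <= e)%E.
Proof.
move=> h; rewrite limn_einf_lim; apply: lime_le; first exact: is_cvg_einfs.
by apply: nearW => n; apply: le_trans (h n); apply: ereal_inf_lbound; exists n => /=.
Qed.

(** Riesz-Fischer: a rapidly converging subsequence has an a.e. limit, and Fatou's lemma upgrades
    this to L^2 convergence of the whole sequence. *)
Lemma sqint_complete (u : nat -> T -> R) : (forall n, sqint (u n)) ->
  (forall e : R, 0 < e -> exists N, forall m n, (N <= m)%N -> (N <= n)%N ->
     \int[mu]_x ((u m x - u n x) ^+ 2) <= e) ->
  exists f, sqint f /\ forall e : R, 0 < e -> exists N, forall n, (N <= n)%N ->
     \int[mu]_x ((u n x - f x) ^+ 2) <= e.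
Proof.
move=> su cu.
have [|phi [phiS phige phiP]] := @subsequence_exists
  (fun k n => forall m, (n <= m)%N -> \int[mu]_x ((u m x - u n x) ^+ 2) <= 4 ^- k).
  move=> k; have [|N hN] := cu (4 ^- k); first by rewrite invr_gt0 exprn_gt0.
  by exists N => n Nn m nm; apply: hN => //; exact: leq_trans nm.
pose v k := u (phi k).
have cv : \forall x \ae mu, cvgn (v ^~ x).
  apply: ae_cvg_of_fast_L1 => [k|k]; first exact: su.
  have e0 : 0 < 2 ^+ k :> R by rewrite exprn_gt0.
  apply: le_trans (sqint_sq_le (sqintB (su (phi k.+1)) (su (phi k))) e0) _.
  rewrite mulrDr mulr1 lerD2r.
  apply: (@le_trans _ _ (2 ^+ k * 4 ^- k)).
    by rewrite ler_wpM2l ?exprn_ge0// phiP.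
  have -> : 2 ^+ k * 4 ^- k = 2 ^- k :> R; last by [].
  by rewrite -exprVn -exprMn -exprVn; congr (_ ^+ _); field.
(* An upper limit exists at every point and is measurable; it is the limit wherever the subsequence
   converges. *)
pose f x := fine (limn_esup (fun k => (v k x)%:E)).
have mv k : measurable_fun setT (v k) by case: (su (phi k)).
have mf : measurable_fun setT f.
  apply: measurableT_comp; first exact: fine_measurable.
  by apply: measurable_fun_limn_esup => k; exact/measurable_EFinP.
have vf : \forall x \ae mu, v ^~ x @ \oo --> f x.
  apply: filterS cv => x /cvg_ex[/= l vl].
  have /cvg_limn_einf_sup[_ h] : (fun k => (v k x)%:E) @ \oo --> l%:E.
    by apply: cvg_EFin => //; exact: nearW.
  by rewrite /f h.
(* Fatou in the second index. The shift k + N makes every index of the subsequence at least N, so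
   the hypothesis applies to all terms. *)
have key N e : (forall m n, (N <= m)%N -> (N <= n)%N ->
     \int[mu]_x ((u m x - u n x) ^+ 2) <= e) -> forall n, (N <= n)%N ->
    (\int[mu]_x ((u n x - f x) ^+ 2)%:E <= e%:E)%E.
  move=> hN n Nn.
  pose w k x := ((u n x - v (k + N)%N x) ^+ 2)%:E.
  have mw k : measurable_fun setT (w k).
    apply/measurable_EFinP/measurable_funX/measurable_funB => //.
    by case: (su n).
  rewrite (@ge0_ae_eq_integral _ _ _ mu setT _ (fun x => limn_einf (w ^~ x)))//.
  - apply: (le_trans (fatou mu measurableT mw _)).
      by move=> k x _; rewrite lee_fin sqr_ge0.
    apply: limn_einf_le => k.
    have /fineK <- : (\int[mu]_x w k x \is a fin_num)%E.
      apply: integrable_fin_num => //; exact: (sqintB (su n) (su _)).2.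
    rewrite lee_fin; apply: hN => //.
    exact: leq_trans (leq_addl k N) (phige _).
  - apply/measurable_EFinP/measurable_funX/measurable_funB => //.
    by case: (su n).
  - have -> : (fun x => limn_einf (w ^~ x)) =
        (fun x => - limn_esup (fun k => - w k x))%E.
      apply/funext => x; rewrite -limn_einfN; congr limn_einf.
      by apply/funext => k; rewrite [RHS]oppeK.
    apply: measurableT_comp => //; apply: measurable_fun_limn_esup => k.
    exact: measurableT_comp.
  - by move=> x _; rewrite lee_fin sqr_ge0.
  - move=> x _; rewrite limn_einf_lim; apply: lime_ge; first exact: is_cvg_einfs.
    by apply: nearW => k; apply: le_ereal_inf_tmp => _ [j _ <-]; rewrite lee_fin sqr_ge0.
  - apply: filterS vf => x vx _.
    suff /cvg_limn_einf_sup[-> _] : w ^~ x @ \oo --> ((u n x - f x) ^+ 2)%:E by [].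
    apply: cvg_EFin; first exact: nearW.
    rewrite (_ : fine \o w ^~ x = (fun k => (u n x - v (k + N)%N x) ^+ 2))//.
    have h : (fun k => u n x - v k x) @ \oo --> u n x - f x.
      by apply: cvgB => //; exact: cvg_cst.
    have h2 : (fun k => (u n x - v k x) ^+ 2) @ \oo --> (u n x - f x) ^+ 2.
      rewrite expr2 (_ : (fun k => _) = (fun k => u n x - v k x) \* (fun k => u n x - v k x)).
        exact: (cvgM h h).
      by apply/funext => k /=; rewrite expr2.
    exact: (cvg_comp _ _ (@cvg_addnr N) h2).
have sf : sqint f.
  have [N hN] := cu 1 ltr01.
  have suf : sqint (fun x => u N x - f x).
    split; first by apply: measurable_funB => //; case: (su N).
    apply: integrP.
      by apply/measurable_funX/measurable_funB => //; case: (su N).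
    under eq_integral do rewrite ger0_norm ?sqr_ge0//.
    by rewrite (le_lt_trans (key _ _ hN _ (leqnn _)))// ltry.
  have := sqintB (su N) suf.
  by under eq_fun do rewrite opprB addrC subrK.
exists f; split => // e /cu[N hN]; exists N => n Nn.
have := key _ _ hN _ Nn.
have /fineK <- : (\int[mu]_x ((u n x - f x) ^+ 2)%:E \is a fin_num)%E.
  by apply: integrable_fin_num => //; exact: (sqintB (su n) sf).2.
by rewrite lee_fin.
Qed.

End SquareIntegrable.

(** * Integration on the circle *)

Section CircleMeasure.
Variable R : realType.
Local Notation m := (circle_measure R).
Local Notation leb := (@lebesgue_measure R).
Local Notation cpoint := (@Defs.cpoint R).

Lemma circle_measureT : m setT = 1%E.
Proof.
rewrite /circle_measure /pushforward preimage_setT /mrestr setTI.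
by rewrite lebesgue_measure_itv /= lte_fin ltr01 oppr0 adde0.
Qed.

Let circle_measure_fin : fin_num_fun m.
Proof.
by apply: lty_fin_num_fun => /=; rewrite circle_measureT ltry.
Qed.

HB.instance Definition _ := Measure_isFinite.Build _ _ _ m circle_measure_fin.

Lemma circle_measurableP d (T : measurableType d) (f : circle R -> T) :
  measurable_fun [set: measurableTypeR R] (f \o cpoint) ->
  measurable_fun setT f.
Proof.
move=> mf _ A mA; rewrite setTI /measurable/= /circle_measurable /image_set_system/=.
exact: mf measurableT A mA.
Qed.

Lemma circle_ge0_integral (f : circle R -> \bar R) :
  measurable_fun setT f -> (forall z, 0 <= f z)%E ->
  (\int[m]_z f z = \int[leb]_(t in `[0%R, 1%R[) f (cpoint t))%E.
Proof.
move=> mf f0.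
have mfc : measurable_fun [set: measurableTypeR R] (f \o cpoint).
  by apply: measurableT_comp => //; exact: Defs.measurable_cpoint.
pose mr : {measure set (measurableTypeR R) -> \bar R} :=
  mrestr leb (@measurable_itv01 R).
rewrite (@ge0_integral_pushforward _ _ _ _ _ _ (@Defs.measurable_cpoint R) mr setT f)//.
rewrite preimage_setT.
rewrite (@ge0_negligible_integral _ _ _ mr setT (~` `[0, 1[))//; first last.
- by rewrite /mr /= /mrestr setICl measure0.
- by move=> t _; exact: f0.
- by apply: measurableC; exact: measurable_itv01.
rewrite setTD setCK; apply: eq_measure_integral => A mA A01.
by rewrite /mr /= /mrestr setIidl.
Qed.

Lemma circle_integral (f : circle R -> \bar R) : measurable_fun setT f ->
  (\int[m]_z f z = \int[leb]_(t in `[0%R, 1%R[) f (cpoint t))%E.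
Proof.
move=> mf; rewrite integralE [RHS]integralE.
have e1 : ((fun t => f (cpoint t))^\+ = f^\+ \o cpoint)%E.
  exact: (@funepos_comp _ _ _ f cpoint).
have e2 : ((fun t => f (cpoint t))^\- = f^\- \o cpoint)%E.
  exact: (@funeneg_comp _ _ _ f cpoint).
rewrite e1 e2 !circle_ge0_integral//.
- exact: measurable_funeneg.
- exact: measurable_funepos.
Qed.

(** A null cover of the pulled-back exceptional set need not be the preimage of a subset of the
    circle. The exceptional set, being measurable, therefore serves as its own cover. *)
Lemma circle_ae (P : circle R -> Prop) : measurable [set z | ~ P z] ->
  {ae leb, forall t : R, `[0, 1[%classic t -> P (cpoint t)} -> {ae m, forall z, P z}.
Proof.
move=> mP h; exists [set z | ~ P z]; split => //.
rewrite /circle_measure /pushforward /mrestr.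
apply/eqP; rewrite eq_le measure_ge0 andbT.
have [N [mN N0 hN]] := h.
rewrite -N0; apply: le_measure; rewrite ?inE//.
  apply: measurableI => //; rewrite -[X in measurable X]setTI.
  exact: Defs.measurable_cpoint.
by move=> t [/= nP t01]; apply: hN => /= /(_ t01).
Qed.

Lemma Re_cpointX (t : R) n :
  sval (cpoint t) ^+ n = (cos (2 * pi * n%:R * t) +i* sin (2 * pi * n%:R * t))%C.
Proof.
elim: n => [|n IH]; first by rewrite expr0 mulr0 mul0r cos0 sin0.
rewrite exprS IH /=; have -> : 2 * pi * n.+1%:R * t = 2 * pi * t + 2 * pi * n%:R * t.
  by rewrite -natr1; ring.
by rewrite cosD sinD; apply: complex_eq => /=; ring.
Qed.

Lemma measurable_cos_comp (f : R -> R) : measurable_fun setT f ->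
  measurable_fun setT (fun t => cos (f t)).
Proof.
move=> mf; apply: (measurableT_comp _ mf).
by apply: continuous_measurable_fun; exact: continuous_cos.
Qed.

Lemma measurable_Re_circle : measurable_fun setT (fun z : circle R => complex.Re (sval z)).
Proof.
apply: circle_measurableP => /=.
rewrite (_ : _ \o _ = fun t : R => cos (2 * pi * t))//.
apply: measurable_cos_comp; apply: measurable_funM => //; exact: measurable_cst.
Qed.

Lemma measurable_Im_circle : measurable_fun setT (fun z : circle R => complex.Im (sval z)).
Proof.
apply: circle_measurableP => /=.
rewrite (_ : _ \o _ = @sin R \o (fun t : R => (2 * pi * t)))//.
apply: measurableT_comp; first by apply: continuous_measurable_fun; exact: continuous_sin.
apply: measurable_funM => //; exact: measurable_cst.
Qed.

Lemma integral_derive01 (f F : R -> R) : continuous f ->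
  (forall t, is_derive (t : R) (1 : R) F (f t)) ->
  (\int[leb]_(t in `[0%R, 1%R[) (f t)%:E = (F 1 - F 0)%:E)%E.
Proof.
move=> cf dF; have cF : continuous F.
  by move=> t; apply/differentiable_continuous/derivable1_diffP; case: (dF t).
rewrite integral_itv_bndo_bndc; last first.
  by apply/measurable_EFinP; apply: measurable_funTS; exact: continuous_measurable_fun.
rewrite (@continuous_FTC2 _ f F)//.
- exact: continuous_subspaceT.
- split.
  + by move=> t _; case: (dF t).
  + exact/cvg_at_right_filter/cF.
  + exact/cvg_at_left_filter/cF.
- by move=> t _; rewrite derive1E; case: (dF t).
Qed.

Lemma cos_2pi_nat n : cos (2 * pi * n%:R) = 1 :> R.
Proof.
have := periodicn (@cosD2pi R) n 0; rewrite add0r cos0 => h; rewrite -[RHS]h.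
by congr cos; rewrite mulr_natr mulr_natl.
Qed.

Lemma sin_2pi_nat n : sin (2 * pi * n%:R) = 0 :> R.
Proof.
have := periodicn (@sinD2pi R) n 0; rewrite add0r sin0 => h; rewrite -[RHS]h.
by congr sin; rewrite mulr_natr mulr_natl.
Qed.

Lemma integral_cos_nat n : (0 < n)%N ->
  (\int[leb]_(t in `[0%R, 1%R[) (cos (2 * pi * n%:R * t))%:E = 0)%E.
Proof.
move=> n0; pose w : R := 2 * pi * n%:R.
have w0 : w != 0 by rewrite !mulf_neq0 ?pnatr_eq0 -?lt0n// gt_eqF// pi_gt0.
have cf : continuous (fun t : R => cos (w * t)).
  move=> t; apply: continuous_comp; last exact: continuous_cos.
  exact: mulrl_continuous.
have dF (t : R) : is_derive t (1 : R) (fun t => sin (w * t) / w) (cos (w * t)).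
  apply: is_derive_eq; rewrite ?scaler0 ?add0r ?scaler1 /GRing.scale /=.
  by field.
rewrite (integral_derive01 cf dF).
by rewrite mulr1 mulr0 sin_2pi_nat sin0 mul0r subrr.
Qed.

Lemma integral_sin_nat n : (0 < n)%N ->
  (\int[leb]_(t in `[0%R, 1%R[) (sin (2 * pi * n%:R * t))%:E = 0)%E.
Proof.
move=> n0; pose w : R := 2 * pi * n%:R.
have w0 : w != 0 by rewrite !mulf_neq0 ?pnatr_eq0 -?lt0n// gt_eqF// pi_gt0.
have cf : continuous (fun t : R => sin (w * t)).
  move=> t; apply: continuous_comp; last exact: continuous_sin.
  exact: mulrl_continuous.
have dF (t : R) : is_derive t (1 : R) (fun t => - cos (w * t) / w) (sin (w * t)).
  apply: is_derive_eq; rewrite ?scaler0 ?add0r ?scaler1 /GRing.scale /=.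
  by field.
rewrite (integral_derive01 cf dF).
by rewrite mulr1 mulr0 cos_2pi_nat cos0 subrr.
Qed.

End CircleMeasure.

(** * Complex-valued integrals and the orthogonality of the powers of z *)

Section ComplexIntegral.
Variable R : realType.
Local Notation m := (circle_measure R).
Implicit Types f g : circle R -> R[i].

Definition cmeas f := measurable_fun setT (fun z => complex.Re (f z)) /\
  measurable_fun setT (fun z => complex.Im (f z)).
Definition cint f := integr m (fun z => complex.Re (f z)) /\
  integr m (fun z => complex.Im (f z)).
Definition csq f := sqint m (fun z => complex.Re (f z)) /\
  sqint m (fun z => complex.Im (f z)).

Lemma csq_cint f : csq f -> cint f.
Proof. by move=> [h1 h2]; split; exact: sqint_integr. Qed.

Lemma csq_cmeas f : csq f -> cmeas f.
Proof. by move=> [[h1 _] [h2 _]]. Qed.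

Lemma cint_cmeas f : cint f -> cmeas f.
Proof. by move=> [h1 h2]; split; [exact: (integr_measurable h1)|exact: (integr_measurable h2)]. Qed.

Lemma cmeasD f g : cmeas f -> cmeas g -> cmeas (fun z => f z + g z).
Proof.
move=> [f1 f2] [g1 g2]; split.
  by under eq_fun do rewrite ReD; exact: measurable_funD.
by under eq_fun do rewrite ImD; exact: measurable_funD.
Qed.

Lemma cmeasM f g : cmeas f -> cmeas g -> cmeas (fun z => f z * g z).
Proof.
move=> [f1 f2] [g1 g2]; split.
  by under eq_fun do rewrite ReM; apply: measurable_funB; exact: measurable_funM.
by under eq_fun do rewrite ImM; apply: measurable_funD; exact: measurable_funM.
Qed.

Lemma cmeas_conj f : cmeas f -> cmeas (fun z => (f z)^*).
Proof.
move=> [f1 f2]; split; first by under eq_fun do rewrite Re_conj.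
by under eq_fun do rewrite Im_conj; exact: measurable_funN.
Qed.

Lemma cmeas_cst a : cmeas (fun=> a).
Proof. by split; exact: measurable_cst. Qed.

Lemma cmeas_sum (I : Type) (s : seq I) (F : I -> circle R -> R[i]) :
  (forall i, cmeas (F i)) -> cmeas (fun z => \sum_(i <- s) F i z).
Proof.
move=> h; elim: s => [|i s IH].
  by under eq_fun do rewrite big_nil; exact: cmeas_cst.
by under eq_fun do rewrite big_cons; exact: cmeasD.
Qed.

Lemma cintD f g : cint f -> cint g -> cint (fun z => f z + g z).
Proof.
move=> [f1 f2] [g1 g2]; split.
  by under eq_fun do rewrite ReD; exact: integrD.
by under eq_fun do rewrite ImD; exact: integrD.
Qed.

Lemma cintZ a f : cint f -> cint (fun z => a * f z).
Proof.
move=> [f1 f2]; split.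
  by under eq_fun do rewrite ReM; apply: integrB; exact: integrZ.
by under eq_fun do rewrite ImM; apply: integrD; exact: integrZ.
Qed.

Lemma cint_cst a : cint (fun=> a).
Proof. by split; exact: integr_cst. Qed.

Lemma cint_sum (I : Type) (s : seq I) (F : I -> circle R -> R[i]) :
  (forall i, cint (F i)) -> cint (fun z => \sum_(i <- s) F i z).
Proof.
move=> h; elim: s => [|i s IH].
  by under eq_fun do rewrite big_nil; exact: cint_cst.
by under eq_fun do rewrite big_cons; exact: cintD.
Qed.

Lemma csqD f g : csq f -> csq g -> csq (fun z => f z + g z).
Proof.
move=> [f1 f2] [g1 g2]; split.
  by under eq_fun do rewrite ReD; exact: sqintD.
by under eq_fun do rewrite ImD; exact: sqintD.
Qed.

Lemma csqZ a f : csq f -> csq (fun z => a * f z).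
Proof.
move=> [f1 f2]; split.
  by under eq_fun do rewrite ReM; apply: sqintB; exact: sqintZ.
by under eq_fun do rewrite ImM; apply: sqintD; exact: sqintZ.
Qed.

Lemma csq_cst a : csq (fun=> a).
Proof. by split; exact: sqint_cst. Qed.

Lemma csq_conj f : csq f -> csq (fun z => (f z)^*).
Proof.
move=> [f1 f2]; split; first by under eq_fun do rewrite Re_conj.
by under eq_fun do rewrite Im_conj; exact: sqintN.
Qed.

Lemma csq_sum (I : Type) (s : seq I) (F : I -> circle R -> R[i]) :
  (forall i, csq (F i)) -> csq (fun z => \sum_(i <- s) F i z).
Proof.
move=> h; elim: s => [|i s IH].
  by under eq_fun do rewrite big_nil; exact: csq_cst.
by under eq_fun do rewrite big_cons; exact: csqD.
Qed.

Lemma csqM f g : csq f -> csq g -> cint (fun z => f z * g z).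
Proof.
move=> [f1 f2] [g1 g2]; split.
  by under eq_fun do rewrite ReM; apply: integrB; exact: sqint_mul.
by under eq_fun do rewrite ImM; apply: integrD; exact: sqint_mul.
Qed.

Lemma csq_bounded_mul M f g : cmeas f ->
  (\forall z \ae m, `|complex.Re (f z)| <= M /\ `|complex.Im (f z)| <= M) ->
  csq g -> csq (fun z => f z * g z).
Proof.
move=> [f1 f2] fM [g1 g2].
have M1 : \forall z \ae m, `|complex.Re (f z)| <= M by apply: filterS fM => z [].
have M2 : \forall z \ae m, `|complex.Im (f z)| <= M by apply: filterS fM => z [].
split.
  under eq_fun do rewrite ReM.
  by apply: sqintB; [exact: sqint_bounded_mul M1 _|exact: sqint_bounded_mul M2 _].
under eq_fun do rewrite ImM.
by apply: sqintD; [exact: sqint_bounded_mul M1 _|exact: sqint_bounded_mul M2 _].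
Qed.

Lemma cintegralD f g : cint f -> cint g ->
  cintegral (fun z => f z + g z) = cintegral f + cintegral g.
Proof.
move=> [f1 f2] [g1 g2]; apply: complex_eq; rewrite ?ReD ?ImD /=.
  by under eq_Rintegral do rewrite ReD; exact: RintD.
by under eq_Rintegral do rewrite ImD; exact: RintD.
Qed.

Lemma cintegralZ a f : cint f ->
  cintegral (fun z => a * f z) = a * cintegral f.
Proof.
move=> [f1 f2]; apply: complex_eq; rewrite ?ReM ?ImM /=.
  under eq_Rintegral do rewrite ReM.
  by rewrite RintB; [rewrite !RintZ|exact: integrZ..].
under eq_Rintegral do rewrite ImM.
by rewrite RintD; [rewrite !RintZ|exact: integrZ..].
Qed.

Lemma cintegral_conj f : cint f -> cintegral (fun z => (f z)^*) = (cintegral f)^*.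
Proof.
move=> [f1 f2]; apply: complex_eq; rewrite ?Re_conj ?Im_conj /=.
  by apply: eq_Rintegral => z _; rewrite Re_conj.
by under eq_Rintegral do rewrite Im_conj; exact: RintN.
Qed.

Lemma cintegral_cst a : cintegral (fun=> a : R[i]) = a.
Proof.
have h (b : R) : \int[m]_x b = b.
  rewrite Rintegral_cst// -[RHS]mulr1; congr (_ * _).
  by rewrite -[RHS]/(fine 1%E); congr fine; exact: circle_measureT.
by apply: complex_eq; rewrite /cintegral /= h.
Qed.

Lemma cintegral_sum (I : Type) (s : seq I) (F : I -> circle R -> R[i]) :
  (forall i, cint (F i)) ->
  cintegral (fun z => \sum_(i <- s) F i z) = \sum_(i <- s) cintegral (F i).
Proof.
move=> h; elim: s => [|i s IH].
  by under eq_fun do rewrite big_nil; rewrite big_nil cintegral_cst.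
under eq_fun do rewrite big_cons; rewrite big_cons cintegralD ?IH//.
exact: cint_sum.
Qed.

Lemma cintegral_ae f g : cmeas f -> cmeas g -> f = g %[ae m] ->
  cintegral f = cintegral g.
Proof.
move=> [f1 f2] [g1 g2] fg; apply: complex_eq => /=.
  by apply: Rint_ae => //; apply: filterS fg => z h /h ->.
by apply: Rint_ae => //; apply: filterS fg => z h /h ->.
Qed.

Lemma eq_cintegral f g : f =1 g -> cintegral f = cintegral g.
Proof. by move=> /funext ->. Qed.

Lemma circle_norm (z : circle R) : `|sval z| = 1.
Proof. by case: z => z /= /eqP. Qed.

Lemma circle_neq0 (z : circle R) : sval z != 0.
Proof. by rewrite -normr_eq0 circle_norm oner_eq0. Qed.

Lemma circle_unit (z : circle R) : sval z \is a GRing.unit.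
Proof. by rewrite unitfE circle_neq0. Qed.

Lemma circleX_norm (z : circle R) (n : int) : `|sval z ^ n| = 1.
Proof.
case: n => n; first by rewrite -exprnP normrX circle_norm expr1n.
by rewrite NegzE -exprnN normrV ?unitrX ?circle_unit// normrX circle_norm expr1n invr1.
Qed.

Lemma circleX_conj (z : circle R) (n : int) : (sval z ^ n)^* = sval z ^ (- n).
Proof.
have h : sval z ^ n != 0 by rewrite -normr_eq0 circleX_norm oner_eq0.
by rewrite -invr_expz; apply: (mulfI h); rewrite mulfV// -normCK circleX_norm expr1n.
Qed.

Lemma norm_parts (a : R[i]) : `|a| = 1 ->
  `|complex.Re a| <= 1 /\ `|complex.Im a| <= 1.
Proof.
move=> a1; have := add_Re2_Im2 a; rewrite a1 expr1n => /(congr1 (@complex.Re R)) /= h.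
have := sqr_ge0 (complex.Re a); have := sqr_ge0 (complex.Im a) => h1 h2.
by split; rewrite -(@ler_pXn2r _ 2%N) ?nnegrE// expr1n real_normK ?num_real//; lra.
Qed.

Lemma cmeas_circle : cmeas (fun z => sval z).
Proof. by split; [exact: measurable_Re_circle|exact: measurable_Im_circle]. Qed.

Lemma cmeas_circleX (n : int) : cmeas (fun z => sval z ^ n).
Proof.
have h k : cmeas (fun z => sval z ^+ k).
  elim: k => [|k IH]; first by under eq_fun do rewrite expr0; exact: cmeas_cst.
  by under eq_fun do rewrite exprS; apply: cmeasM => //; exact: cmeas_circle.
case: n => n; first exact: h.
have -> : (fun z : circle R => sval z ^ Negz n) = fun z => (sval z ^+ n.+1)^*.
  by apply/funext => z; rewrite exprnP circleX_conj NegzE.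
exact: cmeas_conj.
Qed.

Lemma csq_circleX_mul (n : int) f : csq f -> csq (fun z => sval z ^ n * f z).
Proof.
apply: (@csq_bounded_mul 1); first exact: cmeas_circleX.
by apply: nearW => z; apply: norm_parts => //; exact: circleX_norm.
Qed.

Lemma cint_bounded_mul M f g : cmeas f ->
  (forall z, `|complex.Re (f z)| <= M /\ `|complex.Im (f z)| <= M) ->
  cint g -> cint (fun z => f z * g z).
Proof.
move=> [f1 f2] fM [g1 g2].
have key (p q : circle R -> R) : measurable_fun setT p -> (forall z, `|p z| <= M) ->
    integr m q -> integr m (fun z => p z * q z).
  move=> mp pM iq; have iM : integr m (fun z => M * `|q z|).
    by apply: integrZ; have := integrable_norm iq; exact.
  apply: integr_le iM; first by apply: measurable_funM => //; exact: (integr_measurable iq).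
  by move=> z; rewrite normrM ler_wpM2r.
by split; [under eq_fun do rewrite ReM; apply: integrB
  | under eq_fun do rewrite ImM; apply: integrD]; apply: key => // z; have [] := fM z.
Qed.

Lemma cint_circleX_mul (n : int) f : cint f -> cint (fun z => sval z ^ n * f z).
Proof.
apply: (@cint_bounded_mul 1); first exact: cmeas_circleX.
by move=> z; apply: norm_parts => //; exact: circleX_norm.
Qed.

Lemma cintegral_circleX (n : int) : cintegral (fun z : circle R => sval z ^ n) = (n == 0)%:R.
Proof.
have h k : (0 < k)%N -> cintegral (fun z : circle R => sval z ^+ k) = 0.
  move=> k0; have [m1 m2] := cmeas_circleX k.
  apply: complex_eq; rewrite /cintegral /= /Rintegral circle_integral.
  - under eq_integral do rewrite Re_cpointX /=.
    by rewrite integral_cos_nat.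
  - exact/measurable_EFinP.
  - under eq_integral do rewrite Re_cpointX /=.
    by rewrite integral_sin_nat.
  - exact/measurable_EFinP.
case: n => [[|n]|n].
- by under eq_fun do rewrite expr0z; rewrite cintegral_cst.
- exact: h.
- have -> : (fun z : circle R => sval z ^ Negz n) = fun z => (sval z ^+ n.+1)^*.
    by apply/funext => z; rewrite exprnP circleX_conj NegzE.
  rewrite cintegral_conj ?h ?rmorph0//.
  have := cint_circleX_mul n.+1 (cint_cst 1).
  by under eq_fun do rewrite mulr1.
Qed.

End ComplexIntegral.

(** * Uniqueness of Fourier coefficients *)

Section StepPolynomials.
Variable R : realType.

(** Each of the n terms of 1 + b + ... + b^(n-1) is at least b^n; multiplying the sum by 1 - b gives
    1 - b^n. *)
Lemma natr_mul_expr_le (b : R) n : 0 <= b <= 1 ->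
  n%:R * b ^+ n * (1 - b) + b ^+ n <= 1.
Proof.
move=> /andP[b0 b1]; elim: n => [|n IH]; first by rewrite expr0 mul0r mul0r add0r.
have bn : 0 <= b ^+ n.+1 <= 1 by rewrite exprn_ge0// exprn_ile1.
have -> : n.+1%:R * b ^+ n.+1 * (1 - b) + b ^+ n.+1 =
    b * (n%:R * b ^+ n * (1 - b) + b ^+ n) + b ^+ n.+1 * (1 - b).
  by rewrite -natr1 exprS; ring.
apply: (@le_trans _ _ (b + b ^+ n.+1 * (1 - b))).
  by rewrite lerD2r ler_piMr.
by case/andP: bn => h1 h2; nra.
Qed.

Lemma bernoulli_ge (y : R) N : 0 <= y -> 1 + N%:R * y <= (1 + y) ^+ N.
Proof.
move=> y0; elim: N => [|N IH]; first by rewrite expr0 mul0r addr0.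
rewrite exprS; apply: (@le_trans _ _ ((1 + y) * (1 + N%:R * y))).
  have : 0 <= N%:R * y ^+ 2 by rewrite mulr_ge0// sqr_ge0.
  by rewrite -natr1; lra.
by rewrite ler_wpM2l// addr_ge0.
Qed.

Lemma bernoulli_le (y : R) N : 0 <= y <= 1 -> 1 - N%:R * y <= (1 - y) ^+ N.
Proof.
move=> /andP[y0 y1]; elim: N => [|N IH]; first by rewrite expr0 mul0r subr0.
rewrite exprS; apply: (@le_trans _ _ ((1 - y) * (1 - N%:R * y))).
  have : 0 <= N%:R * y ^+ 2 by rewrite mulr_ge0// sqr_ge0.
  by rewrite -natr1; lra.
by rewrite ler_wpM2l// subr_ge0.
Qed.

(* The exponent makes (n * 4 ^ n) * x ^ (2 * n) tend to 0 if x < 1/2 and to +oo if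
   x >= 1/2, so that Bernoulli's inequality gives the indicator of x < 1/2 in the
   limit. *)
Definition step_poly n (x : R) := (1 - x ^+ (2 * n)) ^+ (n * 4 ^ n).

Lemma step_poly_ge0 n (x : R) : 0 <= x <= 1 -> 0 <= step_poly n x <= 1.
Proof.
move=> /andP[x0 x1]; have h : 0 <= 1 - x ^+ (2 * n) <= 1.
  by rewrite subr_ge0 exprn_ile1//= gerBl exprn_ge0.
by case/andP: h => h1 h2; rewrite exprn_ge0//= exprn_ile1.
Qed.

Lemma step_poly_cvg (x : R) : 0 <= x <= 1 ->
  step_poly ^~ x @ \oo --> ((x < 2^-1)%R%:R : R).
Proof.
move=> /[dup] x01 /andP[x0 x1].
have y01 n : 0 <= x ^+ (2 * n) <= 1 by rewrite exprn_ge0// exprn_ile1.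
have y0 n : 0 <= x ^+ (2 * n) by case/andP: (y01 n).
have [x2|x2] := ltP x 2^-1.
  (* Then n 4^n x^(2n) = (n b^n) b^n. The first factor is at most 1 / (1 - b), the second tends to
     0. *)
  pose b := 2 * x; have b0 : 0 <= b by rewrite mulr_ge0.
  have b1 : b < 1 by rewrite /b; lra.
  have lb n : 1 - (1 - b)^-1 * b ^+ n <= step_poly n x.
    apply: le_trans (bernoulli_le (n * 4 ^ n) (y01 n)).
    rewrite lerD2l lerN2 natrM natrX -mulrA.
    have -> : 4 ^+ n * x ^+ (2 * n) = b ^+ n * b ^+ n.
      by rewrite exprM -!exprMn; congr (_ ^+ _); rewrite /b; ring.
    rewrite mulrA ler_wpM2r ?exprn_ge0// -[leRHS]mul1r ler_pdivlMr ?subr_gt0//.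
    have := @natr_mul_expr_le b n; rewrite b0 (ltW b1) => /(_ isT).
    by have := exprn_ge0 n b0; lra.
  apply: (@squeeze_cvgr _ _ _ _ (fun n => 1 - (1 - b)^-1 * b ^+ n) (fun=> 1)).
  - by apply: nearW => n; rewrite lb; case/andP: (@step_poly_ge0 n x x01).
  - rewrite -[X in _ --> X]subr0; apply: cvgB; first exact: cvg_cst.
    rewrite -(mulr0 (1 - b)^-1); apply: cvgM; first exact: cvg_cst.
    by apply: cvg_expr; rewrite ger0_norm.
  - exact: cvg_cst.
apply: (@squeeze_cvgr _ _ _ _ (fun=> 0) harmonic); last 2 first.
- exact: cvg_cst.
- exact: cvg_harmonic.
apply: nearW => n; case/andP: (@step_poly_ge0 n x x01) => -> _ /=.
rewrite -[leRHS]mul1r ler_pdivlMr ?ltr0n//.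
pose y := x ^+ (2 * n); pose N := (n * 4 ^ n)%N.
(* For x at least 1/2 the product 4^n x^(2n) is at least 1, so N y is at least n. *)
have nN : n.+1%:R <= 1 + N%:R * y.
  rewrite -natr1 addrC lerD2l natrM natrX -mulrA.
  rewrite -[leLHS]mulr1 ler_wpM2l//.
  rewrite /y exprM -exprMn exprn_ege1//.
  by have : 0 <= (x - 2^-1) * (x + 2^-1); [rewrite mulr_ge0; lra|rewrite expr2; lra].
(* The product is (1 - y^2)^N, at most 1, and the second factor is at least n + 1 by Bernoulli. *)
apply: (@le_trans _ _ ((1 - y) ^+ N * (1 + y) ^+ N)).
  rewrite ler_wpM2l ?(le_trans nN) ?bernoulli_ge// exprn_ge0// subr_ge0.
  by case/andP: (y01 n).
have := y01 n; rewrite -/y => /andP[h1 h2].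
by rewrite -exprMn exprn_ile1//; nra.
Qed.

End StepPolynomials.

Section FourierUniqueness.
Variable R : realType.
Local Notation m := (circle_measure R).
Variable f : circle R -> R[i].
Hypothesis fint : cint f.
Hypothesis f0 : forall n : int, cintegral (fun z => sval z ^ n * f z) = 0.

(** Bounded real multipliers q for which all Fourier coefficients of q f vanish. Quantifying over
    every n makes the class stable under multiplication by z and 1/z, which keeps trigonometric
    polynomials inside it. *)
Definition annihilating (q : circle R -> R) := [/\ measurable_fun setT q,
  exists M : R, forall z, `|q z| <= M &
  forall n : int, cintegral (fun z => sval z ^ n * ((q z)%:C%C * f z)) = 0].

Let cint_q (q : circle R -> R) (n : int) : measurable_fun setT q ->
  (exists M : R, forall z, `|q z| <= M) ->
  cint (fun z => sval z ^ n * ((q z)%:C%C * f z)).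
Proof.
move=> mq [M qM]; apply: cint_circleX_mul.
apply: (@cint_bounded_mul _ M (fun z => (q z)%:C%C) f) => //.
by move=> z; rewrite /= normr0 qM; split => //; apply: le_trans (qM z).
Qed.

Lemma annihilating1 : annihilating (fun=> 1).
Proof.
split; first exact: measurable_cst.
  by exists 1 => z; rewrite normr1.
by move=> n; under eq_fun do rewrite mul1r.
Qed.

Lemma annihilatingB q q' : annihilating q -> annihilating q' ->
  annihilating (fun z => q z - q' z).
Proof.
move=> [mq bq hq] [mq' bq' hq']; split; first exact: measurable_funB.
  have [M hM] := bq; have [M' hM'] := bq'; exists (M + M') => z.
  by rewrite (le_trans (ler_normB _ _))// lerD.
move=> n.
transitivity (cintegral (fun z => sval z ^ n * ((q z)%:C%C * f z) +
   (-1) * (sval z ^ n * ((q' z)%:C%C * f z)))).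
  by apply: eq_cintegral => z; rewrite rmorphB /=; ring.
rewrite cintegralD; [|exact: cint_q|exact/cintZ/cint_q].
by rewrite cintegralZ ?hq ?hq' ?mulr0 ?addr0//; exact: cint_q.
Qed.

Definition trig1 (a k : R) (w : R[i]) (z : circle R) : R :=
  a + k * complex.Re (sval z * w).

(** Since Re (z w) is half of z w plus its conjugate, the new coefficient combines those of index n,
    n + 1 and n - 1. *)
Lemma annihilating_trig1 a k w q : annihilating q ->
  annihilating (fun z => trig1 a k w z * q z).
Proof.
move=> [mq bq hq]; have [M qM] := bq.
have b1 z : `|trig1 a k w z| <= `|a| + `|k| * (`|complex.Re w| + `|complex.Im w|).
  rewrite (le_trans (ler_normD _ _))// lerD2l normrM ler_wpM2l// ReM.
  rewrite (le_trans (ler_normB _ _))// !normrM.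
  by have [h1 h2] := norm_parts (circle_norm z); rewrite lerD// ler_piMl.
split.
- apply: measurable_funM => //; apply: measurable_funD; first exact: measurable_cst.
  apply: measurable_funM; first exact: measurable_cst.
  by have [] := cmeasM (@cmeas_circle R) (@cmeas_cst R w).
- exists ((`|a| + `|k| * (`|complex.Re w| + `|complex.Im w|)) * M) => z.
  by rewrite normrM ler_pM.
- move=> n.
  pose F j z := sval z ^ j * ((q z)%:C%C * f z).
  have iF j : cint (F j) by exact: cint_q.
  transitivity (cintegral (fun z => a%:C%C * F n z +
     ((k / 2)%:C%C * w * F (n + 1) z + (k / 2)%:C%C * w^* * F (n - 1) z))).
    apply: eq_cintegral => z; rewrite /F !expfzDr ?circle_neq0// expr1z.
    rewrite -[sval z ^ (-1)]circleX_conj expr1z /trig1.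
    set y := sval z ^ n.
    have e (c : R[i]) : (a + k * complex.Re c)%:C%C = a%:C%C + (k / 2)%:C%C * (c + c^*).
      by apply: complex_eq; rewrite ?(ReD, ImD, ReM, ImM, Re_conj, Im_conj)/=; field.
    by rewrite rmorphM /= e rmorphM /=; ring.
  have hF j : cintegral (F j) = 0 by exact: hq.
  rewrite cintegralD; [|exact: cintZ|by apply: cintD; exact: cintZ].
  rewrite cintegralD; [|exact: cintZ..].
  by rewrite !cintegralZ// !hF !mulr0 !addr0.
Qed.

(** Multiplying p by 1 - t^(2n) means subtracting t^(2n) p from p, so induction on the outer
    exponent suffices. *)
Lemma annihilating_step a k w n :
  annihilating (fun z => step_poly n (trig1 a k w z)).
Proof.
have pow q j : annihilating q -> annihilating (fun z => trig1 a k w z ^+ j * q z).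
  move=> hq; elim: j => [|j IH]; first by under eq_fun do rewrite expr0 mul1r.
  by under eq_fun do rewrite exprS -mulrA; exact: annihilating_trig1.
rewrite /step_poly; elim: (n * 4 ^ n)%N => [|j IH].
  by under eq_fun do rewrite expr0; exact: annihilating1.
have := annihilatingB IH (pow _ (2 * n)%N IH).
by under eq_fun do rewrite -{1}[X in X - _]mul1r -mulrBl -exprS.
Qed.

(** Dominated convergence along [step_poly], with |p (f z)| as dominating function. The parameter p
    treats real and imaginary parts at once. *)
Lemma integral_trig1_lt a k w (p : R[i] -> R) : (p = @complex.Re R \/ p = @complex.Im R) ->
  (forall z, 0 <= trig1 a k w z <= 1) ->
  measurable_fun setT (fun z => (trig1 a k w z < 2^-1)%R%:R * p (f z)) /\
  (\int[m]_z ((trig1 a k w z < 2^-1)%R%:R * p (f z))%:E = 0)%E.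
Proof.
move=> pE t01.
have ip : integr m (fun z => p (f z)) by case: fint => i1 i2; case: pE => ->.
have mp := integr_measurable ip.
have mt : measurable_fun setT (trig1 a k w).
  have [+ _ _] := annihilating_trig1 a k w annihilating1.
  by under eq_fun do rewrite mulr1.
have P0 n : (\int[m]_z (step_poly n (trig1 a k w z) * p (f z))%:E = 0)%E.
  have [mq bq /(_ 0)] := annihilating_step a k w n.
  have := cint_q 0 mq bq.
  under [X in cint X]eq_fun do rewrite expr0z mul1r.
  under [X in cintegral X]eq_fun do rewrite expr0z mul1r.
  move=> iq h; have iqp : integr m (fun z => step_poly n (trig1 a k w z) * p (f z)).
    case: iq => i1 i2; case: pE => ->.
      by move: i1; under eq_fun do rewrite ReM /= mul0r subr0.
    by move: i2; under eq_fun do rewrite ImM /= mul0r addr0.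
  have /fineK <- : (\int[m]_z (step_poly n (trig1 a k w z) * p (f z))%:E \is a fin_num)%E.
    by apply: integrable_fin_num => //; exact: iqp.
  congr EFin; case: pE => ->.
    have := congr1 (@complex.Re R) h; rewrite /= => <-.
    by apply: eq_Rintegral => z _; rewrite ReM /= mul0r subr0.
  have := congr1 (@complex.Im R) h; rewrite /= => <-.
  by apply: eq_Rintegral => z _; rewrite ImM /= mul0r addr0.
pose F n z := (step_poly n (trig1 a k w z) * p (f z))%:E.
have mF n : measurable_fun setT (F n).
  apply/measurable_EFinP; apply: measurable_funM => //.
  by have [] := annihilating_step a k w n.
have cF z : F ^~ z @ \oo --> ((trig1 a k w z < 2^-1)%R%:R * p (f z))%:E.
  apply: cvg_EFin; first exact: nearW.
  apply: cvgM; last exact: cvg_cst.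
  exact: step_poly_cvg.
have mL : measurable_fun setT
    (fun z => ((trig1 a k w z < 2^-1)%R%:R * p (f z))%:E).
  by apply: (emeasurable_fun_cvg _ _ mF) => z _; exact: cF.
split; first exact/measurable_EFinP.
have [] := @dominated_convergence _ _ _ m setT measurableT F
  (fun z => ((trig1 a k w z < 2^-1)%R%:R * p (f z))%:E) (fun z => `|p (f z)|%:E).
- exact: mF.
- exact: mL.
- by apply: nearW => z _; exact: cF.
- by have := integrable_norm ip; exact.
- apply: nearW => z n _; rewrite lee_fin normrM ler_piMl//.
  by have /andP[h1 h2] := step_poly_ge0 n (t01 z); rewrite ger0_norm.
move=> _ _; under eq_fun do rewrite P0.
by move=> /cvg_lim <- //; rewrite lim_cst.
Qed.

End FourierUniqueness.

(** * From integrals over arcs to vanishing almost everywhere *)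

Section ArcIndicators.
Variable R : realType.
Local Notation m := (circle_measure R).
Local Notation leb := (@lebesgue_measure R).
Local Notation cpoint := (@Defs.cpoint R).

(* cos (2 pi (t - c)), with c the midpoint of ]a, b[, exceeds its value at the
   endpoints exactly on ]a, b[; the affine rescaling sends that value to the
   threshold 1/2 of step_poly and stays in [0, 1]. *)
Definition arc (a b : R) : circle R -> R :=
  trig1 (2^-1 + cos (2 * pi * ((b - a) / 2)) / 4) (- 4^-1)
    (sval (cpoint ((a + b) / 2)))^*.

Lemma arc_cpoint a b t : arc a b (cpoint t) =
  2^-1 - (cos (2 * pi * (t - (a + b) / 2)) - cos (2 * pi * ((b - a) / 2))) / 4.
Proof. by rewrite /arc /trig1 ReM Re_conj Im_conj /= [in RHS]mulrBr cosB; field. Qed.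

Lemma arc01 a b z : 0 <= arc a b z <= 1.
Proof.
rewrite /arc /trig1.
have := cos_geN1 (2 * pi * ((b - a) / 2)); have := cos_le1 (2 * pi * ((b - a) / 2)).
have [|] := @norm_parts _ (sval z * (sval (cpoint ((a + b) / 2)))^*).
  by rewrite normrM norm_conjC !circle_norm mulr1.
by rewrite ler_norml => /andP[h1 h2] _ h3 h4; apply/andP; split; lra.
Qed.

(** Compares cosines at the distance s from t to the midpoint and at the half-length d, using that
    cosine decreases on [0, pi]. *)
Lemma arc_lt a b t : 0 <= a -> a < b -> b <= 1 -> 0 <= t < 1 ->
  (arc a b (cpoint t) < 2^-1) = (a < t < b).
Proof.
move=> a0 ab b1 /andP[t0 t1].
pose c := (a + b) / 2; pose d := (b - a) / 2; pose s := `|t - c|.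
have pi0 := pi_gt0 R.
have -> : (arc a b (cpoint t) < 2^-1) = (cos (2 * pi * d) < cos (2 * pi * s)).
  rewrite arc_cpoint -/c -/d -[cos (2 * pi * (t - c))]cos_norm normrM ger0_norm; last first.
    by rewrite mulr_ge0// ltW.
  by rewrite -/s; apply/idP/idP; lra.
have -> : (a < t < b) = (s < d).
  by rewrite /s ltr_norml /c /d; apply/andP/andP => -[h1 h2]; split; lra.
have d0 : 0 < d <= 2^-1 by rewrite /d; lra.
have s0 : 0 <= s by exact: normr_ge0.
have s1 : s <= 1 - d by rewrite /s ler_norml /c /d; lra.
have dI : 2 * pi * d \in `[0, pi].
  by rewrite in_itv /=; apply/andP; split; nra.
have [s2|s2] := leP s 2^-1.
  have sI : 2 * pi * s \in `[0, pi] by rewrite in_itv /=; apply/andP; split; nra.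
  by rewrite ltr_cos// ltr_pM2l// mulr_gt0.
have -> : (s < d) = false by apply/negbTE; rewrite -leNgt; lra.
apply/negbTE; rewrite -leNgt.
(* Beyond s = 1/2 the cosine increases again; 1 - s is the distance the other way round the circle,
   still at least d. *)
have -> : cos (2 * pi * s) = cos (2 * pi * (1 - s)).
  rewrite -cosN -(cosD2pi (- (2 * pi * s))); congr cos; rewrite -mulr_natl; ring.
have sI : 2 * pi * (1 - s) \in `[0, pi] by rewrite in_itv /=; apply/andP; split; nra.
rewrite leNgt ltr_cos// -leNgt ler_pM2l ?mulr_gt0//; lra.
Qed.

(** The integral over every subinterval of [0, 1] vanishes, so the primitive is zero on ]0, 1[, and
    by Lebesgue differentiation its derivative is the integrand a.e. *)
Lemma fourier_unique_part (f : circle R -> R[i]) (p : R[i] -> R) :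
  (p = @complex.Re R \/ p = @complex.Im R) -> cint f ->
  (forall n : int, cintegral (fun z => sval z ^ n * f z) = 0) ->
  {ae m, forall z, p (f z) = 0}.
Proof.
move=> pE fint f0.
have ip : integr m (fun z => p (f z)) by case: fint => i1 i2; case: pE => ->.
have mp : measurable_fun setT (fun z => p (f z)) by exact: (integr_measurable ip).
pose g (t : R) := p (f (cpoint t)).
have mg : measurable_fun setT g.
  by apply: (measurableT_comp mp); exact: Defs.measurable_cpoint.
(* Extension by 0 to the whole line, where the differentiation theorem is applied. *)
pose G := g \_ `[0, 1[.
have ig : leb.-integrable `[0, 1[ (EFin \o g).
  apply/integrableP; split; first by apply/measurable_EFinP/measurable_funTS.
  have /integrableP[_] := ip; rewrite circle_integral//.
  by apply: measurableT_comp => //; exact/measurable_EFinP.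
have iG : leb.-integrable setT (EFin \o G).
  by rewrite /G -restrict_EFin; apply/(integrable_mkcond _ _).1.
have G0 (a b : R) : 0 <= a -> a < b -> b <= 1 -> (\int[leb]_(t in `]a, b[) (G t)%:E = 0)%E.
  move=> a0 ab b1.
  have [mL] := @integral_trig1_lt R f fint f0 _ _ _ p pE (arc01 a b).
  rewrite circle_integral; last exact/measurable_EFinP.
  rewrite integral_mkcond [in X in _ -> X]integral_mkcond => <-.
  apply: eq_integral => t _; rewrite /patch /G /patch.
  have [|t01] := boolP (t \in `[0, 1[%classic).
    rewrite inE /= in_itv /= => t01; rewrite -/(arc a b _) arc_lt//.
    have -> : (t \in `]a, b[%classic) = (a < t < b).
      by apply/idP/idP; rewrite inE /= in_itv.
    by case: ifP; rewrite ?mul1r ?mul0r.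
  by case: ifP.
pose F y := (\int[leb]_(t in [set` Interval (BRight 0) (BRight y)]) (G t)).
have F0 y : 0 < y < 1 -> F y = 0.
  move=> /andP[y0 y1]; rewrite /F -Rintegral_itv_bndo_bndc; last first.
    by apply: (integrableS _ _ _ iG) => //; exact: measurable_itv.
  by rewrite /Rintegral G0 // ltW.
have lG : locally_integrable [set: R] G.
  have := integrable_locally (measurable_itv `[0%R, 1%R[) (_ : leb.-integrable _ (EFin \o g)).
  apply; exact: ig.
have iy (y : R) : leb.-integrable [set` Interval (BRight 0) (BRight y)] (EFin \o G).
  by apply: (integrableS _ _ _ iG) => //; exact: measurable_itv.
have h1 := FTC1 iy lG.
apply: circle_ae.
  rewrite (_ : [set z | _] = (fun z => p (f z)) @^-1` (~` [set 0])); last first.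
    by [].
  rewrite -[X in measurable X]setTI; apply: mp => //; apply: measurableC.
  exact: measurable_set1.
(* The primitive starts at 0, so its derivative is controlled only for t > 0. *)
have h2 : {ae leb, forall t : R, t <> 0}.
  exists [set 0]; split; [exact: measurable_set1|exact: lebesgue_measure_set1|].
  by move=> t /= /contrapT.
apply: (negligibleS _ (negligibleU h1 h2)) => t /= /not_implyP[t01 pf].
apply: contrapT => /not_orP[/contrapT h /contrapT t0]; apply: pf.
have tt : 0 < t < 1.
  move: t01; rewrite in_itv /= => /andP[t01 ->]; rewrite andbT lt_neqAle t01 andbT.
  by apply/eqP => t0'; apply: t0.
have /h[_] : (BRight 0 < BRight t)%O by rewrite bnd_simp; case/andP: tt.
have -> : G t = p (f (cpoint t)) by rewrite /G /patch mem_set.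
move=> <-.
have nF : {near t, F =1 cst 0}.
  have : t \in `]0, 1[ by rewrite in_itv.
  move=> /near_in_itvoo; apply: filterS => y; rewrite in_itv => y01.
  exact: F0.
change (F^`()%classic t = 0).
by rewrite derive1E (@near_eq_derive _ _ _ F (cst 0) t 1 nF)// -derive1E derive1_cst.
Qed.

Lemma fourier_unique (f : circle R -> R[i]) : cint f ->
  (forall n : int, cintegral (fun z => sval z ^ n * f z) = 0) ->
  f = (fun=> 0) %[ae m].
Proof.
move=> fint f0.
have h1 := fourier_unique_part (or_introl erefl) fint f0.
have h2 := fourier_unique_part (or_intror erefl) fint f0.
by apply: filterS2 h1 h2 => z r i _; apply: complex_eq.
Qed.

End ArcIndicators.

(** * The Hilbert space of square-integrable vector functions *)

Section VectorMeasurability.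
Variable R : realType.

Lemma vmeasurable_lin (V W : vectType R[i]) (g : {linear V -> W})
  (F : circle R -> V) : vmeasurable F -> vmeasurable (fun z => g (F z)).
Proof.
move=> mF i; change (cmeas (vcoord (fun z => g (F z)) i)).
have -> : vcoord (fun z => g (F z)) i = fun z =>
  \sum_(j < \dim {:V}) coord (vbasis {:W}) i (g (vbasis {:V})`_j) * vcoord F j z.
  apply/funext => z; rewrite /vcoord {1}(coord_vbasis (memvf (F z))) !linear_sum.
  by apply: eq_bigr => j _; rewrite !linearZ /= mulrC.
apply: cmeas_sum => j; apply: cmeasM; first exact: cmeas_cst.
exact: mF.
Qed.

Lemma vintegral_lin (V W : vectType R[i]) (g : {linear V -> W})
  (F : circle R -> V) : (forall i, cint (vcoord F i)) ->
  g (vintegral F) = vintegral (fun z => g (F z)).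
Proof.
move=> iF; rewrite /vintegral linear_sum.
rewrite [LHS](coord_vbasis (memvf _)); apply: eq_bigr => i _; congr (_ *: _).
rewrite linear_sum /=.
transitivity (cintegral (fun z =>
  \sum_(j < \dim {:V}) coord (vbasis {:W}) i (g (vbasis {:V})`_j) * vcoord F j z)).
  rewrite cintegral_sum; last by move=> j; apply/cintZ/iF.
  by apply: eq_bigr => j _; rewrite !linearZ /= cintegralZ// mulrC.
apply: eq_cintegral => z; rewrite /vcoord.
rewrite [in RHS](coord_vbasis (memvf (F z))) !linear_sum.
by apply: eq_bigr => j _; rewrite !linearZ /= mulrC.
Qed.

End VectorMeasurability.

Section VectorFunctions.
Variables (R : realType) (H : vectType R[i]) (dot : {dot H for Num.conj}).
Local Notation m := (circle_measure R).
Local Notation u := (onb dot).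
Local Notation L2 := (L2H dot).
Implicit Types f g h : circle R -> H.

Lemma dot_vcoord f y z : dot (f z) y = \sum_(i < \dim {:H}) dot (vbasis {:H})`_i y * vcoord f i z.
Proof.
rewrite {1}(coord_vbasis (memvf (f z))) dot_suml; apply: eq_bigr => i _.
by rewrite dotZl mulrC.
Qed.

Lemma vcoord_dot f i z :
  vcoord f i z = \sum_j coord (vbasis {:H}) i (u j) * dot (f z) (u j).
Proof.
rewrite /vcoord {1}(onb_sum dot (f z)) linear_sum; apply: eq_bigr => j _.
by rewrite linearZ /= mulrC.
Qed.

Lemma vmeasurableP f : vmeasurable f <-> forall y, cmeas (fun z => dot (f z) y).
Proof.
split=> [mf y|mf i].
  under eq_fun do rewrite dot_vcoord.
  by apply: cmeas_sum => i; apply: cmeasM; [exact: cmeas_cst|exact: mf].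
change (cmeas (vcoord f i)).
rewrite (funext (vcoord_dot f i)).
by apply: cmeas_sum => j; apply: cmeasM; [exact: cmeas_cst|exact: mf].
Qed.

(** Reduces membership in L^2 to scalar functions: Cauchy-Schwarz in one direction, the coordinate
    formula for the norm in [onb] in the other. *)
Lemma L2P f : L2 f <-> forall y, csq (fun z => dot (f z) y).
Proof.
split=> [[/vmeasurableP mf fi] y|hf].
  have [m1 m2] := mf y.
  have mn : measurable_fun setT (fun z => hnorm dot (f z) ^+ 2).
    under eq_fun do rewrite (sqr_hnorm_onb dot).
    apply: measurable_sum => i; have [n1 n2] := mf (u i).
    by apply: measurable_funD; exact: measurable_funX.
  have iN : integr m (fun z => hnorm dot (f z) ^+ 2).
    apply: integrP => //; under eq_integral do rewrite ger0_norm ?sqr_ge0//.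
    exact: fi.
  have key (p : circle R -> R) : measurable_fun setT p ->
      (forall z, `|p z| <= hnorm dot (f z) * hnorm dot y) -> sqint m p.
    move=> mp hp; split => //; apply: integr_le (integrZ (hnorm dot y ^+ 2) iN).
      exact: measurable_funX.
    move=> z; rewrite normrX -exprMn mulrC lerXn2r// ?nnegrE ?mulr_ge0 ?hnorm_ge0//.
  by split; apply: key => // z; [exact: Re_dot_le|exact: Im_dot_le].
split; first by apply/vmeasurableP => y; exact/csq_cmeas/hf.
have iN : integr m (fun z => hnorm dot (f z) ^+ 2).
  under eq_fun do rewrite (sqr_hnorm_onb dot).
  by apply: integr_sum => i; have [[_ h1] [_ h2]] := hf (u i); exact: integrD.
have /integrableP[_] := iN.
by under eq_integral do rewrite gee0_abs ?lee_fin ?sqr_ge0//.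
Qed.

Lemma L2_vmeasurable f : L2 f -> vmeasurable f.
Proof. by case. Qed.

Lemma L2D f g : L2 f -> L2 g -> L2 (f + g).
Proof.
move=> /L2P hf /L2P hg; apply/L2P => y.
by under eq_fun do rewrite dotDl; exact: csqD.
Qed.

Lemma L2Z a f : L2 f -> L2 (a *: f).
Proof.
by move=> /L2P hf; apply/L2P => y; under eq_fun do rewrite dotZl; exact: csqZ.
Qed.

Lemma L2B f g : L2 f -> L2 g -> L2 (f - g).
Proof. by move=> hf hg; apply: L2D => //; rewrite -scaleN1r; exact: L2Z. Qed.

Lemma L2P_lin a f g : L2 f -> L2 g -> L2 (a *: f + g).
Proof. by move=> hf hg; apply: L2D => //; exact: L2Z. Qed.

Lemma L2_cst x : L2 (fun=> x).
Proof. by apply/L2P => y; exact: csq_cst. Qed.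

Lemma L2_0 : L2 0.
Proof. exact: (L2_cst 0). Qed.

Lemma L2_sum (I : Type) (s : seq I) (F : I -> circle R -> H) :
  (forall i, L2 (F i)) -> L2 (\sum_(i <- s) F i).
Proof. by move=> h; elim/big_ind : _ => //; [exact: L2_0|exact: L2D]. Qed.

Lemma L2_circleX (n : int) f : L2 f -> L2 (fun z => sval z ^ n *: f z).
Proof.
move=> /L2P hf; apply/L2P => y; under eq_fun do rewrite dotZl.
exact: csq_circleX_mul.
Qed.

Lemma cint_dot f g : L2 f -> L2 g -> cint (fun z => dot (f z) (g z)).
Proof.
move=> /L2P hf /L2P hg; under eq_fun do rewrite (dot_onb dot).
by apply: cint_sum => i; apply: csqM => //; exact: csq_conj.
Qed.

Lemma ipPl a f g h : L2 f -> L2 g -> L2 h ->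
  ip dot (a *: f + g) h = a * ip dot f h + ip dot g h.
Proof.
move=> hf hg hh; rewrite /ip -cintegralZ; last exact: cint_dot.
rewrite -cintegralD; [|exact/cintZ/cint_dot|exact: cint_dot].
by apply: eq_cintegral => z; rewrite dotDl dotZl.
Qed.

Lemma ip0l h : ip dot 0 h = 0.
Proof. by rewrite /ip; under eq_fun do rewrite dot0l; rewrite cintegral_cst. Qed.

Lemma ipZl a f h : L2 f -> L2 h -> ip dot (a *: f) h = a * ip dot f h.
Proof.
by move=> hf hh; have := ipPl a hf L2_0 hh; rewrite addr0 ip0l addr0.
Qed.

Lemma ipDl f g h : L2 f -> L2 g -> L2 h ->
  ip dot (f + g) h = ip dot f h + ip dot g h.
Proof. by move=> hf hg hh; have := ipPl 1 hf hg hh; rewrite scale1r mul1r. Qed.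

Lemma ipBl f g h : L2 f -> L2 g -> L2 h ->
  ip dot (f - g) h = ip dot f h - ip dot g h.
Proof.
move=> hf hg hh; rewrite -scaleN1r ipDl ?ipZl ?mulN1r//; exact: L2Z.
Qed.

Lemma ipC f g : L2 f -> L2 g -> ip dot f g = (ip dot g f)^*.
Proof.
move=> hf hg; rewrite /ip -cintegral_conj; last exact: cint_dot.
by apply: eq_cintegral => z; exact: dotC.
Qed.

Lemma ipDr f g h : L2 f -> L2 g -> L2 h ->
  ip dot h (f + g) = ip dot h f + ip dot h g.
Proof.
move=> hf hg hh; rewrite ipC//; last exact: L2D.
by rewrite ipDl// rmorphD /= -!ipC.
Qed.

Lemma ipZr a f h : L2 f -> L2 h -> ip dot h (a *: f) = a^* * ip dot h f.
Proof.
move=> hf hh; rewrite ipC//; last exact: L2Z.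
by rewrite ipZl// rmorphM /= -ipC.
Qed.

Lemma ipBr f g h : L2 f -> L2 g -> L2 h ->
  ip dot h (f - g) = ip dot h f - ip dot h g.
Proof.
move=> hf hg hh; rewrite ipC//; last exact: L2B.
by rewrite ipBl// rmorphB /= -!ipC.
Qed.

Lemma ip_suml (I : Type) (s : seq I) (F : I -> circle R -> H) h :
  (forall i, L2 (F i)) -> L2 h ->
  ip dot (\sum_(i <- s) F i) h = \sum_(i <- s) ip dot (F i) h.
Proof.
move=> hF hh; elim: s => [|i s IH]; first by rewrite !big_nil ip0l.
by rewrite !big_cons ipDl ?IH//; exact: L2_sum.
Qed.

Lemma ip_sumr (I : Type) (s : seq I) (F : I -> circle R -> H) h :
  (forall i, L2 (F i)) -> L2 h ->
  ip dot h (\sum_(i <- s) F i) = \sum_(i <- s) ip dot h (F i).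
Proof.
move=> hF hh; rewrite ipC//; last exact: L2_sum.
rewrite ip_suml// rmorph_sum; apply: eq_bigr => i _; exact/esym/ipC.
Qed.

Lemma ip_ael f g h : L2 f -> L2 g -> L2 h -> f = g %[ae m] -> ip dot f h = ip dot g h.
Proof.
move=> hf hg hh fg; apply: cintegral_ae; try exact/cint_cmeas/cint_dot.
by apply: filterS fg => z e /e ->.
Qed.

Lemma ip_aer f g h : L2 f -> L2 g -> L2 h -> f = g %[ae m] -> ip dot h f = ip dot h g.
Proof. by move=> hf hg hh fg; rewrite ipC// (ip_ael hf hg hh fg) -ipC. Qed.

Lemma Re_ip f : L2 f -> complex.Re (ip dot f f) = \int[m]_z (hnorm dot (f z) ^+ 2).
Proof.
by move=> hf; apply: eq_Rintegral => z _; rewrite sqr_hnorm.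
Qed.

Lemma Re_ip_ge0 f : 0 <= complex.Re (ip dot f f).
Proof. by apply: Rintegral_ge0 => z _; exact: Re_dot_ge0. Qed.

Lemma sqr_L2norm f : L2norm dot f ^+ 2 = complex.Re (ip dot f f).
Proof. by rewrite sqr_sqrtr// Re_ip_ge0. Qed.

Lemma L2norm_ge0 f : 0 <= L2norm dot f.
Proof. exact: sqrtr_ge0. Qed.

Lemma integr_hnorm f : L2 f -> integr m (fun z => hnorm dot (f z) ^+ 2).
Proof.
move=> /L2P hf; under eq_fun do rewrite (sqr_hnorm_onb dot).
by apply: integr_sum => i; have [[_ h1] [_ h2]] := hf (u i); exact: integrD.
Qed.

Lemma ip_eq0_ae f : L2 f -> ip dot f f = 0 -> f = (fun=> 0) %[ae m].
Proof.
move=> hf /(congr1 (@complex.Re R)); rewrite Re_ip//= => f0.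
have sf : sqint m (fun z => hnorm dot (f z)).
  split; last exact: integr_hnorm.
  have -> : (fun z => hnorm dot (f z)) = Num.sqrt \o (fun z => hnorm dot (f z) ^+ 2).
    by apply/funext => z /=; rewrite sqrtr_sqr ger0_norm// hnorm_ge0.
  apply: measurableT_comp; last exact: (integr_measurable (integr_hnorm hf)).
  by apply: continuous_measurable_fun; exact: sqrt_continuous.
have := sqint0_ae sf f0; apply: filterS => z h _.
by have := h I; exact: hnorm_eq0.
Qed.

Lemma ip_circleX (n : int) f g :
  ip dot (fun z => sval z ^ n *: f z) g = ip dot f (fun z => sval z ^ (- n) *: g z).
Proof.
by apply: eq_cintegral => z; rewrite dotZl dotZr circleX_conj opprK.
Qed.

Lemma L2norm_circleX (n : int) f : L2norm dot (fun z => sval z ^ n *: f z) = L2norm dot f.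
Proof.
congr (Num.sqrt (complex.Re _)); rewrite ip_circleX; apply: eq_cintegral => z.
by rewrite scalerA -expfzDr ?circle_neq0// addNr expr0z scale1r.
Qed.

Lemma dot_vintegral f y : (forall y', cint (fun z => dot (f z) y')) ->
  dot (vintegral f) y = cintegral (fun z => dot (f z) y).
Proof.
move=> hf; have hc i : cint (vcoord f i).
  rewrite (funext (vcoord_dot f i)).
  by apply: cint_sum => j; exact: cintZ.
rewrite /vintegral dot_suml.
under [in RHS]eq_fun do rewrite dot_vcoord.
rewrite cintegral_sum; last by move=> i; exact: cintZ.
by apply: eq_bigr => i _; rewrite dotZl cintegralZ// mulrC.
Qed.

(** Turns coefficients, defined through [vbasis], into inner products; the properties of [fourier]
    are then inherited from [ip]. *)
Lemma dot_fourier f (n : int) y : L2 f ->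
  dot (fourier f n) y = ip dot f (fun z => sval z ^ n *: y).
Proof.
move=> hf; rewrite dot_vintegral => [|y'].
  by apply: eq_cintegral => z; rewrite dotZl dotZr circleX_conj.
by have /L2P h := L2_circleX (- n) hf; exact: csq_cint.
Qed.

Lemma fourier_ae f g (n : int) : L2 f -> L2 g -> f = g %[ae m] -> fourier f n = fourier g n.
Proof.
move=> hf hg fg; apply: (@dot_inj _ _ dot) => y; rewrite !dot_fourier//.
by apply: ip_ael => //; apply: L2_circleX; exact: L2_cst.
Qed.

Lemma fourierP a f g (n : int) : L2 f -> L2 g ->
  fourier (a *: f + g) n = a *: fourier f n + fourier g n.
Proof.
move=> hf hg; apply: (@dot_inj _ _ dot) => y; have hy := L2_circleX n (L2_cst y).
by rewrite dotDl dotZl !dot_fourier ?ipPl//; exact: L2P_lin.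
Qed.

Lemma fourierB f g (n : int) : L2 f -> L2 g ->
  fourier (f - g) n = fourier f n - fourier g n.
Proof.
move=> hf hg; apply: (@dot_inj _ _ dot) => y; have hy := L2_circleX n (L2_cst y).
by rewrite dotBl !dot_fourier ?ipBl//; exact: L2B.
Qed.

Lemma ip_cst x y : ip dot (fun=> x) (fun=> y) = dot x y.
Proof. exact: cintegral_cst. Qed.

Lemma fourier_circleX (k n : int) f : L2 f ->
  fourier (fun z => sval z ^ k *: f z) n = fourier f (n - k).
Proof.
move=> hf; apply: (@dot_inj _ _ dot) => y; rewrite !dot_fourier//; last exact: L2_circleX.
rewrite ip_circleX; apply: eq_cintegral => z; congr (dot _ _).
by rewrite scalerA -expfzDr ?circle_neq0// addrC.
Qed.

Lemma fourier_cst x (n : int) : fourier (fun=> x : H) n = (n == 0)%:R *: x.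
Proof.
apply: (@dot_inj _ _ dot) => y; rewrite dot_fourier; last exact: L2_cst.
rewrite /ip dotZl -[n == 0]oppr_eq0 -cintegral_circleX mulrC -cintegralZ.
  by apply: eq_cintegral => z; rewrite dotZr circleX_conj mulrC.
by have := cint_circleX_mul (- n) (cint_cst (1 : R[i])); under eq_fun do rewrite mulr1.
Qed.

Lemma fourier_eq0_ae f : L2 f -> (forall n : int, fourier f n = 0) -> f = (fun=> 0) %[ae m].
Proof.
move=> hf f0.
have h i : (fun z => dot (f z) (u i)) = (fun=> 0) %[ae m].
  apply: fourier_unique; first by have /L2P hf' := hf; exact: csq_cint.
  move=> n; have := dot_fourier (- n) (u i) hf; rewrite f0 dot0l => /esym e.
  by rewrite -[RHS]e; apply: eq_cintegral => z; rewrite dotZr circleX_conj opprK.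
have : \forall z \ae m, forall i, dot (f z) (u i) = 0.
  apply: filter_forall => i; apply: filterS (h i) => z; exact.
apply: filterS => z hz _; rewrite (onb_sum dot (f z)) big1// => i _.
by rewrite hz scale0r.
Qed.

End VectorFunctions.

(** * Norm inequalities, completeness and Riesz representation *)

Section HilbertSpace.
Variables (R : realType) (H : vectType R[i]) (dot : {dot H for Num.conj}).
Local Notation m := (circle_measure R).
Local Notation u := (onb dot).
Local Notation L2 := (L2H dot).
Local Notation N := (L2norm dot).
Implicit Types f g h : circle R -> H.

Lemma le0_of_small (x c : R) : 0 <= c -> (forall e : R, 0 < e -> x <= e * c) -> x <= 0.
Proof.
move=> c0 h; rewrite leNgt; apply/negP => x0.
(* Adding 1 covers c = 0; the factor 2 makes e c smaller than x when e is x divided by this. *)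
have c1 : 0 < 2 * (c + 1) by rewrite mulr_gt0// ltr_wpDl.
have := h (x / (2 * (c + 1))); rewrite divr_gt0// => /(_ isT).
rewrite mulrAC ler_pdivlMr//; nra.
Qed.

Lemma eq_of_small (x y c : R) : 0 <= c -> (forall e : R, 0 < e -> `|x - y| <= e * c) -> x = y.
Proof.
move=> c0 h; apply/eqP; rewrite -subr_eq0 -normr_le0; exact: le0_of_small h.
Qed.

Lemma Re_ip_sym f g : L2 f -> L2 g -> complex.Re (ip dot f g) = complex.Re (ip dot g f).
Proof. by move=> hf hg; rewrite ipC// Re_conj. Qed.

Lemma sqr_L2normPl (t : R) f g : L2 f -> L2 g ->
  N (t%:C%C *: f + g) ^+ 2 =
  t ^+ 2 * N f ^+ 2 + 2 * t * complex.Re (ip dot f g) + N g ^+ 2.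
Proof.
move=> hf hg; have tf : L2 (t%:C%C *: f) by exact: L2Z.
rewrite !sqr_L2norm ipDl//; last exact: L2D.
rewrite !ipDr// !ipZl// !ipZr// !ReD conj_real !Re_realM (Re_ip_sym hg hf).
ring.
Qed.

Lemma sqr_L2normD f g : L2 f -> L2 g ->
  N (f + g) ^+ 2 = N f ^+ 2 + 2 * complex.Re (ip dot f g) + N g ^+ 2.
Proof.
by move=> hf hg; have := sqr_L2normPl 1 hf hg; rewrite scale1r expr1n mul1r mulr1.
Qed.

Lemma Re_ip_le f g : L2 f -> L2 g -> `|complex.Re (ip dot f g)| <= N f * N g.
Proof.
move=> hf hg; rewrite -(@ler_pXn2r _ 2%N)// ?nnegrE// ?mulr_ge0 ?L2norm_ge0//.
rewrite real_normK ?num_real// exprMn mulrC.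
apply: real_quad; rewrite ?sqr_ge0// => t.
have := sqr_ge0 (N (t%:C%C *: f + g)); rewrite sqr_L2normPl//; lra.
Qed.

Lemma L2normD f g : L2 f -> L2 g -> N (f + g) <= N f + N g.
Proof.
move=> hf hg; rewrite -(@ler_pXn2r _ 2%N)// ?nnegrE ?addr_ge0 ?L2norm_ge0//.
rewrite sqr_L2normD// sqrrD.
by have := Re_ip_le hf hg; rewrite ler_norml => /andP[_]; lra.
Qed.

Lemma L2normN f : L2 f -> N (- f) = N f.
Proof.
move=> hf; have h0 := L2_0 dot; apply/eqP.
rewrite -(@eqrXn2 _ 2%N)// ?L2norm_ge0//.
have := sqr_L2normPl (-1) hf h0; rewrite addr0 (_ : (-1)%:C%C *: f = - f); last first.
  by rewrite rmorphN1 scaleN1r.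
move=> ->; rewrite (Re_ip_sym hf h0) ip0l [N 0]/L2norm ip0l sqrtr0.
by rewrite sqrrN expr1n expr0n mulr0 !addr0 mul1r.
Qed.

Lemma L2norm_distC f g : L2 f -> L2 g -> N (f - g) = N (g - f).
Proof. by move=> hf hg; rewrite -L2normN ?opprB//; exact: L2B. Qed.

Lemma L2norm0 : N 0 = 0.
Proof. by rewrite /L2norm ip0l sqrtr0. Qed.

Lemma L2norm_ae f g : L2 f -> L2 g -> f = g %[ae m] -> N f = N g.
Proof.
by move=> hf hg fg; rewrite /L2norm (ip_ael hf hg hf fg) (ip_aer hf hg hg fg).
Qed.

Lemma L2normi f : L2 f -> N ('i%C *: f) = N f.
Proof.
move=> hf; rewrite /L2norm ipZl ?ipZr ?mulrA//; last exact: L2Z.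
by congr (Num.sqrt (complex.Re _)); case: (ip dot f f) => a b; apply: complex_eq => /=; ring.
Qed.

Definition cvgL2 (v : nat -> circle R -> H) f :=
  forall e : R, 0 < e -> exists n0, forall n, (n0 <= n)%N -> N (v n - f) <= e.

Definition cauchyL2 (v : nat -> circle R -> H) :=
  forall e : R, 0 < e -> exists n0, forall p q, (n0 <= p)%N -> (n0 <= q)%N -> N (v p - v q) <= e.

Lemma sqr_L2norm_onb f : L2 f -> N f ^+ 2 = \sum_i
  (\int[m]_z (complex.Re (dot (f z) (u i)) ^+ 2) +
   \int[m]_z (complex.Im (dot (f z) (u i)) ^+ 2)).
Proof.
move=> hf; rewrite sqr_L2norm Re_ip//; under eq_Rintegral do rewrite (sqr_hnorm_onb dot).
move/L2P : hf => hf; rewrite Rint_sum; last first.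
  by move=> i; have [[_ h1] [_ h2]] := hf (u i); exact: integrD.
by apply: eq_bigr => i _; have [[_ h1] [_ h2]] := hf (u i); rewrite RintD.
Qed.

(** Scalar completeness is applied to the real and imaginary parts of each orthonormal
    coordinate. *)
Lemma L2_complete (v : nat -> circle R -> H) : (forall n, L2 (v n)) -> cauchyL2 v ->
  exists2 f, L2 f & cvgL2 v f.
Proof.
move=> hv cv.
have key (p : R[i] -> R) : (p = @complex.Re R \/ p = @complex.Im R) -> forall i,
    exists a, sqint m a /\ forall e : R, 0 < e -> exists n0, forall n, (n0 <= n)%N ->
     \int[m]_z ((p (dot (v n z) (u i)) - a z) ^+ 2) <= e.
  move=> pE i; apply: sqint_complete => [n|e e0].
    by have /L2P /(_ (u i)) [h1 h2] := hv n; case: pE => ->.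
  have [|n0 hn0] := cv (Num.sqrt e); first by rewrite sqrtr_gt0.
  exists n0 => p' q' hp hq; apply: (@le_trans _ _ (N (v p' - v q') ^+ 2)); last first.
    rewrite -[leRHS](sqr_sqrtr (ltW e0)) lerXn2r ?nnegrE ?L2norm_ge0 ?sqrtr_ge0//.
    exact: hn0.
  rewrite sqr_L2norm_onb; last exact: L2B.
  rewrite (bigD1 i)//= -[leLHS]addr0 lerD//; last first.
    apply: sumr_ge0 => j _; apply: addr_ge0; apply: Rintegral_ge0 => z _; exact: sqr_ge0.
  case: pE => ->.
    rewrite -[leLHS]addr0 lerD//; last by apply: Rintegral_ge0 => z _; exact: sqr_ge0.
    rewrite le_eqVlt; apply/orP; left; apply/eqP; apply: eq_Rintegral => z _.
    by rewrite dotBl ReB.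
  rewrite -[leLHS]add0r lerD//; first by apply: Rintegral_ge0 => z _; exact: sqr_ge0.
  rewrite le_eqVlt; apply/orP; left; apply/eqP; apply: eq_Rintegral => z _.
  by rewrite dotBl ImD ImN.
have /choice[a ha] := key _ (or_introl erefl).
have /choice[b hb] := key _ (or_intror erefl).
pose f z := \sum_i (a i z +i* b i z)%C *: u i.
have fu z i : dot (f z) (u i) = (a i z +i* b i z)%C.
  rewrite dot_suml (bigD1 i)//= dotZl onbP eqxx mulr1 big1 ?addr0//.
  by move=> j ji; rewrite dotZl onbP (negbTE ji) mulr0.
have hf : L2 f.
  apply/L2P => y; under eq_fun do rewrite (dot_onb dot).
  apply: csq_sum => i; under eq_fun do rewrite fu mulrC.
  by apply: csqZ; split => /=; [case: (ha i)|case: (hb i)].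
exists f => // e e0.
(* The error e^2 is shared among twice the dimension many scalar functions; adding 1 keeps K
   positive when H is zero. *)
pose K := (\dim {:H})%:R * 2 + 1 : R.
have K0 : 0 < K by rewrite ltr_wpDl// mulr_ge0.
have e'0 : 0 < e ^+ 2 / K by rewrite divr_gt0// exprn_gt0.
have /choice[na hna] : forall i, exists n0, forall n, (n0 <= n)%N ->
     \int[m]_z ((complex.Re (dot (v n z) (u i)) - a i z) ^+ 2) <= e ^+ 2 / K.
  by move=> i; have [_ h] := ha i; exact: h.
have /choice[nb hnb] : forall i, exists n0, forall n, (n0 <= n)%N ->
     \int[m]_z ((complex.Im (dot (v n z) (u i)) - b i z) ^+ 2) <= e ^+ 2 / K.
  by move=> i; have [_ h] := hb i; exact: h.
exists (\sum_i (na i + nb i))%N => n hn.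
rewrite -(@ler_pXn2r _ 2%N) ?nnegrE ?L2norm_ge0 ?(ltW e0)// sqr_L2norm_onb; last exact: L2B.
apply: (@le_trans _ _ (\sum_(i < \dim {:H}) (e ^+ 2 / K + e ^+ 2 / K))).
  apply: ler_sum => i _; have hni : (na i + nb i <= n)%N.
    by apply: leq_trans hn; rewrite (bigD1 i)//= leq_addr.
  apply: lerD.
    under eq_Rintegral do rewrite dotBl fu ReB /=.
    by apply: hna; apply: leq_trans hni; rewrite leq_addr.
  under eq_Rintegral do rewrite dotBl fu ImD ImN /=.
  by apply: hnb; apply: leq_trans hni; rewrite leq_addl.
rewrite sumr_const card_ord -[leLHS]mulr_natl mulrDr -mulrDl -[leRHS](@divfK _ K) ?gt_eqF//.
rewrite mulrC ler_wpM2l ?(ltW e'0)// /K; lra.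
Qed.

Lemma cvgL2_ip v f w : (forall n, L2 (v n)) -> L2 f -> L2 w -> cvgL2 v f ->
  (forall n, ip dot (v n) w = 0) -> ip dot f w = 0.
Proof.
move=> hv hf hw vf v0.
have re w' : L2 w' -> (forall n, ip dot (v n) w' = 0) -> complex.Re (ip dot f w') = 0.
  move=> hw' v0'; apply: (@eq_of_small _ _ (N w')); first exact: L2norm_ge0.
  move=> e e0; rewrite subr0; have [n0 /(_ _ (leqnn _)) hn] := vf e e0.
  have := Re_ip_le (L2B hf (hv n0)) hw'; rewrite ipBl// v0' subr0 => /le_trans; apply.
  by rewrite ler_wpM2r ?L2norm_ge0// L2norm_distC.
apply: complex_eq; first exact: re.
have := re _ (L2Z 'i%C hw) _; rewrite ipZr//.
case: (ip dot f w) => a b /=; rewrite !mul0r sub0r mulN1r opprK; apply => n.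
by rewrite ipZr// v0 mulr0.
Qed.

(** Variational proof: the representing vector is the limit of a minimising sequence of a quadratic
    functional. Only the real part of l needs a bound, the imaginary part being recovered from
    multiplication by i. *)
Lemma riesz (K : set (circle R -> H)) (l : (circle R -> H) -> R[i]) (M : R) :
  K `<=` L2 -> K 0 -> (forall a f g, K f -> K g -> K (a *: f + g)) ->
  (forall v f, (forall n, K (v n)) -> L2 f -> cvgL2 v f -> K f) ->
  (forall a f g, K f -> K g -> l (a *: f + g) = a * l f + l g) ->
  (forall f, K f -> `|complex.Re (l f)| <= M * N f) ->
  exists2 g, K g & forall f, K f -> l f = ip dot f g.
Proof.
move=> KL K0 Klin Kcl llin lM.
(* If g represents l, this is N (f - g) ^+ 2 - N g ^+ 2, so g is its minimiser. *)
pose J : (circle R -> H) -> R := fun f => N f ^+ 2 - 2 * complex.Re (l f).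
have JM f : K f -> - M ^+ 2 <= J f.
  move=> Kf; have := lM _ Kf; rewrite ler_norml => /andP[_ h].
  by have := sqr_ge0 (N f - M); rewrite sqrrB /J; lra.
pose S : set R := [set J f | f in K].
have S0 : has_inf S.
  by split; [exists (J 0), 0|exists (- M ^+ 2) => _ [f Kf <-]; exact: JM].
pose d : R := inf S.
have infS f : K f -> d <= J f.
  by move=> Kf; apply: ge_inf; [case: S0|exists f].
have /choice[v hv] : forall n, exists f, K f /\ J f < d + n.+1%:R^-1 :> R.
  move=> n; have [|_ [f Kf <-] h] := @inf_adherent R S n.+1%:R^-1 _ S0; last by exists f.
  by rewrite invr_gt0.
have Kv n : K (v n) by case: (hv n).
have Lv n : L2 (v n) by exact/KL/Kv.
have l0 : l 0 = 0.
  have := llin 1 0 0 K0 K0; rewrite scale1r addr0 mul1r -[in LHS](addr0 (l 0)).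
  by move=> /addrI.
have lZ a f : K f -> l (a *: f) = a * l f.
  by move=> Kf; have := llin a f 0 Kf K0; rewrite !addr0 l0 addr0.
have KZ a f : K f -> K (a *: f) by move=> Kf; have := Klin a f 0 Kf K0; rewrite addr0.
(* The parallelogram identity, with J at least d at the midpoint of f and g; it makes minimising
   sequences Cauchy. *)
have par f g : K f -> K g -> N (f - g) ^+ 2 <= 2 * (J f + J g - 2 * d).
  move=> Kf Kg; have hf := KL _ Kf; have hg := KL _ Kg.
  have half : K ((2^-1)%:C%C *: f + (2^-1)%:C%C *: g) by apply: Klin => //; exact: KZ.
  have := infS _ half; rewrite /J llin//; last exact: KZ.
  rewrite sqr_L2normPl//; last exact: L2Z.
  rewrite ipZr//.
  have := sqr_L2normPl (-1) hg hf.
  rewrite (_ : (-1)%:C%C *: g + f = f - g); last by rewrite rmorphN1 scaleN1r addrC.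
  move=> ->; have := sqr_L2normPl (2^-1) hg (L2_0 dot).
  rewrite addr0 Re_ip_sym//; last exact: L2_0.
  rewrite ip0l L2norm0 (_ : (0 : R) ^+ 2 = 0) ?expr0n// mulr0 !addr0 => ->.
  rewrite !lZ// ReD conj_real !Re_realM (Re_ip_sym hg hf); lra.
have inv0 (e : R) : 0 < e -> exists n0, forall n, (n0 <= n)%N -> n.+1%:R^-1 <= e :> R.
  move=> e0; have [k] := ltr_add_invr e0; rewrite add0r => hk; exists k => n kn.
  apply: le_trans (ltW hk).
  by rewrite lef_pV2 ?posrE ?ltr0n// ler_nat ltnS.
have cv : cauchyL2 v.
  move=> e e0; have [|n0 hn0] := inv0 (e ^+ 2 / 4); first by rewrite divr_gt0// exprn_gt0.
  exists n0 => p q hp hq; rewrite -(@ler_pXn2r _ 2%N) ?nnegrE ?L2norm_ge0 ?(ltW e0)//.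
  apply: (le_trans (par _ _ (Kv p) (Kv q))).
  have aux (x y a b c : R) : x < d + a -> y < d + b -> a <= c / 4 -> b <= c / 4 ->
      2 * (x + y - 2 * d) <= c by lra.
  exact: aux (hv p).2 (hv q).2 (hn0 _ hp) (hn0 _ hq).
have [g Lg vg] := L2_complete Lv cv.
have Kg : K g by exact: Kcl vg.
exists g => //.
have re h : K h -> complex.Re (l h) = complex.Re (ip dot h g).
  move=> Kh; have Lh := KL _ Kh.
  apply: (@eq_of_small _ _ (2 * N h)); first by rewrite mulr_ge0// L2norm_ge0.
  move=> e e0.
  have [|n1 hn1] := inv0 (e ^+ 2); first by rewrite exprn_gt0.
  have [n2 hn2] := vg e e0.
  pose n := maxn n1 n2.
  have b1 : n.+1%:R^-1 <= e ^+ 2 by apply: hn1; rewrite leq_maxl.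
  have b2 : N (v n - g) <= e by apply: hn2; rewrite leq_maxr.
  (* Since J (t h + v n) is at least d while J (v n) is below d + e^2, a quadratic polynomial in t
     is nonnegative; [real_quad] bounds its linear coefficient. *)
  have h1 : `|complex.Re (ip dot h (v n)) - complex.Re (l h)| <= e * N h.
    rewrite -(@ler_pXn2r _ 2%N) ?nnegrE ?mulr_ge0 ?L2norm_ge0 ?(ltW e0)//.
    rewrite real_normK ?num_real// exprMn; apply: real_quad; rewrite ?sqr_ge0// => t.
    have Kt : K (t%:C%C *: h + v n) by exact: Klin.
    have := infS _ Kt; rewrite /J sqr_L2normPl// llin// ReD Re_realM => i1.
    have aux (nh iph lh nv lv k c : R) :
        d <= t ^+ 2 * nh + 2 * t * iph + nv - 2 * (t * lh + lv) ->
        nv - 2 * lv < d + k -> k <= c ->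
        0 <= c + t * (2 * (iph - lh)) + t ^+ 2 * nh by lra.
    exact: aux i1 (hv n).2 b1.
  have h2 : `|complex.Re (ip dot h (v n)) - complex.Re (ip dot h g)| <= e * N h.
    rewrite -ReB -(ipBr (Lv n) Lg Lh).
    rewrite (le_trans (Re_ip_le Lh (L2B (Lv n) Lg)))//.
    by rewrite mulrC ler_wpM2r ?L2norm_ge0.
  rewrite distrC in h1; have := lerD h1 h2 => /(le_trans (ler_normD _ _)).
  by rewrite addrA subrK; lra.
move=> h Kh; apply: complex_eq; first exact: re.
have := re _ (KZ 'i%C _ Kh); rewrite lZ// ipZl//; last exact: KL.
by case: (l h) => a b; case: (ip dot h g) => a' b' /=; lra.
Qed.

End HilbertSpace.

(** * Operator-valued functions *)

Section OperatorFunctions.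
Variables (R : realType) (H : vectType R[i]) (dot : {dot H for Num.conj}).
Local Notation m := (circle_measure R).
Local Notation u := (onb dot).
Local Notation L2 := (L2H dot).
Implicit Types (f g h : circle R -> H) (Phi : circle R -> 'End(H)).

Definition matrix_unit (i k : 'I_(\dim {:H})) (x : H) : H := dot x (u i) *: u k.

Lemma matrix_unit_linear i k : linear (matrix_unit i k).
Proof. by move=> a x y; rewrite /matrix_unit dotDl dotZl scalerDl scalerA. Qed.

Definition matrix_unit_lin i k : {linear H -> H} :=
  HB.pack (matrix_unit i k) (GRing.isLinear.Build R[i] H H _ _ (matrix_unit_linear i k)).

Lemma matrix_unitE i k x : linfun (matrix_unit_lin i k) x = dot x (u i) *: u k.
Proof. by rewrite lfunE. Qed.

Lemma End_sum (T : 'End(H)) :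
  T = \sum_i \sum_k dot (T (u i)) (u k) *: linfun (matrix_unit_lin i k).
Proof.
apply/lfunP => x; rewrite sum_lfunE {1}(onb_sum dot x) linear_sum.
apply: eq_bigr => i _; rewrite sum_lfunE linearZ /= {1}(onb_sum dot (T (u i))) scaler_sumr.
by apply: eq_bigr => k _; rewrite scale_lfunE matrix_unitE !scalerA mulrC.
Qed.

Lemma eval_linear (x : H) : linear (fun T : 'End(H) => T x).
Proof. by move=> a S T; rewrite add_lfunE scale_lfunE. Qed.

Definition eval_lin (x : H) : {linear 'End(H) -> H} :=
  HB.pack (fun T : 'End(H) => T x)
    (GRing.isLinear.Build R[i] 'End(H) H _ _ (eval_linear x)).

Lemma vmeasurable_eval Phi x : vmeasurable Phi -> vmeasurable (fun z => Phi z x).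
Proof. exact: (@vmeasurable_lin _ _ _ (eval_lin x)). Qed.

(** Passes from the basis of ['End(H)] used to define measurability to matrix entries in the
    orthonormal basis. *)
Lemma vcoord_End Phi j z : vcoord Phi j z = \sum_i \sum_k
  coord (vbasis {:'End(H)}) j (linfun (matrix_unit_lin i k)) * dot (Phi z (u i)) (u k).
Proof.
rewrite /vcoord {1}(End_sum (Phi z)) linear_sum; apply: eq_bigr => i _.
by rewrite linear_sum; apply: eq_bigr => k _; rewrite linearZ /= mulrC.
Qed.

(** The squared Hilbert-Schmidt norm is the sum of the squared norms of the columns, so square
    integrability can be tested column by column. *)
Lemma L2LP Phi : L2L dot Phi <-> forall x, L2 (fun z => Phi z x).
Proof.
split=> [[mPhi iPhi] x|hPhi].
  have mc y : vmeasurable (fun z => Phi z y) by exact: vmeasurable_eval.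
  have sqm y : measurable_fun setT (fun z => hnorm dot (Phi z y) ^+ 2).
    have /(vmeasurableP dot) mp := mc y.
    under eq_fun do rewrite (sqr_hnorm_onb dot).
    apply: measurable_sum => i; have [n1 n2] := mp (u i).
    by apply: measurable_funD; exact: measurable_funX.
  have iN : integr m (fun z => hsnorm dot (Phi z) ^+ 2).
    apply: integrP.
      by under eq_fun do rewrite sqr_hsnorm; exact: measurable_sum.
    by under eq_integral do rewrite ger0_norm ?sqr_ge0//.
  have hu i : L2 (fun z => Phi z (u i)).
    split => //; have : integr m (fun z => hnorm dot (Phi z (u i)) ^+ 2).
      apply: integr_le iN => // z; rewrite ger0_norm ?sqr_ge0// sqr_hsnorm.
      rewrite (bigD1 i)//= lerDl sumr_ge0// => j _; exact: sqr_ge0.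
    by move=> /integrableP[_]; under eq_integral do rewrite gee0_abs ?lee_fin ?sqr_ge0//.
  have -> : (fun z => Phi z x) = \sum_i dot x (u i) *: (fun z => Phi z (u i)).
    apply/funext => z; rewrite {1}(onb_sum dot x) linear_sum fct_sumE.
    by apply: eq_bigr => i _; rewrite linearZ.
  by apply: L2_sum => i; exact: L2Z.
split.
  move=> j; change (cmeas (vcoord Phi j)); rewrite (funext (vcoord_End Phi j)).
  apply: cmeas_sum => i; apply: cmeas_sum => k; apply: cmeasM; first exact: cmeas_cst.
  by have /L2_vmeasurable/(vmeasurableP dot) := hPhi (u i).
have : integr m (fun z => hsnorm dot (Phi z) ^+ 2).
  under eq_fun do rewrite sqr_hsnorm.
  by apply: integr_sum => i; exact/integr_hnorm/hPhi.
by move=> /integrableP[_]; under eq_integral do rewrite gee0_abs ?lee_fin ?sqr_ge0//.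
Qed.

Lemma fourier_eval Phi (n : int) x : L2L dot Phi ->
  fourier Phi n x = fourier (fun z => Phi z x) n.
Proof.
move=> /L2LP hPhi; rewrite /fourier.
rewrite (_ : (fun z => _ *: Phi z x) = (fun z => eval_lin x (sval z ^ (- n) *: Phi z))).
  rewrite -(@vintegral_lin _ _ _ (eval_lin x))// => j.
  have -> : vcoord (fun z => sval z ^ (- n) *: Phi z) j =
      (fun z => sval z ^ (- n) * vcoord Phi j z).
    by apply/funext => z; rewrite /vcoord linearZ.
  apply: cint_circleX_mul; rewrite (funext (vcoord_End Phi j)).
  apply: cint_sum => i; apply: cint_sum => k; apply: cintZ.
  by have /L2P h := hPhi (u i); exact: csq_cint.
by apply/funext => z /=; rewrite scale_lfunE.
Qed.

Definition ae_bounded f := exists M : R, \forall z \ae m, hnorm dot (f z) <= M.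

Lemma dot_opmul Phi f y z :
  dot (opmul Phi f z) y = \sum_i dot (f z) (u i) * dot (Phi z (u i)) y.
Proof.
rewrite /opmul {1}(onb_sum dot (f z)) linear_sum dot_suml.
by apply: eq_bigr => i _; rewrite linearZ /= dotZl.
Qed.

Lemma vmeasurable_opmul Phi f : (forall x, vmeasurable (fun z => Phi z x)) ->
  vmeasurable f -> vmeasurable (opmul Phi f).
Proof.
move=> mP /(vmeasurableP dot) mf; apply/(vmeasurableP dot) => y.
under eq_fun do rewrite dot_opmul.
apply: cmeas_sum => i; apply: cmeasM => //.
by have /(vmeasurableP dot) := mP (u i).
Qed.

(** Here boundedness of f matters: the product of two merely square-integrable entries would only be
    integrable. *)
Lemma L2_opmul_bounded Phi f : (forall x, L2 (fun z => Phi z x)) ->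
  vmeasurable f -> ae_bounded f -> L2 (opmul Phi f).
Proof.
move=> hP /(vmeasurableP dot) mf [M fM]; apply/L2P => y.
under eq_fun do rewrite dot_opmul.
apply: csq_sum => i.
apply: (@csq_bounded_mul _ M (fun z => dot (f z) (u i))
  (fun z => dot (Phi z (u i)) y)); first exact: mf.
  apply: filterS fM => z fz.
  have := Re_dot_le dot (f z) (u i); have := Im_dot_le dot (f z) (u i).
  by rewrite hnorm_onb mulr1 => h1 h2; split; exact: le_trans fz.
by have /L2P := hP (u i).
Qed.

Lemma L2_adj Phi : (forall x, L2 (fun z => Phi z x)) ->
  forall x, L2 (fun z => adj dot (Phi z) x).
Proof.
move=> hP x; apply/L2P => y; under eq_fun do rewrite adjPl dotC.
by apply: csq_conj; have /L2P := hP y.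
Qed.

Lemma ip_opmul Phi f g :
  ip dot (opmul Phi f) g = ip dot f (opmul (fun z => adj dot (Phi z)) g).
Proof. by apply: eq_cintegral => z; rewrite /opmul adjP. Qed.

Lemma ip_opmul_adj Phi f g :
  ip dot (opmul (fun z => adj dot (Phi z)) f) g = ip dot f (opmul Phi g).
Proof. by apply: eq_cintegral => z; rewrite /opmul adjPl. Qed.

Lemma L2_opmul_unitary Phi f : (forall x, vmeasurable (fun z => Phi z x)) ->
  (\forall z \ae m, unitary dot (Phi z)) -> L2 f -> L2 (opmul Phi f).
Proof.
move=> mP uP hf; have mf := L2_vmeasurable hf.
have mo := vmeasurable_opmul mP mf; split => //.
have /integrableP[_] := integr_hnorm hf.
under eq_integral do rewrite gee0_abs ?lee_fin ?sqr_ge0//.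
apply: le_lt_trans; rewrite le_eqVlt; apply/orP; left; apply/eqP.
have sqm g : vmeasurable g -> measurable_fun setT (fun z => hnorm dot (g z) ^+ 2).
  move=> /(vmeasurableP dot) mg; under eq_fun do rewrite (sqr_hnorm_onb dot).
  apply: measurable_sum => i; have [n1 n2] := mg (u i).
  by apply: measurable_funD; exact: measurable_funX.
apply: ae_eq_integral => //.
- by apply/measurable_EFinP; exact: sqm.
- by apply/measurable_EFinP; exact: sqm.
- by apply: filterS uP => z uz _; rewrite /opmul unitary_hnorm.
Qed.

Lemma ip_unitary Phi f g : L2 f -> L2 g -> L2 (opmul Phi f) -> L2 (opmul Phi g) ->
  (\forall z \ae m, unitary dot (Phi z)) ->
  ip dot (opmul Phi f) (opmul Phi g) = ip dot f g.
Proof.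
move=> hf hg hPf hPg uP; apply: cintegral_ae; try exact/cint_cmeas/cint_dot.
by apply: filterS uP => z uz _; rewrite /opmul unitary_dot.
Qed.

End OperatorFunctions.

(** * The Hardy space and the backward shift *)

Section HardySpace.
Variables (R : realType) (H : vectType R[i]) (dot : {dot H for Num.conj}).
Local Notation m := (circle_measure R).
Local Notation L2 := (L2H dot).
Local Notation H2 := (H2H dot).
Local Notation N := (L2norm dot).
Implicit Types (f g h : circle R -> H).

Definition zX (n : int) f : circle R -> H := fun z => sval z ^ n *: f z.

Lemma zX_zX k n f : zX k (zX n f) = zX (k + n) f.
Proof.
by apply/funext => z; rewrite /zX scalerA -expfzDr ?circle_neq0.
Qed.

Lemma zX0 f : zX 0 f = f.
Proof. by apply/funext => z; rewrite /zX expr0z scale1r. Qed.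

Lemma zXB n f g : zX n (f - g) = zX n f - zX n g.
Proof. by apply/funext => z; rewrite /zX /= scalerBr. Qed.

Lemma zXD n f g : zX n (f + g) = zX n f + zX n g.
Proof. by apply/funext => z; rewrite /zX /= scalerDr. Qed.

Lemma zXZ n a f : zX n (a *: f) = a *: zX n f.
Proof.
apply/funext => z; rewrite /zX -[RHS]/(a *: (sval z ^ n *: f z)).
by rewrite scalerA mulrC -scalerA.
Qed.

Lemma ip_zX n f g : ip dot (zX n f) g = ip dot f (zX (- n) g).
Proof. exact: ip_circleX. Qed.

Lemma L2_zX n f : L2 f -> L2 (zX n f).
Proof. exact: L2_circleX. Qed.

Lemma L2norm_zX n f : N (zX n f) = N f.
Proof. exact: L2norm_circleX. Qed.

Lemma fourier_zX (k n : int) f : L2 f -> fourier (zX k f) n = fourier f (n - k).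
Proof. exact: fourier_circleX. Qed.

Lemma H2_L2 f : H2 f -> L2 f.
Proof. by case. Qed.

Lemma H2P_lin a f g : H2 f -> H2 g -> H2 (a *: f + g).
Proof.
move=> [hf f0] [hg g0]; split; first exact: L2P_lin.
by move=> n n0; rewrite (fourierP _ _ hf hg) f0// g0// scaler0 addr0.
Qed.

Lemma H2_cst x : H2 (fun=> x).
Proof.
split; first exact: L2_cst.
by move=> n n0; rewrite (fourier_cst dot) lt_eqF// scale0r.
Qed.

Lemma H2_0 : H2 0.
Proof. exact: (H2_cst 0). Qed.

Lemma H2B f g : H2 f -> H2 g -> H2 (f - g).
Proof.
by move=> hf hg; rewrite addrC -scaleN1r; exact: H2P_lin.
Qed.

Lemma H2D f g : H2 f -> H2 g -> H2 (f + g).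
Proof. by move=> hf hg; rewrite -[f]scale1r; exact: H2P_lin. Qed.

Lemma H2_zX (k : nat) f : H2 f -> H2 (zX k f).
Proof.
move=> [hf f0]; split; first exact: L2_zX.
by move=> n n0; rewrite fourier_zX// f0// subr_lt0 (lt_le_trans n0).
Qed.

Lemma H2_ae f g : L2 f -> f = g %[ae m] -> H2 g -> H2 f.
Proof.
move=> hf fg [hg g0]; split => // n n0.
by rewrite (fourier_ae n hf hg fg) g0.
Qed.

Lemma dot_value0 f y : L2 f -> dot (value0 f) y = ip dot f (fun=> y).
Proof.
move=> hf; rewrite /value0 dot_fourier//; congr (ip dot f _).
by apply/funext => z; rewrite expr0z scale1r.
Qed.

Lemma value0_ae f g : L2 f -> L2 g -> f = g %[ae m] -> value0 f = value0 g.
Proof. exact: fourier_ae. Qed.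

Lemma value0_cst x : value0 (fun=> x) = x :> H.
Proof. by rewrite /value0 (fourier_cst dot) eqxx scale1r. Qed.

Lemma value0_zX1 f : H2 f -> value0 (zX 1 f) = 0.
Proof. by move=> [hf f0]; rewrite /value0 fourier_zX// f0. Qed.

Definition bshift f : circle R -> H := zX (-1) (f - cst (value0 f)).

Lemma bshift_L2 f : L2 f -> L2 (bshift f).
Proof. by move=> hf; apply/L2_zX/L2B => //; exact: L2_cst. Qed.

Lemma fourier_bshift f (n : int) : L2 f ->
  fourier (bshift f) n = fourier f (n + 1) - (n + 1 == 0)%:R *: value0 f.
Proof.
move=> hf; have hc := L2_cst dot (value0 f).
rewrite fourier_zX ?opprK; last exact: L2B.
by rewrite (fourierB _ hf hc) (fourier_cst dot).
Qed.

Lemma bshift_H2 f : H2 f -> H2 (bshift f).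
Proof.
move=> [hf f0]; split; first exact: bshift_L2.
move=> n n0; rewrite fourier_bshift//.
have [e|e] := eqVneq (n + 1) 0; first by rewrite e scale1r subrr.
by rewrite scale0r subr0 f0// lt_neqAle e -ltzD1 ltrD2r.
Qed.

Lemma bshiftK f : zX 1 (bshift f) = f - cst (value0 f).
Proof. by rewrite /bshift zX_zX zX0. Qed.

Lemma ip_zX1_cst f x : H2 f -> ip dot (zX 1 f) (fun=> x) = 0.
Proof.
by move=> hf; rewrite -dot_value0; [rewrite value0_zX1 ?dot0l|exact/L2_zX/H2_L2].
Qed.

(** Pythagoras for f = f(0) + z B f, since z H^2 is orthogonal to the constants. *)
Lemma sqr_L2norm_bshift f : H2 f ->
  N f ^+ 2 = hnorm dot (value0 f) ^+ 2 + N (bshift f) ^+ 2.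
Proof.
move=> hf; have hB := bshift_H2 hf.
have hc := L2_cst dot (value0 f).
have {1}-> : f = zX 1 (bshift f) + cst (value0 f) by rewrite bshiftK subrK.
rewrite sqr_L2normD//; last exact/L2_zX/H2_L2.
rewrite ip_zX1_cst// mulr0 addr0 addrC L2norm_zX; congr (_ + _).
by rewrite sqr_L2norm ip_cst sqr_hnorm.
Qed.

(** The Taylor polynomial of degree below n in Horner form. Recursion through [bshift] makes the
    remainder z^n B^n f and matches the later iteration. *)
Fixpoint psum n f : circle R -> H :=
  if n is n'.+1 then cst (value0 f) + zX 1 (psum n' (bshift f)) else 0.

Lemma psum_H2 n f : H2 f -> H2 (psum n f).
Proof.
elim: n f => [|n IH] f hf; first exact: H2_0.
by apply: H2D; [exact: H2_cst|apply: (@H2_zX 1); apply/IH/bshift_H2].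
Qed.

Lemma iter_bshift_H2 n f : H2 f -> H2 (iter n bshift f).
Proof. by move=> hf; elim: n => //= n; exact: bshift_H2. Qed.

Lemma sub_psum n f : f - psum n f = zX n (iter n bshift f).
Proof.
elim: n f => [|n IH] f; first by rewrite subr0 zX0.
have -> : f - psum n.+1 f = zX 1 (bshift f - psum n (bshift f)).
  by rewrite zXB bshiftK /= opprD addrA.
by rewrite IH zX_zX iterSr.
Qed.

Lemma sqr_L2norm_psum n f : H2 f ->
  N (psum n f) ^+ 2 = N f ^+ 2 - N (iter n bshift f) ^+ 2.
Proof.
elim: n f => [|n IH] f hf; first by rewrite /= subrr L2norm0 expr0n.
have hB := bshift_H2 hf; have hp := psum_H2 n hB.
have hc : N (cst (value0 f)) ^+ 2 = hnorm dot (value0 f) ^+ 2.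
  by rewrite sqr_L2norm ip_cst sqr_hnorm.
have -> : psum n.+1 f = zX 1 (psum n (bshift f)) + cst (value0 f).
  by rewrite addrC.
rewrite sqr_L2normD; [|exact/L2_zX/H2_L2|exact: L2_cst].
rewrite ip_zX1_cst// mulr0 addr0 L2norm_zX IH// -iterSr hc (sqr_L2norm_bshift hf).
by rewrite addrAC; congr (_ - _); rewrite addrC.
Qed.

Lemma psum_sub n k f : psum (n + k) f - psum n f = zX n (psum k (iter n bshift f)).
Proof.
elim: n f => [|n IH] f; first by rewrite subr0 zX0.
by rewrite addSn /= opprD addrACA subrr add0r -zXB IH zX_zX -iterSr.
Qed.

(** By [psum_sub] and Pythagoras, the squared norm of a block of Taylor terms is a difference of two
    values of N (B^n f) ^+ 2. Beyond an index where this quantity is close to its infimum, such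
    blocks are small. *)
Lemma psum_cauchy f : H2 f -> cauchyL2 dot (psum ^~ f).
Proof.
move=> hf e e0.
pose a n : R := N (iter n bshift f) ^+ 2.
pose S : set R := [set a n | n in [set: nat]].
have S0 : has_inf S.
  by split; [exists (a 0%N), 0%N|exists 0 => _ [n _ <-]; exact: sqr_ge0].
have infS n : inf S <= a n by apply: ge_inf; [case: S0|exists n].
have e2 : 0 < (e / 2) ^+ 2 by rewrite exprn_gt0// divr_gt0.
have [_ [n0 _ <-] hn0] := inf_adherent e2 S0.
have main k : N (psum (n0 + k) f - psum n0 f) <= e / 2.
  rewrite -(@ler_pXn2r _ 2%N) ?nnegrE ?L2norm_ge0 ?divr_ge0 ?(ltW e0)//.
  rewrite psum_sub L2norm_zX sqr_L2norm_psum; last exact: iter_bshift_H2.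
  rewrite -iterD addnC; have h := infS (n0 + k)%N.
  have aux (x y b c : R) : x < b + c -> b <= y -> x - y <= c by lra.
  exact: aux hn0 h.
exists n0 => p q hp hq.
have Lp n : L2 (psum n f) by exact/H2_L2/psum_H2.
have -> : psum p f - psum q f = (psum p f - psum n0 f) + (psum n0 f - psum q f).
  by rewrite addrA subrK.
apply: (le_trans (L2normD (L2B (Lp _) (Lp _)) (L2B (Lp _) (Lp _)))).
rewrite (splitr e) lerD//; first by rewrite -(subnKC hp).
by rewrite L2norm_distC// -(subnKC hq).
Qed.

(** The limit given by completeness has the Fourier coefficients of f, because the remainder z^n B^n
    f has none below n; uniqueness then identifies it with f. *)
Lemma psum_cvg f : H2 f -> cvgL2 dot (psum ^~ f) f.
Proof.
move=> hf; have Lf := H2_L2 hf.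
have Lp n : L2 (psum n f) by exact/H2_L2/psum_H2.
have [g Lg cg] := L2_complete Lp (psum_cauchy hf).
have fg : f - g = (fun=> 0) %[ae m].
  apply: (fourier_eq0_ae (L2B Lf Lg)) => k; apply: (@dot_inj _ _ dot) => y.
  rewrite dot0l dot_fourier; last exact: L2B.
  (* Shifting the sequence by j puts every remainder beyond index k, as [cvgL2_ip] asks for
     orthogonality of all terms. *)
  pose j := `|k|%N.+1.
  apply: (@cvgL2_ip _ _ _ (fun n => f - psum (n + j) f)).
  - by move=> n; exact: L2B.
  - exact: L2B.
  - exact/L2_circleX/L2_cst.
  - move=> e e0; have [n0 hn0] := cg e e0; exists n0 => n hn.
    rewrite opprB addrC addrA subrK L2norm_distC//; apply: hn0.
    by rewrite (leq_trans hn)// leq_addr.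
  - move=> n; rewrite -dot_fourier; last exact: L2B.
    rewrite sub_psum fourier_zX; last exact/H2_L2/iter_bshift_H2.
    have [_ ->] := iter_bshift_H2 (n + j) hf; first by rewrite dot0l.
    rewrite subr_lt0 /j addnS; apply: (le_lt_trans (lez_abs k)).
    by rewrite ltz_nat ltnS leq_addl.
move=> e e0; have [n0 hn0] := cg e e0; exists n0 => n hn.
rewrite (@L2norm_ae _ _ _ _ (psum n f - g)); [exact: hn0|exact: L2B|exact: L2B|].
apply: filterS fg => z h _; have := h I => /eqP.
by rewrite /= subr_eq0 => /eqP fz; congr (_ - _).
Qed.

(** B^n f has the norm of the Taylor remainder z^n B^n f. *)
Lemma iter_bshift_cvg0 f : H2 f -> forall e : R, 0 < e ->
  exists n0, forall n, (n0 <= n)%N -> N (iter n bshift f) <= e.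
Proof.
move=> hf e e0; have [n0 hn0] := psum_cvg hf e0; exists n0 => n hn.
rewrite -(L2norm_zX n) -sub_psum L2norm_distC; [exact: hn0| |].
  exact: H2_L2.
exact/H2_L2/psum_H2.
Qed.

(** By density it suffices to treat Taylor polynomials; peeling off the constant term replaces v by
    v / z, whose nonnegative coefficients still vanish. *)
Lemma H2_orth v h : L2 v -> (forall j : nat, fourier v j = 0) -> H2 h -> ip dot v h = 0.
Proof.
move=> Lv v0 hh; rewrite ipC//; last exact: H2_L2.
suff -> : ip dot h v = 0 by rewrite rmorph0.
apply: (@cvgL2_ip _ _ _ (psum ^~ h)) => //.
- by move=> n; exact/H2_L2/psum_H2.
- exact: H2_L2.
- exact: psum_cvg.
move=> n; elim: n h hh v Lv v0 => [|n IH] h hh v Lv v0; first by rewrite ip0l.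
have hB := bshift_H2 hh; have hp := psum_H2 n hB.
rewrite /= ipDl//; [|exact: L2_cst|exact/L2_zX/H2_L2].
rewrite ipC//; last exact: L2_cst.
rewrite -dot_value0// /value0 (v0 0%N) dot0l rmorph0 add0r ip_zX.
apply: IH => //; first exact: L2_zX.
by move=> j; rewrite fourier_zX// opprK -(v0 j.+1) -addn1.
Qed.

End HardySpace.

Opaque L2H ip.

(** * Model spaces *)

Section ModelSpaceTheory.
Variables (R : realType) (H : vectType R[i]) (dot : {dot H for Num.conj}).
Local Notation m := (circle_measure R).
Local Notation L2 := (L2H dot).
Local Notation H2 := (H2H dot).
Local Notation N := (L2norm dot).
Variable Theta : circle R -> 'End(H).
Hypothesis innerT : inner dot Theta.
Implicit Types (f g h : circle R -> H).
Local Notation K := (model dot Theta).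
Local Notation T0 := (value0 Theta).
Local Notation Theta' := (fun z => adj dot (Theta z)).

Lemma inner_L2L : L2L dot Theta.
Proof. by case: innerT => -[[]]. Qed.

Lemma inner_unitary : \forall z \ae m, unitary dot (Theta z).
Proof. by case: innerT. Qed.

Lemma inner_unitary_adj : \forall z \ae m, unitary dot (Theta' z).
Proof.
by apply: filterS inner_unitary => z [h1 h2]; split; rewrite adj_adj.
Qed.

Lemma inner_col x : L2 (fun z => Theta z x).
Proof. by have /L2LP := inner_L2L. Qed.

Lemma inner_adj_col x : L2 (fun z => adj dot (Theta z) x).
Proof. exact: (L2_adj inner_col). Qed.

Lemma inner_opmul f : L2 f -> L2 (opmul Theta f).
Proof.
apply: L2_opmul_unitary; last exact: inner_unitary.
by move=> x; exact/L2_vmeasurable/inner_col.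
Qed.

Lemma inner_opmul_adj f : L2 f -> L2 (opmul Theta' f).
Proof.
apply: L2_opmul_unitary; last exact: inner_unitary_adj.
by move=> x; exact/L2_vmeasurable/inner_adj_col.
Qed.

Lemma ip_inner f g : L2 f -> L2 g ->
  ip dot (opmul Theta f) (opmul Theta g) = ip dot f g.
Proof.
move=> hf hg; apply: (ip_unitary hf hg (inner_opmul hf) (inner_opmul hg)).
exact: inner_unitary.
Qed.

Lemma T0E x : T0 x = value0 (fun z => Theta z x).
Proof. exact/fourier_eval/inner_L2L. Qed.

Lemma inner_col_H2 x : H2 (fun z => Theta z x).
Proof.
split; first exact: inner_col.
move=> n n0; rewrite -(fourier_eval _ _ inner_L2L).
by case: innerT => -[[_ -> //] _] _; rewrite zero_lfunE.
Qed.

Lemma opmul_zX (Phi : circle R -> 'End(H)) n f :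
  opmul Phi (zX n f) = zX n (opmul Phi f).
Proof. by apply/funext => z; rewrite /opmul /zX linearZ. Qed.

Lemma opmulP_lin (Phi : circle R -> 'End(H)) a f g :
  opmul Phi (a *: f + g) = a *: opmul Phi f + opmul Phi g.
Proof. by apply/funext => z; rewrite /opmul linearP. Qed.

Lemma opmulD (Phi : circle R -> 'End(H)) f g :
  opmul Phi (f + g) = opmul Phi f + opmul Phi g.
Proof. by apply/funext => z; rewrite /opmul linearD. Qed.

Lemma opmulB (Phi : circle R -> 'End(H)) f g :
  opmul Phi (f - g) = opmul Phi f - opmul Phi g.
Proof. by apply/funext => z; rewrite /opmul linearB. Qed.

(** The product Theta h is not expanded: the adjoint columns, minus their constant terms, have no
    nonnegative coefficients and so are orthogonal to h. *)
Lemma value0_inner h : H2 h -> value0 (opmul Theta h) = T0 (value0 h).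
Proof.
move=> hh; have Lh := H2_L2 hh; have Lo := inner_opmul Lh.
apply: (@dot_inj _ _ dot) => y; rewrite dot_value0// ip_opmul adjP dot_value0//.
have La := inner_adj_col y; have Lc := L2_cst dot (adj dot T0 y).
apply/eqP; rewrite -subr_eq0 -(ipBr La Lc Lh); apply/eqP.
have Lac := L2B La Lc.
rewrite (ipC Lh Lac) (H2_orth Lac _ hh); first by rewrite rmorph0.
move=> j; rewrite (fourierB _ La Lc); apply: (@dot_inj _ _ dot) => x.
rewrite dot0l dotBl dot_fourier// (fourier_cst dot).
rewrite ip_opmul_adj -/(zX j (fun=> x)) opmul_zX.
rewrite (ipC (L2_cst dot y) (L2_zX j (inner_col x))) ip_zX.
have -> : ip dot (opmul Theta (fun=> x)) (zX (- j%:Z) (fun=> y)) =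
    dot (fourier (fun z => Theta z x) (- j%:Z)) y.
  by rewrite (dot_fourier _ _ (inner_col x)).
case: j => [|j].
  by rewrite oppr0 eqxx scale1r adjPl T0E -dotC subrr.
rewrite [_ == 0](_ : _ = false)// scale0r dot0l subr0.
by have [_ ->] := inner_col_H2 x; rewrite ?dot0l ?rmorph0.
Qed.

Lemma model_H2 f : K f -> H2 f.
Proof. by case. Qed.

Lemma model_L2 f : K f -> L2 f.
Proof. by case=> /H2_L2. Qed.

Lemma ip_model_inner f h : K f -> H2 h -> ip dot f (opmul Theta h) = 0.
Proof. by case=> _; apply. Qed.

Lemma modelP_lin a f g : K f -> K g -> K (a *: f + g).
Proof.
move=> Kf Kg; split; first exact: (H2P_lin _ (model_H2 Kf) (model_H2 Kg)).
move=> h hh; rewrite ipPl ?ip_model_inner ?mulr0 ?addr0//.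
- exact: model_L2.
- exact: model_L2.
- exact/inner_opmul/H2_L2.
Qed.

Lemma model0 : K 0.
Proof. by split; [exact: H2_0|move=> h _; rewrite ip0l]. Qed.

Lemma modelD f g : K f -> K g -> K (f + g).
Proof. by move=> Kf Kg; rewrite -[f]scale1r; exact: modelP_lin. Qed.

Lemma modelZ a f : K f -> K (a *: f).
Proof. by move=> Kf; rewrite -[X in K X]addr0; apply: modelP_lin => //; exact: model0. Qed.

Lemma modelB f g : K f -> K g -> K (f - g).
Proof. by move=> Kf Kg; rewrite addrC -scaleN1r; exact: modelP_lin. Qed.

Lemma model_ae f g : L2 f -> f = g %[ae m] -> K g -> K f.
Proof.
move=> Lf fg Kg; split; first exact: (H2_ae Lf fg (model_H2 Kg)).
move=> h hh; rewrite (ip_ael Lf (model_L2 Kg) _ fg) ?ip_model_inner//.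
exact/inner_opmul/H2_L2.
Qed.

Lemma model_closed (v : nat -> circle R -> H) f :
  (forall n, K (v n)) -> L2 f -> cvgL2 dot v f -> K f.
Proof.
move=> Kv Lf cv; have Lv n : L2 (v n) by exact/model_L2/Kv.
split; first split => //.
  move=> n n0; apply: (@dot_inj _ _ dot) => y; rewrite dot0l dot_fourier//.
  apply: (cvgL2_ip Lv) => //; first exact/L2_circleX/L2_cst.
  move=> k; rewrite -dot_fourier//.
  by have [[_ ->//] _] := Kv k; rewrite dot0l.
move=> h hh; apply: (cvgL2_ip Lv) => //; first exact/inner_opmul/H2_L2.
by move=> n; exact: ip_model_inner.
Qed.

Lemma model_riesz (l : (circle R -> H) -> R[i]) (M : R) :
  (forall a f g, K f -> K g -> l (a *: f + g) = a * l f + l g) ->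
  (forall f, K f -> `|complex.Re (l f)| <= M * N f) ->
  exists2 g, K g & forall f, K f -> l f = ip dot f g.
Proof.
move=> ll lM; apply: (riesz (M := M)) => //.
- exact: model_L2.
- exact: model0.
- exact: modelP_lin.
- exact: model_closed.
Qed.

(** The Riesz vector of h |-> <h, f> on the closed subspace K is the projection, so [xget] never
    takes its default here. *)
Lemma projP f : L2 f -> K (Defs.proj dot Theta f) /\
  forall h, K h -> ip dot (f - Defs.proj dot Theta f) h = 0.
Proof.
move=> Lf; rewrite /Defs.proj; case: xgetP => [g _ //|nex]; exfalso.
have [|h Kh|g Kg hg] := @model_riesz (fun h => ip dot h f) (N f).
- by move=> a g h Kg Kh; rewrite ipPl//; exact: model_L2.
- by rewrite mulrC; apply: Re_ip_le => //; exact: model_L2.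
apply: (nex g); split => // h Kh.
have Lg := model_L2 Kg; have Lh := model_L2 Kh.
by rewrite ipBl// ipC// hg// -ipC// subrr.
Qed.

Lemma proj_model f : L2 f -> K (Defs.proj dot Theta f).
Proof. by move=> /projP[]. Qed.

Lemma ip_proj f h : L2 f -> K h -> ip dot (Defs.proj dot Theta f) h = ip dot f h.
Proof.
move=> Lf Kh; have [Kp /(_ _ Kh)] := projP Lf.
rewrite (ipBl Lf (model_L2 Kp) (model_L2 Kh)).
by move/eqP; rewrite subr_eq0 => /eqP.
Qed.

Lemma model_inj f g : K f -> K g -> (forall h, K h -> ip dot f h = ip dot g h) ->
  f = g %[ae m].
Proof.
move=> Kf Kg fg; have Kd := modelB Kf Kg; have Ld := model_L2 Kd.
have := ip_eq0_ae Ld; rewrite {1}ipBl ?fg ?subrr//; [|exact: model_L2..].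
move=> /(_ erefl); apply: filterS => z h _; have := h I => /eqP.
by rewrite subr_eq0 => /eqP.
Qed.

Lemma proj_unique f g : L2 f -> K g -> (forall h, K h -> ip dot f h = ip dot g h) ->
  Defs.proj dot Theta f = g %[ae m].
Proof.
move=> Lf Kg fg; apply: model_inj => //; first exact: proj_model.
by move=> h Kh; rewrite ip_proj// fg.
Qed.

Lemma ip_cst_inner x h : H2 h -> ip dot (fun=> x) (opmul Theta h) = dot x (T0 (value0 h)).
Proof.
move=> hh; have Lo := inner_opmul (H2_L2 hh).
by rewrite ipC//; [rewrite -dot_value0// value0_inner// -dotC|exact: L2_cst].
Qed.

Lemma ip_cst_H2 x h : L2 h -> ip dot (fun=> x) h = dot x (value0 h).
Proof.
by move=> Lh; rewrite ipC//; [rewrite -dot_value0// -dotC|exact: L2_cst].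
Qed.

Definition k0 x : circle R -> H := fun z => x - Theta z (adj dot T0 x).

Lemma k0E x : k0 x = cst x - opmul Theta (cst (adj dot T0 x)).
Proof. by []. Qed.

Lemma k0_L2 x : L2 (k0 x).
Proof. by rewrite k0E; apply: L2B; [exact: L2_cst|exact: inner_col]. Qed.

(** Against Theta h, both terms of k0 x give <x, Theta(0) h(0)>: the first by [value0_inner], the
    second because Theta is isometric. *)
Lemma k0_model x : K (k0 x).
Proof.
split; first by rewrite k0E; apply: H2B; [exact: H2_cst|exact: inner_col_H2].
move=> h hh; have Lo := inner_opmul (H2_L2 hh).
rewrite k0E ipBl//; [|exact: L2_cst|exact: inner_col].
rewrite ip_inner; [|exact: L2_cst|exact: H2_L2].
by rewrite ip_cst_inner// ip_cst_H2; [rewrite adjPl subrr|exact: H2_L2].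
Qed.

Lemma ip_k0 x h : K h -> ip dot (k0 x) h = dot x (value0 h).
Proof.
move=> Kh; have Lh := model_L2 Kh; have Lx := inner_col (adj dot T0 x).
rewrite k0E ipBl//; [|exact: L2_cst].
rewrite ip_cst_H2// [ip dot (opmul _ _) h]ipC// ip_model_inner//; last exact: H2_cst.
by rewrite rmorph0 subr0.
Qed.

Definition kt x : circle R -> H := bshift (fun z => Theta z x).

Lemma ktE x : kt x = zX (-1) (opmul Theta (cst x) - cst (T0 x)).
Proof. by rewrite T0E. Qed.

Lemma kt_pointE x : kt x = fun z => (sval z)^* *: (Theta z x - T0 x).
Proof. by rewrite ktE; apply/funext => z; rewrite /zX -circleX_conj expr1z. Qed.

Lemma kt_L2 x : L2 (kt x).
Proof. exact/bshift_L2/inner_col. Qed.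

(** Moving 1/z to the other side replaces h by z h, which vanishes at 0, and this kills both
    terms. *)
Lemma kt_model x : K (kt x).
Proof.
split; first exact/bshift_H2/inner_col_H2.
move=> h hh; have Lo := inner_opmul (H2_L2 hh).
rewrite ktE ip_zX opprK ipBl; [|exact: inner_col|exact: L2_cst|exact: L2_zX].
rewrite -opmul_zX ip_inner; [|exact: L2_cst|exact/L2_zX/H2_L2].
rewrite ip_cst_inner; last exact: (H2_zX 1 hh).
rewrite ip_cst_H2; last exact/L2_zX/H2_L2.
by rewrite (value0_zX1 hh) [T0 0]linear0 !dot0r subrr.
Qed.

Definition ct h : H := fourier (opmul Theta' h) (-1).

Lemma ip_kt x h : K h -> ip dot (kt x) h = dot x (ct h).
Proof.
move=> Kh; have Lh := model_L2 Kh; have hh := model_H2 Kh.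
rewrite ktE ip_zX opprK ipBl; [|exact: inner_col|exact: L2_cst|exact: L2_zX].
rewrite ip_cst_H2; last exact: L2_zX.
rewrite (value0_zX1 hh) dot0r subr0 ip_opmul opmul_zX.
have La := inner_opmul_adj Lh.
rewrite ipC; [|exact: L2_cst|exact: L2_zX].
by rewrite ip_zX -dot_fourier// -dotC.
Qed.

Lemma bshift_model f : K f -> K (bshift f).
Proof.
move=> Kf; have Lf := model_L2 Kf; have hf := model_H2 Kf.
split; first exact: bshift_H2.
move=> h hh; have Lo := inner_opmul (H2_L2 hh); have hz := H2_zX 1 hh.
rewrite /bshift ip_zX opprK ipBl; [|exact: Lf|exact: L2_cst|exact: L2_zX].
rewrite -opmul_zX ip_model_inner// ip_cst_inner//.
by rewrite (value0_zX1 hh) [T0 0]linear0 dot0r subrr.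
Qed.

Definition shift f : circle R -> H := zX 1 f - opmul Theta (cst (ct f)).

(** Theta h / z equals Theta B h + Theta h(0) / z, and f is orthogonal to the first term. So <z f,
    Theta h> depends only on h(0), and subtracting Theta c(f) cancels it. *)
Lemma shift_model f : K f -> K (shift f).
Proof.
move=> Kf; have Lf := model_L2 Kf; have hf := model_H2 Kf.
split; first by apply: H2B; [exact: (H2_zX 1 hf)|exact: inner_col_H2].
move=> h hh; have Lo := inner_opmul (H2_L2 hh); have Lh := H2_L2 hh.
rewrite (ipBl (L2_zX 1 Lf) (inner_col (ct f)) Lo) (ip_inner (L2_cst dot (ct f)) Lh).
rewrite ip_cst_H2// ip_zX.
have -> : zX (- 1) (opmul Theta h) = opmul Theta (bshift h) +
    zX (-1) (opmul Theta (cst (value0 h))).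
  by rewrite -!opmul_zX -opmulD -zXD subrK.
rewrite (ipDr (inner_opmul (bshift_L2 Lh)) (L2_zX (-1) (inner_col (value0 h))) Lf).
rewrite (ip_model_inner Kf (bshift_H2 hh)).
have La := inner_opmul_adj Lf.
by rewrite add0r -opmul_zX -ip_opmul_adj -dot_fourier// subrr.
Qed.

Lemma ip_shift f h : K f -> K h -> ip dot (shift f) h = ip dot (zX 1 f) h.
Proof.
move=> Kf Kh; have Lf := model_L2 Kf; have Lh := model_L2 Kh.
rewrite (ipBl (L2_zX 1 Lf) (inner_col (ct f)) Lh) (ipC (inner_col (ct f)) Lh).
by rewrite (ip_model_inner Kh (H2_cst dot _)) rmorph0 subr0.
Qed.

Lemma ip_bshift_H2 f h : L2 f -> H2 h -> ip dot (bshift f) h = ip dot (zX (-1) f) h.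
Proof.
move=> Lf hh; have Lh := H2_L2 hh.
rewrite /bshift zXB (ipBl (L2_zX (-1) Lf) (L2_zX (-1) (L2_cst dot (value0 f))) Lh).
rewrite [ip dot (zX _ (cst _)) h]ip_zX opprK ip_cst_H2; last exact: L2_zX.
by rewrite (value0_zX1 hh) dot0r subr0.
Qed.

Lemma ip_shift_bshift f h : K f -> K h -> ip dot (shift f) h = ip dot f (bshift h).
Proof.
move=> Kf Kh; have Lf := model_L2 Kf; have Lh := model_L2 Kh.
rewrite (ip_shift Kf Kh) ip_zX (ipC Lf (bshift_L2 Lh)).
by rewrite (ip_bshift_H2 Lh (model_H2 Kf)) -(ipC Lf (L2_zX _ Lh)).
Qed.

Lemma cshiftE f : K f -> cshift dot Theta f = shift f %[ae m].
Proof.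
move=> Kf; have Lf := model_L2 Kf; rewrite /cshift.
rewrite (_ : (fun z => _) = zX 1 f); last by apply/funext => z; rewrite /zX expr1z.
apply: proj_unique; [exact: L2_zX|exact: shift_model|].
by move=> h Kh; rewrite ip_shift.
Qed.

Lemma cshift_adjE f : K f -> cshift_adj dot Theta f = bshift f %[ae m].
Proof.
move=> Kf; have Lf := model_L2 Kf; rewrite /cshift_adj.
rewrite (_ : (fun z => _) = zX (-1) f); last first.
  by apply/funext => z; rewrite /zX -circleX_conj expr1z.
apply: proj_unique; [exact: L2_zX|exact: bshift_model|].
by move=> h Kh; rewrite ip_bshift_H2//; exact: model_H2.
Qed.

Lemma cshift_model f : K f -> K (cshift dot Theta f).
Proof.
move=> Kf; have Lf := L2_zX 1 (model_L2 Kf).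
rewrite /cshift (_ : (fun z => _) = zX 1 f); first exact: proj_model.
by apply/funext => z; rewrite /zX expr1z.
Qed.

Lemma cshift_adj_model f : K f -> K (cshift_adj dot Theta f).
Proof.
move=> Kf; have Lf := L2_zX (-1) (model_L2 Kf).
rewrite /cshift_adj (_ : (fun z => _) = zX (-1) f); first exact: proj_model.
by apply/funext => z; rewrite /zX -circleX_conj expr1z.
Qed.

Lemma ct_ae f g : L2 f -> L2 g -> f = g %[ae m] -> ct f = ct g.
Proof.
move=> Lf Lg fg; apply: fourier_ae; try exact: inner_opmul_adj.
by apply: filterS fg => z h _; rewrite /opmul h.
Qed.

(** Pairing with y through [ip_kt] leaves <Theta y - Theta(0) y, f - f(0)>, of which only -<Theta(0)
    y, f(0)> survives, since f is orthogonal to Theta y. *)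
Lemma ct_bshift f : K f -> ct (bshift f) = - adj dot T0 (value0 f).
Proof.
move=> Kf; have Lf := model_L2 Kf; have hf := model_H2 Kf.
apply: (@dot_inj _ _ dot) => y; rewrite dotC [RHS]dotC; congr (_^*).
rewrite -ip_kt; last exact: bshift_model.
have Ly := inner_col y; have Lc := L2_cst dot (T0 y).
rewrite ktE /bshift ip_zX zX_zX subrr zX0.
have Lcf := L2_cst dot (value0 f).
rewrite (ipBl Ly Lc (L2B Lf Lcf)) (ipBr Lf Lcf Ly) (ipBr Lf Lcf Lc).
rewrite ip_cst_H2// [ip dot (opmul _ _) f]ipC// ip_model_inner//; last exact: H2_cst.
rewrite rmorph0 sub0r ip_cst subrr subr0.
rewrite -dot_value0// -T0E -[in RHS]scaleN1r dotZr rmorphN1 mulN1r.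
by rewrite -adjP.
Qed.

Lemma defectE f : K f -> defect dot Theta f = k0 (value0 f) %[ae m].
Proof.
move=> Kf; have Kb := bshift_model Kf; have Ka := cshift_adj_model Kf.
have e := cshift_adjE Kf.
have ec : ct (cshift_adj dot Theta f) = - adj dot T0 (value0 f).
  by rewrite (ct_ae _ _ e) ?ct_bshift//; exact: model_L2.
have e2 := cshiftE Ka.
apply: filterS2 e e2 => z h1 h2 _.
rewrite /defect /= -[LHS]/(f z - cshift dot Theta (cshift_adj dot Theta f) z).
rewrite h2// /shift ec.
rewrite -[(_ - _ : _ -> _) z]/(zX 1 (cshift_adj dot Theta f) z -
  Theta z (- adj dot T0 (value0 f))).
rewrite /zX h1// /bshift /zX scalerA -expfzDr ?circle_neq0// subrr expr0z scale1r.
rewrite linearN opprK /k0 -[(f - _) z]/(f z - value0 f).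
by rewrite opprD opprB addrA [f z + _]addrC subrK.
Qed.

(** Since z f vanishes at 0, the value of S f there is -Theta(0) c(f); hence B S f = f - kt (c
    f). *)
Lemma defect_tE f : K f -> defect_t dot Theta f = kt (ct f) %[ae m].
Proof.
move=> Kf; have hf := model_H2 Kf; have Lf := model_L2 Kf.
have Kc := cshift_model Kf; have Ks := shift_model Kf.
have Lc := model_L2 Kc; have Ls := model_L2 Ks.
have e := cshiftE Kf; have e2 := cshift_adjE Kc.
have v0 : value0 (cshift dot Theta f) = - T0 (ct f).
  rewrite (value0_ae Lc Ls e) /value0 (fourierB 0 (L2_zX 1 Lf) (inner_col (ct f))).
  by rewrite -/(value0 _) (value0_zX1 hf) sub0r -/(value0 _) -T0E.
apply: filterS2 e e2 => z h1 h2 _.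
rewrite /defect_t -[LHS]/(f z - cshift_adj dot Theta (cshift dot Theta f) z).
rewrite h2// /bshift v0 ktE /zX.
rewrite -[(_ - _ : _ -> _) z]/(cshift dot Theta f z - - T0 (ct f)) h1// /shift.
rewrite -[(_ - _ : _ -> _) z]/(sval z ^ 1 *: f z - Theta z (ct f)).
rewrite -[in RHS](opprB (cst _)) -[(- _ : _ -> _) z]/(- (T0 (ct f) - Theta z (ct f))).
rewrite opprK -addrA scalerDr scalerA -expfzDr ?circle_neq0// addNr expr0z scale1r.
by rewrite opprD addrA subrr add0r scalerN addrC.
Qed.

Lemma ae_bounded_cst x : ae_bounded dot (fun=> x).
Proof. by exists (hnorm dot x); exact: nearW. Qed.

Lemma ae_boundedD f g : ae_bounded dot f -> ae_bounded dot g -> ae_bounded dot (f + g).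
Proof.
move=> [M hM] [M' hM']; exists (M + M'); apply: filterS2 hM hM' => z h h'.
by rewrite (le_trans (hnormD _ _ _))// lerD.
Qed.

Lemma ae_boundedN f : ae_bounded dot f -> ae_bounded dot (- f).
Proof.
by move=> [M hM]; exists M; apply: filterS hM => z h; rewrite -[(- f) z]/(- f z) hnormN.
Qed.

Lemma ae_bounded_zX n f : ae_bounded dot f -> ae_bounded dot (zX n f).
Proof.
move=> [M hM]; exists M; apply: filterS hM => z h.
by rewrite /zX hnorm_unit// circleX_norm.
Qed.

Lemma ae_bounded_inner f : ae_bounded dot f -> ae_bounded dot (opmul Theta f).
Proof.
move=> [M hM]; exists M; apply: filterS2 hM inner_unitary => z h uz.
by rewrite /opmul unitary_hnorm.
Qed.

Local Notation Koo := (model_oo dot Theta).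

Lemma model_ooP f : Koo f <-> K f /\ ae_bounded dot f.
Proof. by split=> [[Kf [_ bf]]|[Kf bf]] //; do 2 split => //; exact: model_H2. Qed.

Lemma k0_model_oo x : Koo (k0 x).
Proof.
apply/model_ooP; split; first exact: k0_model.
rewrite k0E; apply: ae_boundedD; first exact: ae_bounded_cst.
exact/ae_boundedN/ae_bounded_inner/ae_bounded_cst.
Qed.

Lemma shift_model_oo f : Koo f -> Koo (shift f).
Proof.
move=> /model_ooP[Kf bf]; apply/model_ooP; split; first exact: shift_model.
apply: ae_boundedD; first exact: ae_bounded_zX.
exact/ae_boundedN/ae_bounded_inner/ae_bounded_cst.
Qed.

Lemma bshift_model_oo f : Koo f -> Koo (bshift f).
Proof.
move=> /model_ooP[Kf bf]; apply/model_ooP; split; first exact: bshift_model.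
by apply/ae_bounded_zX/ae_boundedD => //; exact/ae_boundedN/ae_bounded_cst.
Qed.

(* the vectors S^n k0 x lie in K^oo, and <S^n k0 x, f> = <x, n-th coefficient of f> *)
Lemma model_oo_orth f : K f -> (forall g, Koo g -> ip dot g f = 0) ->
  f = (fun=> 0) %[ae m].
Proof.
move=> Kf f0; have Lf := model_L2 Kf.
have main n x g : K g -> ip dot (iter n shift (k0 x)) g = dot x (fourier g n).
  elim: n g => [|n IH] g Kg; first exact: ip_k0.
  have Ks : K (iter n shift (k0 x)).
    by elim: n {IH} => [|n IH]; [exact: k0_model|exact: shift_model].
  rewrite /= ip_shift_bshift// IH; last exact: bshift_model.
  rewrite (fourier_bshift _ (model_L2 Kg)) (_ : (n%:Z + 1 == 0) = false).
    by rewrite scale0r subr0 -addn1.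
  by rewrite -PoszD addn1.
apply: (fourier_eq0_ae Lf) => -[] n; last by have [[_ ->]] := Kf.
apply: (@dot_inj _ _ dot) => x; rewrite dot0l dotC -main// f0 ?rmorph0//.
by elim: n => [|n IH]; [exact: k0_model_oo|exact: shift_model_oo].
Qed.

End ModelSpaceTheory.

(** * Operators on defect spaces *)

Section KernelPairs.
Variables (R : realType) (H : vectType R[i]) (dot : {dot H for Num.conj}).
Local Notation m := (circle_measure R).
Local Notation u := (onb dot).
Local Notation L2 := (L2H dot).
Local Notation N := (L2norm dot).
Implicit Types (f g h : circle R -> H).

Lemma L2normZ_le a f : L2 f ->
  N (a *: f) <= (`|complex.Re a| + `|complex.Im a|) * N f.
Proof.
move=> Lf; have Lif := L2Z 'i%C Lf.
have scal (t : R) g : L2 g -> N (t%:C%C *: g) = `|t| * N g.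
  move=> Lg; apply/eqP.
  rewrite -(@eqrXn2 _ 2%N)// ?mulr_ge0 ?L2norm_ge0// exprMn real_normK ?num_real//.
  have := sqr_L2normPl t Lg (L2_0 dot); rewrite addr0 => ->.
  rewrite Re_ip_sym ?ip0l//; last exact: L2_0.
  by rewrite mulr0 addr0 L2norm0 (_ : (0 : R) ^+ 2 = 0) ?expr0n// addr0.
have -> : a *: f = (complex.Re a)%:C%C *: f + (complex.Im a)%:C%C *: ('i%C *: f).
  rewrite scalerA -scalerDl; congr (_ *: _).
  by apply: complex_eq; rewrite ?(ReD, ImD, ReM, ImM) /=; ring.
apply: (le_trans (L2normD (L2Z _ Lf) (L2Z _ Lif))).
by rewrite !scal// L2normi// mulrDl.
Qed.

Lemma L2norm_sum (I : Type) (s : seq I) (F : I -> circle R -> H) :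
  (forall i, L2 (F i)) -> N (\sum_(i <- s) F i) <= \sum_(i <- s) N (F i).
Proof.
move=> hF; elim: s => [|i s IH]; first by rewrite !big_nil L2norm0.
rewrite !big_cons (le_trans (L2normD (hF i) (L2_sum _ hF)))//.
by rewrite lerD2l.
Qed.

Section LinearFamily.
Variable G : H -> circle R -> H.
Hypothesis Glin : forall a x y, G (a *: x + y) = a *: G x + G y.
Hypothesis GL : forall x, L2 (G x).

Lemma family0 : G 0 = 0.
Proof.
by have := Glin 1 0 0; rewrite !scale1r addr0 -[in LHS](addr0 (G 0)) => /addrI.
Qed.

Lemma family_sum x : G x = \sum_i dot x (u i) *: G (u i).
Proof.
rewrite {1}(onb_sum dot x); elim/big_rec2 : _ => [|i a b _ <-]; first exact: family0.
exact: Glin.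
Qed.

Lemma family_bounded : exists2 C, 0 <= C & forall x, N (G x) <= C * hnorm dot x.
Proof.
exists (\sum_i 2 * N (G (u i))).
  by apply: sumr_ge0 => i _; rewrite mulr_ge0// L2norm_ge0.
move=> x; rewrite family_sum mulr_suml.
apply: (le_trans (L2norm_sum _ _)); first by move=> i; exact: L2Z.
apply: ler_sum => i _; apply: (le_trans (L2normZ_le _ (GL _))).
rewrite -mulrA [N _ * _]mulrC mulrA ler_wpM2r ?L2norm_ge0//.
have := Re_dot_le dot x (u i); have := Im_dot_le dot x (u i).
by rewrite hnorm_onb mulr1; lra.
Qed.

End LinearFamily.

(* k parametrizes a defect space E inside the model space and c is the adjoint of k *)
Definition kernel_pair (Theta : circle R -> 'End(H)) (k : H -> circle R -> H)
    (c : (circle R -> H) -> H) (E : set (circle R -> H)) : Prop :=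
  [/\ forall a x y, k (a *: x + y) = a *: k x + k y,
      forall x, model dot Theta (k x),
      forall x h, model dot Theta h -> ip dot (k x) h = dot x (c h),
      forall x, c (k x) = 0 -> x = 0 &
      forall f, E f <-> L2 f /\ exists x, f = k x %[ae m]].

Section OneKernelPair.
Variables (Theta : circle R -> 'End(H)).
Hypothesis innerT : inner dot Theta.
Variables (k : H -> circle R -> H) (c : (circle R -> H) -> H) (E : set (circle R -> H)).
Hypothesis kp : kernel_pair Theta k c E.
Local Notation K := (model dot Theta).

Let klin : forall a x y, k (a *: x + y) = a *: k x + k y.
Proof. by case: kp. Qed.
Let kK x : K (k x).
Proof. by case: kp. Qed.
Let kc x h : K h -> ip dot (k x) h = dot x (c h).
Proof. by case: kp => _ _ + _ _; apply. Qed.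
Let kinj x : c (k x) = 0 -> x = 0.
Proof. by case: kp => _ _ _ + _; apply. Qed.
Let EP f : E f <-> L2 f /\ exists x, f = k x %[ae m].
Proof. by case: kp. Qed.
Let kL x : L2 (k x).
Proof. exact/model_L2/kK. Qed.

Lemma dot_c x h : K h -> dot (c h) x = ip dot h (k x).
Proof. by move=> Kh; rewrite dotC -kc// -ipC//; exact: (model_L2 Kh). Qed.

Lemma c_lin a f g : K f -> K g -> c (a *: f + g) = a *: c f + c g.
Proof.
move=> Kf Kg; have Kfg := modelP_lin innerT a Kf Kg.
have Lf := model_L2 Kf; have Lg := model_L2 Kg.
apply: (@dot_inj _ _ dot) => y.
by rewrite dotDl dotZl !dot_c// ipPl.
Qed.

Lemma c_ae f g : K f -> K g -> f = g %[ae m] -> c f = c g.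
Proof.
move=> Kf Kg fg; have Lf := model_L2 Kf; have Lg := model_L2 Kg.
by apply: (@dot_inj _ _ dot) => y; rewrite !dot_c//; exact: ip_ael.
Qed.

(** As adjoint of the bounded k: the square of the norm of c f is <k (c f), f>, and one factor
    cancels. *)
Lemma c_bounded : exists2 C, 0 <= C & forall f, K f -> hnorm dot (c f) <= C * N f.
Proof.
have [C C0 hC] := family_bounded klin kL; exists C => // f Kf.
have Lf := model_L2 Kf.
have [->|x0] := eqVneq (hnorm dot (c f)) 0; first by rewrite mulr_ge0// L2norm_ge0.
have xp : 0 < hnorm dot (c f) by rewrite lt_neqAle eq_sym x0 hnorm_ge0.
rewrite -(ler_pM2l xp) -expr2 sqr_hnorm -kc//.
apply: (le_trans (ler_norm _)); apply: (le_trans (Re_ip_le (kL _) Lf)).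
by rewrite mulrA ler_wpM2r ?L2norm_ge0// mulrC hC.
Qed.

(** Inverts the Gram operator c k on the finite-dimensional H; n (c f) then recovers the parameter
    of a vector f of E. *)
Lemma ck_inverse : exists n : 'End(H), forall y, c (k (n y)) = y.
Proof.
pose T x := c (k x).
have lT : linear T.
  by move=> a x y; rewrite /T klin c_lin.
pose TL : {linear H -> H} := HB.pack T (GRing.isLinear.Build R[i] H H _ T lT).
have kT : (lker (linfun TL) == 0)%VS.
  rewrite -subv0; apply/subvP => x; rewrite memv_ker lfunE memv0 => /eqP.
  by move=> /kinj ->.
exists ((linfun TL)^-1)%VF => y.
have := lker0_lfunVK kT y; rewrite lfunE; exact.
Qed.

Lemma E_model f : E f -> K f.
Proof. by move=> /EP[Lf [x fx]]; exact: (model_ae innerT Lf fx). Qed.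

Lemma E_k x : E (k x).
Proof. by apply/EP; split; [exact: kL|exists x; exact: nearW]. Qed.

Lemma E_ae f x : L2 f -> f = k x %[ae m] -> E f.
Proof. by move=> Lf fx; apply/EP; split => //; exists x. Qed.

Lemma E_lin a f g : E f -> E g -> E (a *: f + g).
Proof.
move=> Ef Eg; have Kf := E_model Ef; have Kg := E_model Eg.
move/EP : Ef => [Lf [x fx]]; move/EP : Eg => [Lg [y gy]].
apply: (@E_ae _ (a *: x + y)); first exact: L2P_lin.
apply: filterS2 fx gy => z h1 h2 _; rewrite klin.
by rewrite -[LHS]/(a *: f z + g z) h1// h2.
Qed.

End OneKernelPair.

Section TwoModelSpaces.
Variables (Theta1 Theta2 : circle R -> 'End(H)).
Hypotheses (inner1 : inner dot Theta1) (inner2 : inner dot Theta2).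
Variables (k : H -> circle R -> H) (c : (circle R -> H) -> H) (E : set (circle R -> H)).
Hypothesis kp : kernel_pair Theta1 k c E.
Local Notation K2 := (model dot Theta2).
Local Notation P2 := (Defs.proj dot Theta2).

Lemma L2norm_proj f : L2 f -> N (P2 f) <= N f.
Proof.
move=> Lf; have Kp := proj_model inner2 Lf; have Lp := model_L2 Kp.
have [->|p0] := eqVneq (N (P2 f)) 0; first exact: L2norm_ge0.
have pp : 0 < N (P2 f) by rewrite lt_neqAle eq_sym p0 L2norm_ge0.
rewrite -(ler_pM2r pp) -expr2 sqr_L2norm ip_proj//.
exact: (le_trans (ler_norm _) (Re_ip_le Lf Lp)).
Qed.

(** Reading the parameter of f as n (c f), rather than choosing it, makes B linear, bounded and
    compatible with a.e. equality. *)
Lemma build_operator (G : H -> circle R -> H) :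
  (forall a x y, G (a *: x + y) = a *: G x + G y) -> (forall x, L2 (G x)) ->
  exists B, bounded_linear dot E K2 B /\
    forall x h, K2 h -> ip dot (B (k x)) h = ip dot (G x) h.
Proof.
move=> Glin GL; have [n nP] := ck_inverse inner1 kp.
have [_ kK _ kinj _] := kp.
have nck x : n (c (k x)) = x.
  apply/eqP; rewrite -subr_eq0; apply/eqP/kinj.
  have [klin _ _ _ _] := kp.
  have -> : n (c (k x)) - x = (-1) *: x + n (c (k x)) by rewrite scaleN1r addrC.
  by rewrite klin (c_lin inner1 kp)// nP scaleN1r addNr.
exists (fun f => P2 (G (n (c f)))); split; last first.
  by move=> x h Kh; rewrite nck ip_proj.
split.
- by move=> f _; exact: proj_model.
- move=> f g Ef Eg fg; rewrite (c_ae kp (E_model inner1 kp Ef) (E_model inner1 kp Eg) fg).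
  exact: nearW.
- move=> a f g Ef Eg; have Kf := E_model inner1 kp Ef; have Kg := E_model inner1 kp Eg.
  rewrite (c_lin inner1 kp)// linearP Glin.
  have Gf := GL (n (c f)); have Gg := GL (n (c g)).
  have Pf := proj_model inner2 Gf; have Pg := proj_model inner2 Gg.
  have Gfg := L2P_lin a Gf Gg.
  apply: (model_inj inner2); [exact: proj_model|exact: modelP_lin|].
  move=> h Kh; have Lh := model_L2 Kh.
  rewrite (ip_proj inner2 Gfg Kh) (ipPl a Gf Gg Lh).
  by rewrite (ipPl a (model_L2 Pf) (model_L2 Pg) Lh) !ip_proj.
- have [C1 C10 hC1] := family_bounded Glin GL.
  have [C2 C20 hC2] := linear_bounded dot n.
  have [C3 C30 hC3] := c_bounded kp.
  exists (C1 * (C2 * C3)) => f Ef; apply: (le_trans (L2norm_proj (GL _))).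
  apply: (le_trans (hC1 _)); rewrite -mulrA ler_wpM2l//.
  apply: (le_trans (hC2 _)); rewrite -mulrA ler_wpM2l//.
  exact/hC3/(E_model inner1 kp).
Qed.

(** If w represents x |-> <B (k x), f> on H, the adjoint value is k (n w); its existence makes the
    choice in [adjop] meaningful. *)
Lemma adjopP B f : bounded_linear dot E K2 B -> L2 f ->
  E (adjop dot E B f) /\ forall x, ip dot (k x) (adjop dot E B f) = ip dot (B (k x)) f.
Proof.
move=> [BK Bae Blin _] Lf; have [n nP] := ck_inverse inner1 kp.
have [klin kK kc kinj EP] := kp.
have LB g : E g -> L2 (B g) by move=> Eg; exact/model_L2/BK.
have Ek := E_k kp.
have [|w wP] := @riesz_fin _ _ dot (fun x => ip dot (B (k x)) f).
  move=> a x y; rewrite -ipPl//; [|exact: LB..].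
  rewrite klin; apply: ip_ael => //; last exact: Blin.
  - by apply/LB/(E_lin inner1 kp).
  - by apply: L2P_lin; exact: LB.
suff : E (adjop dot E B f) /\ forall h, E h -> ip dot h (adjop dot E B f) = ip dot (B h) f.
  by move=> [h1 h2]; split => // x; exact: h2.
rewrite /adjop; case: xgetP => [g _ //|nex]; exfalso.
apply: (nex (k (n w))); split; first exact: Ek.
move=> h Eh; have Kh := E_model inner1 kp Eh; have Lh := model_L2 Kh.
move/EP : (Eh) => [_ [x hx]].
have Lkx := model_L2 (kK x).
rewrite (ip_ael Lh Lkx (model_L2 (kK _)) hx) kc// nP -wP.
apply: esym; apply: ip_ael => //; [exact: LB|exact: LB|exact: Bae].
Qed.

End TwoModelSpaces.

(** The common core of the necessity of both conditions: a weak identity known for bounded f only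
    becomes an operator identity on all of K. The hypothesis on w says that T has an adjoint, so
    both sides are pairings of f with L^2 vectors. *)
Lemma build_pair (Theta1 Theta2 : circle R -> 'End(H))
  (inner1 : inner dot Theta1) (inner2 : inner dot Theta2)
  (k1 k2 : H -> circle R -> H) (c1 c2 : (circle R -> H) -> H)
  (E1 E2 : set (circle R -> H))
  (kp1 : kernel_pair Theta1 k1 c1 E1) (kp2 : kernel_pair Theta2 k2 c2 E2)
  (G G' : H -> circle R -> H) (T : (circle R -> H) -> circle R -> H) :
  (forall a x y, G (a *: x + y) = a *: G x + G y) -> (forall x, L2 (G x)) ->
  (forall a x y, G' (a *: x + y) = a *: G' x + G' y) -> (forall x, L2 (G' x)) ->
  (forall f, model dot Theta1 f -> model dot Theta2 (T f)) ->
  (forall h, model dot Theta2 h -> exists2 w, L2 w &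
    forall f, model dot Theta1 f -> ip dot (T f) h = ip dot f w) ->
  (forall f h, model_oo dot Theta1 f -> model dot Theta2 h ->
    ip dot (T f) h = ip dot (G (c1 f)) h + ip dot f (G' (c2 h))) ->
  exists B1 B2, [/\ bounded_linear dot E1 (model dot Theta2) B1,
    bounded_linear dot E2 (model dot Theta1) B2 &
    forall f, model dot Theta1 f ->
      T f = B1 (k1 (c1 f)) + k2 (c2 (adjop dot E2 B2 f)) %[ae m]].
Proof.
move=> Glin GL Glin' GL' TK Tadj TG.
have [B1 [bB1 B1G]] := build_operator inner1 inner2 kp1 Glin GL.
have [B2 [bB2 B2G]] := build_operator inner2 inner1 kp2 Glin' GL'.
exists B1, B2; split => // f Kf.
have [k1lin k1K k1c _ _] := kp1; have [k2lin k2K k2c _ _] := kp2.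
have [B1K _ _ _] := bB1; have [B2K _ _ _] := bB2.
have Lf := model_L2 Kf.
(* The operator k2 c2 is self-adjoint on the model space, so it moves onto h and B2 is then
   evaluated on k2 (c2 h). *)
have second g h : model dot Theta1 g -> model dot Theta2 h ->
    ip dot (k2 (c2 (adjop dot E2 B2 g))) h = ip dot g (G' (c2 h)).
  move=> Kg Kh; have Lg := model_L2 Kg; have Lh := model_L2 Kh.
  have [Ea aP] := adjopP inner2 kp2 bB2 Lg.
  have Ka := E_model inner2 kp2 Ea.
  have KB : model dot Theta1 (B2 (k2 (c2 h))) by apply: B2K; exact: (E_k kp2).
  by rewrite k2c// dotC -k2c// aP B2G// -ipC.
apply: (model_inj inner2); first exact: TK.
  by apply: (modelD inner2) => //; apply: B1K; exact: (E_k kp1).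
move=> h Kh; have Lh := model_L2 Kh.
rewrite ipDl//; [|by apply/model_L2/B1K/(E_k kp1)|exact/model_L2/k2K].
rewrite B1G// second//.
have [w Lw wP] := Tadj h Kh.
(* Through this vector, <G (c1 g), h> becomes <g, k1 x>, so that v below represents the whole defect
   of the identity. *)
have [|x xP] := @riesz_fin _ _ dot (fun x => ip dot (G x) h).
  by move=> a x y; rewrite Glin; exact: ipPl.
have LG' := GL' (c2 h); have Lk := model_L2 (k1K x).
pose v := w - k1 x - G' (c2 h).
have Lwk := L2B Lw Lk.
have Lv : L2 v by exact: L2B.
have diff g : model dot Theta1 g ->
    ip dot (T g) h - (ip dot (G (c1 g)) h + ip dot g (G' (c2 h))) = ip dot g v.
  move=> Kg; have Lg := model_L2 Kg.
  rewrite xP (dot_c kp1)// wP// /v (ipBr Lwk LG' Lg) (ipBr Lw Lk Lg).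
  by rewrite opprD addrA.
apply/eqP; rewrite -subr_eq0 diff//.
have Kp := proj_model inner1 Lv; have Lp := model_L2 Kp.
(* The vector v need not lie in the model space; its projection does, and it is orthogonal to all
   bounded functions there. *)
have p0 : Defs.proj dot Theta1 v = (fun=> 0) %[ae m].
  apply: (model_oo_orth inner1 Kp) => g Kg.
  have Kg' : model dot Theta1 g by case: Kg.
  have Lg := model_L2 Kg'.
  by rewrite ipC// ip_proj// -ipC// -diff// TG// subrr.
rewrite ipC// -(ip_proj inner1 Lv Kf) (ip_ael Lp (L2_0 dot) Lf p0) ip0l.
by rewrite rmorph0.
Qed.

Section PurePairs.
Variable Theta : circle R -> 'End(H).
Hypotheses (innerT : inner dot Theta) (pureT : pure dot Theta).
Local Notation T0 := (value0 Theta).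

Lemma pure_fixed x : hnorm dot (T0 x) = hnorm dot x -> x = 0.
Proof.
move=> e; have := opnormP dot T0 x; rewrite e => h.
apply: (@hnorm_eq0 _ _ dot); apply/eqP; rewrite eq_le hnorm_ge0 andbT.
rewrite leNgt; apply/negP => xp.
have := pureT; rewrite /pure ltNge => /negP; apply.
by rewrite -(ler_pM2r xp) mul1r.
Qed.

(** Put y = Theta(0)^* x. Then y and Theta(0) y = x have equal norms, so purity applies to y and no
    norm bound for the adjoint is required. *)
Lemma pure_fixed_adj x : T0 (adj dot T0 x) = x -> x = 0.
Proof.
move=> e; have y0 : adj dot T0 x = 0.
  apply: pure_fixed; rewrite e; apply/eqP.
  by rewrite -(@eqrXn2 _ 2%N)// ?hnorm_ge0// !sqr_hnorm adjPl e.
by rewrite -e y0 linear0.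
Qed.

Lemma k0_pair : kernel_pair Theta (k0 dot Theta) (@value0 _ _) (defect_space dot Theta).
Proof.
split.
- move=> a x y; apply/funext => z; rewrite -[RHS]/(a *: k0 dot Theta x z + k0 dot Theta y z).
  by rewrite /k0 (linearP (adj dot T0)) (linearP (Theta z)) scalerBr opprD addrACA.
- by move=> x; exact: k0_model.
- by move=> x h; exact: ip_k0.
- move=> x; rewrite k0E /value0 (fourierB 0 (L2_cst dot x) (inner_col innerT _)).
  have -> : fourier (opmul Theta (cst (adj dot T0 x))) 0 = T0 (adj dot T0 x).
    by rewrite (T0E innerT).
  rewrite -/(value0 _) (value0_cst dot) => /eqP.
  by rewrite subr_eq0 => /eqP /esym; exact: pure_fixed_adj.
- by move=> f; split.
Qed.

Lemma kt_pair : kernel_pair Theta (kt Theta) (ct dot Theta) (defect_space_t dot Theta).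
Proof.
split.
- move=> a x y; apply/funext => z; rewrite -[RHS]/(a *: kt Theta x z + kt Theta y z).
  rewrite !(kt_pointE innerT) (linearP (Theta z)) (linearP T0) scalerA mulrC -scalerA -scalerDr.
  by congr (_ *: _); rewrite scalerBr opprD addrACA.
- by move=> x; exact: kt_model.
- by move=> x h; exact: ip_kt.
(* If c (kt x) = 0 then kt x has norm 0. Its squared norm is that of x minus that of Theta(0) x,
   because Theta is isometric. *)
- move=> x cx; have Kx := kt_model innerT x.
  have := ip_kt innerT x Kx; rewrite cx dot0r.
  have Lx := inner_col innerT x; have Lc := L2_cst dot (T0 x).
  rewrite (ktE innerT) ip_zX opprK zX_zX subrr zX0.
  rewrite (ipBl Lx Lc (L2B Lx Lc)) (ipBr Lx Lc Lx) (ipBr Lx Lc Lc).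
  rewrite (ip_inner innerT (L2_cst dot x) (L2_cst dot x)) !ip_cst.
  rewrite (ip_cst_H2 _ Lx) -(T0E innerT) subrr subr0.
  rewrite -(dot_value0 _ Lx) -(T0E innerT) => /eqP; rewrite subr_eq0 => /eqP e.
  apply: pure_fixed; apply/eqP.
  by rewrite -(@eqrXn2 _ 2%N)// ?hnorm_ge0// !sqr_hnorm e.
- move=> f; split=> -[Lf [x fx]]; split => //; exists x.
    by rewrite (kt_pointE innerT).
  by move: fx; rewrite (kt_pointE innerT).
Qed.

End PurePairs.

End KernelPairs.

(** * Necessity *)

Section Truncated.
Variables (R : realType) (H : vectType R[i]) (dot : {dot H for Num.conj}).
Local Notation m := (circle_measure R).
Local Notation L2 := (L2H dot).
Local Notation N := (L2norm dot).
Implicit Types (f g h : circle R -> H).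
Variables (Theta1 Theta2 : circle R -> 'End(H)).
Hypotheses (inner1 : inner dot Theta1) (pure1 : pure dot Theta1).
Hypotheses (inner2 : inner dot Theta2) (pure2 : pure dot Theta2).
Variable A : (circle R -> H) -> circle R -> H.
Local Notation K1 := (model dot Theta1).
Local Notation K2 := (model dot Theta2).
Hypothesis bA : bounded_linear dot K1 K2 A.

Lemma A_model f : K1 f -> K2 (A f).
Proof. by case: bA => h _ _ _; exact: h. Qed.

Lemma A_ae f g : K1 f -> K1 g -> f = g %[ae m] -> A f = A g %[ae m].
Proof. by case: bA => _ h _ _; exact: h. Qed.

Lemma A_L2 f : K1 f -> L2 (A f).
Proof. by move=> Kf; exact/model_L2/A_model. Qed.

Lemma A_adj h : L2 h -> exists2 w, K1 w & forall f, K1 f -> ip dot (A f) h = ip dot f w.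
Proof.
move=> Lh; have [_ Aae Alin [M AM]] := bA.
apply: (model_riesz inner1 (M := M * N h)).
  move=> a f g Kf Kg; rewrite -(ipPl _ (A_L2 Kf) (A_L2 Kg) Lh).
  apply: ip_ael => //; [|exact: L2P_lin (A_L2 Kf) (A_L2 Kg)|exact: Alin].
  exact/A_L2/modelP_lin.
move=> f Kf; apply: (le_trans (Re_ip_le (A_L2 Kf) Lh)).
by rewrite mulrAC ler_wpM2r ?L2norm_ge0// AM.
Qed.

Section Necessity.
Variable Phi : circle R -> 'End(H).
Hypothesis L2Phi : L2L dot Phi.
Hypothesis APhi : forall f, model_oo dot Theta1 f ->
  A f = trunc_toeplitz dot Theta2 Phi f %[ae m].
Local Notation Phi' := (fun z => adj dot (Phi z)).

Lemma Phi_col x : L2 (fun z => Phi z x).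
Proof. by have /L2LP := L2Phi. Qed.

Lemma Phi_bounded f : L2 f -> ae_bounded dot f -> L2 (opmul Phi f).
Proof.
move=> Lf bf; apply: L2_opmul_bounded => //; [exact: Phi_col|].
exact: (L2_vmeasurable Lf).
Qed.

Lemma Phi_adj_bounded f : L2 f -> ae_bounded dot f -> L2 (opmul Phi' f).
Proof.
move=> Lf bf; apply: L2_opmul_bounded => //; [|exact: (L2_vmeasurable Lf)].
exact: (L2_adj Phi_col).
Qed.

Lemma ip_A_Phi f h : model_oo dot Theta1 f -> K2 h ->
  ip dot (A f) h = ip dot (opmul Phi f) h.
Proof.
move=> Kf Kh; have /model_ooP[Kf' bf] := Kf; have Lf := model_L2 Kf'.
have Lp := Phi_bounded Lf bf; have Kp := proj_model inner2 Lp.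
rewrite (ip_ael (A_L2 Kf') (model_L2 Kp) (model_L2 Kh) (APhi Kf)).
exact: ip_proj.
Qed.

Lemma necessity_a : exists B1 B2,
  [/\ bounded_linear dot (defect_space dot Theta1) K2 B1,
      bounded_linear dot (defect_space_t dot Theta2) K1 B2 &
      forall f, K1 f -> cshift_adj dot Theta2 (A f) - A (cshift_adj dot Theta1 f) =
        B1 (k0 dot Theta1 (value0 f)) +
        kt Theta2 (ct dot Theta2 (adjop dot (defect_space_t dot Theta2) B2 f))
        %[ae m]].
Proof.
pose G x := zX (-1) (opmul Phi (cst x)).
pose G' y := (-1) *: opmul Phi' (opmul Theta2 (cst y)).
(* Under the pairing the adjoint shifts may be replaced by [bshift], which is explicit. *)
have TE f h : K1 f -> K2 h ->
    ip dot (cshift_adj dot Theta2 (A f) - A (cshift_adj dot Theta1 f)) h =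
    ip dot (bshift (A f)) h - ip dot (A (bshift f)) h.
  move=> Kf Kh; have Lh := model_L2 Kh; have KA := A_model Kf.
  have Kc := cshift_adj_model inner2 KA; have Kc1 := cshift_adj_model inner1 Kf.
  have Kb := bshift_model inner1 Kf.
  rewrite (ipBl (model_L2 Kc) (A_L2 Kc1) Lh).
  rewrite (ip_ael (model_L2 Kc) (bshift_L2 (model_L2 KA)) Lh (cshift_adjE inner2 KA)).
  have e := A_ae Kc1 Kb (cshift_adjE inner1 Kf).
  by rewrite (ip_ael (A_L2 Kc1) (A_L2 Kb) Lh e).
have L2G' y : L2 (opmul Phi' (opmul Theta2 (cst y))).
  apply: Phi_adj_bounded; first exact: inner_col.
  by apply: (ae_bounded_inner inner2); exact: ae_bounded_cst.
apply: (build_pair inner1 inner2 (k0_pair inner1 pure1) (kt_pair inner2 pure2)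
  (G := G) (G' := G')).
- move=> a x y; rewrite /G -zXZ -zXD -opmulP_lin; congr (zX _ (opmul _ _)).
- by move=> x; exact: (L2_zX (-1) (Phi_col x)).
- move=> a x y; rewrite /G' scalerA mulrC -scalerA -scalerDr -!opmulP_lin.
  by congr (_ *: opmul _ (opmul _ _)).
- by move=> x; exact: L2Z.
- move=> f Kf; apply: (modelB inner2).
    exact/(cshift_adj_model inner2)/A_model.
  exact/A_model/(cshift_adj_model inner1).
- move=> h Kh; have Lh := model_L2 Kh.
  have [w1 Kw1 w1P] := A_adj (L2_zX 1 Lh); have [w2 Kw2 w2P] := A_adj Lh.
  have Lw1 := model_L2 Kw1; have Lw2 := L2_zX 1 (model_L2 Kw2).
  exists (w1 - zX 1 w2); first exact: L2B.
  move=> f Kf; rewrite TE// (ip_bshift_H2 (A_L2 Kf) (model_H2 Kh)) ip_zX opprK w1P//.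
  rewrite w2P; last exact: bshift_model.
  by rewrite (ip_bshift_H2 (model_L2 Kf) (model_H2 Kw2)) ip_zX opprK (ipBr Lw1 Lw2 (model_L2 Kf)).
- move=> f h Kf Kh; have /model_ooP[Kf' bf] := Kf.
  have Lf := model_L2 Kf'; have Lh := model_L2 Kh; have Lz := L2_zX 1 Lh.
  have Lp := Phi_bounded Lf bf.
  rewrite TE//.
  have Kb := bshift_model_oo inner1 Kf.
  have Lc := Phi_col (value0 f).
  have Lt := inner_col inner2 (ct dot Theta2 h).
  (* Uses <B A f, h> = <A f, S h> with S h = z h - Theta2 c(h). The term <Phi f, z h> appears again
     in the next expansion and cancels. *)
  have -> : ip dot (bshift (A f)) h =
      ip dot (opmul Phi f) (zX 1 h) - ip dot (opmul Phi f) (opmul Theta2 (cst (ct dot Theta2 h))).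
    have KA := A_model Kf'; have Ks := shift_model inner2 Kh.
    rewrite ipC; [|exact: (bshift_L2 (model_L2 KA))|exact: Lh].
    rewrite -(ip_shift_bshift inner2 Kh KA) -ipC; [|exact: (model_L2 KA)|exact: (model_L2 Ks)].
    by rewrite ip_A_Phi// (ipBr Lz Lt Lp).
  have -> : ip dot (A (bshift f)) h =
      ip dot (opmul Phi f) (zX 1 h) - ip dot (zX (-1) (opmul Phi (cst (value0 f)))) h.
    rewrite ip_A_Phi// /bshift opmul_zX opmulB !ip_zX opprK.
    exact: (ipBl Lp Lc Lz).
  rewrite opprB addrC addrA subrK; congr (_ + _).
  by rewrite (ipZr _ (L2G' _) Lf) rmorphN1 mulN1r -ip_opmul.
Qed.

(** Now <A f, B h> yields <Phi f, h / z> - <Phi f, h(0) / z>, while <A S f, h> yields <Phi f, h / z>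
    - <Phi Theta1 c(f), h>. The common term cancels, which explains G and G'. *)
Lemma necessity_b : exists B1 B2,
  [/\ bounded_linear dot (defect_space_t dot Theta1) K2 B1,
      bounded_linear dot (defect_space dot Theta2) K1 B2 &
      forall f, K1 f -> cshift dot Theta2 (A f) - A (cshift dot Theta1 f) =
        B1 (kt Theta1 (ct dot Theta1 f)) +
        k0 dot Theta2 (value0 (adjop dot (defect_space dot Theta2) B2 f))
        %[ae m]].
Proof.
pose G x := opmul Phi (opmul Theta1 (cst x)).
pose G' y := (-1) *: opmul Phi' (zX (-1) (cst y)).
have TE f h : K1 f -> K2 h ->
    ip dot (cshift dot Theta2 (A f) - A (cshift dot Theta1 f)) h =
    ip dot (shift dot Theta2 (A f)) h - ip dot (A (shift dot Theta1 f)) h.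
  move=> Kf Kh; have Lh := model_L2 Kh; have KA := A_model Kf.
  have Kc := cshift_model inner2 KA; have Kc1 := cshift_model inner1 Kf.
  have Kb := shift_model inner1 Kf; have Ks := shift_model inner2 KA.
  rewrite (ipBl (model_L2 Kc) (A_L2 Kc1) Lh).
  rewrite (ip_ael (model_L2 Kc) (model_L2 Ks) Lh (cshiftE inner2 KA)).
  have e := A_ae Kc1 Kb (cshiftE inner1 Kf).
  by rewrite (ip_ael (A_L2 Kc1) (A_L2 Kb) Lh e).
have L2G x : L2 (opmul Phi (opmul Theta1 (cst x))).
  apply: Phi_bounded; first exact: inner_col.
  by apply: (ae_bounded_inner inner1); exact: ae_bounded_cst.
have L2G' y : L2 (opmul Phi' (zX (-1) (cst y))).
  apply: Phi_adj_bounded; first exact/L2_zX/L2_cst.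
  by apply: ae_bounded_zX; exact: ae_bounded_cst.
apply: (build_pair inner1 inner2 (kt_pair inner1 pure1) (k0_pair inner2 pure2)
  (G := G) (G' := G')).
- by move=> a x y; rewrite /G -!opmulP_lin; congr (opmul _ (opmul _ _)).
- exact: L2G.
- move=> a x y; rewrite /G' scalerA mulrC -scalerA -scalerDr -opmulP_lin -zXZ -zXD.
  by congr (_ *: opmul _ (zX _ _)).
- by move=> x; exact: L2Z.
- move=> f Kf; apply: (modelB inner2).
    exact/(cshift_model inner2)/A_model.
  exact/A_model/(cshift_model inner1).
- move=> h Kh; have Lh := model_L2 Kh.
  have [w1 Kw1 w1P] := A_adj (L2_zX (-1) Lh); have [w2 Kw2 w2P] := A_adj Lh.
  have Lw1 := model_L2 Kw1; have Lw2 := bshift_L2 (model_L2 Kw2).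
  exists (w1 - bshift w2); first exact: L2B.
  move=> f Kf; rewrite TE// (ip_shift inner2 (A_model Kf) Kh) ip_zX w1P//.
  rewrite w2P; last exact: shift_model.
  by rewrite (ip_shift_bshift inner1 Kf Kw2) (ipBr Lw1 Lw2 (model_L2 Kf)).
- move=> f h Kf Kh; have /model_ooP[Kf' bf] := Kf.
  have Lf := model_L2 Kf'; have Lh := model_L2 Kh; have Lz := L2_zX (-1) Lh.
  have Lp := Phi_bounded Lf bf.
  rewrite TE//.
  have Ks := shift_model_oo inner1 Kf.
  have Lc : L2 (zX (-1) (cst (value0 h))) by exact/L2_zX/L2_cst.
  have -> : ip dot (shift dot Theta2 (A f)) h =
      ip dot (opmul Phi f) (zX (-1) h) - ip dot (opmul Phi f) (zX (-1) (cst (value0 h))).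
    rewrite (ip_shift_bshift inner2 (A_model Kf') Kh) ip_A_Phi//; last exact: bshift_model.
    by rewrite /bshift zXB (ipBr Lz Lc Lp).
  have -> : ip dot (A (shift dot Theta1 f)) h =
      ip dot (opmul Phi f) (zX (-1) h) -
      ip dot (opmul Phi (opmul Theta1 (cst (ct dot Theta1 f)))) h.
    rewrite ip_A_Phi// /shift opmulB opmul_zX (ipBl (L2_zX 1 Lp) (L2G _) Lh).
    by rewrite ip_zX.
  rewrite opprB addrC addrA subrK; congr (_ + _).
  by rewrite (ipZr _ (L2G' _) Lf) rmorphN1 mulN1r -ip_opmul.
Qed.

End Necessity.

End Truncated.

(** * Sufficiency *)

Section Sufficiency.
Variables (R : realType) (H : vectType R[i]) (dot : {dot H for Num.conj}).
Local Notation m := (circle_measure R).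
Local Notation u := (onb dot).
Local Notation L2 := (L2H dot).
Local Notation H2 := (H2H dot).
Local Notation N := (L2norm dot).
Implicit Types (f g h : circle R -> H).

Definition of_columns (F : 'I_(\dim {:H}) -> circle R -> H) (z : circle R) : 'End(H) :=
  \sum_i \sum_k dot (F i z) (u k) *: linfun (matrix_unit_lin dot i k).

Lemma of_columnsE F z x : of_columns F z x = \sum_i dot x (u i) *: F i z.
Proof.
rewrite /of_columns sum_lfunE; apply: eq_bigr => i _.
rewrite sum_lfunE {2}(onb_sum dot (F i z)) scaler_sumr.
by apply: eq_bigr => k _; rewrite scale_lfunE matrix_unitE !scalerA mulrC.
Qed.

Lemma opmul_of_columns F x :
  opmul (of_columns F) (cst x) = \sum_i dot x (u i) *: F i.
Proof. by apply/funext => z; rewrite /opmul of_columnsE fct_sumE. Qed.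

Lemma of_columns_H2 F : (forall i, H2 (F i)) -> forall x, H2 (fun z => of_columns F z x).
Proof.
move=> hF x; rewrite -[X in H2 X]/(opmul (of_columns F) (cst x)) opmul_of_columns.
elim/big_ind : _ => [||i _]; [exact: H2_0|by move=> f g; exact: H2D|].
by rewrite -[X in H2 X]addr0; apply: H2P_lin => //; exact: H2_0.
Qed.

(** Psi f itself may fail to be square integrable; on a Taylor polynomial it is a finite sum of
    shifted columns. *)
Lemma opmul_psum_H2 (Psi : circle R -> 'End(H)) n f :
  (forall x, H2 (fun z => Psi z x)) -> H2 f -> H2 (opmul Psi (psum n f)).
Proof.
move=> hP; elim: n f => [|n IH] f hf.
  have -> : opmul Psi (psum 0 f) = 0 by apply/funext => z; rewrite /opmul linear0.
  exact: H2_0.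
rewrite /= opmulD opmul_zX; apply: H2D; first exact: hP.
by apply: (@H2_zX _ _ _ 1); exact/IH/bshift_H2.
Qed.

Lemma L2norm_bshift f : H2 f -> N (bshift f) <= N f.
Proof.
move=> hf; rewrite -(@ler_pXn2r _ 2%N) ?nnegrE ?L2norm_ge0//.
by rewrite (sqr_L2norm_bshift hf) lerDr sqr_ge0.
Qed.

Lemma L2norm_iter_bshift n f : H2 f -> N (iter n (@bshift R H) f) <= N f.
Proof.
move=> hf; elim: n => //= n IH; apply: le_trans IH.
exact/L2norm_bshift/iter_bshift_H2.
Qed.

Variables (Theta1 Theta2 : circle R -> 'End(H)).
Hypotheses (inner1 : inner dot Theta1) (inner2 : inner dot Theta2).
Hypothesis (pure2 : pure dot Theta2).
Variable A : (circle R -> H) -> circle R -> H.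
Local Notation K1 := (model dot Theta1).
Local Notation K2 := (model dot Theta2).
Hypothesis bA : bounded_linear dot K1 K2 A.
Variables B1 B2 : (circle R -> H) -> circle R -> H.
Local Notation E1 := (defect_space dot Theta1).
Local Notation E2 := (defect_space_t dot Theta2).
Hypotheses (bB1 : bounded_linear dot E1 K2 B1) (bB2 : bounded_linear dot E2 K1 B2).
Hypothesis AB : forall f, K1 f ->
  cshift_adj dot Theta2 (A f) - A (cshift_adj dot Theta1 f) =
  B1 (defect dot Theta1 f) + defect_t dot Theta2 (adjop dot E2 B2 f) %[ae m].
Local Notation T0 := (value0 Theta2).
Local Notation kp2 := (kt_pair inner2 pure2).

Lemma k0_E x : E1 (k0 dot Theta1 x).
Proof. by split; [exact: k0_L2|exists x; exact: nearW]. Qed.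

Lemma B1_k0_model x : K2 (B1 (k0 dot Theta1 x)).
Proof. by case: bB1 => h _ _ _; apply: h; exact: k0_E. Qed.

Lemma B2_kt_model x : K1 (B2 (kt Theta2 x)).
Proof. by case: bB2 => h _ _ _; apply: h; exact: (E_k kp2). Qed.

(** Represents x |-> z B1 (k0 x). As B1 is linear only up to null sets, its values on the basis are
    fixed and extended linearly at each point. *)
Definition Psi1 := of_columns (fun i => zX 1 (B1 (k0 dot Theta1 (u i)))).

Lemma Psi1_H2 x : H2 (fun z => Psi1 z x).
Proof.
by apply: of_columns_H2 => i; apply: (@H2_zX _ _ _ 1); exact/model_H2/B1_k0_model.
Qed.

Lemma B1_k0_ae x :
  B1 (k0 dot Theta1 x) = \sum_i dot x (u i) *: B1 (k0 dot Theta1 (u i)) %[ae m].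
Proof.
have [_ Bae Blin _] := bB1.
have k0lin a y y' : k0 dot Theta1 (a *: y + y') = a *: k0 dot Theta1 y + k0 dot Theta1 y'.
  apply/funext => z; rewrite -[RHS]/(a *: k0 dot Theta1 y z + k0 dot Theta1 y' z).
  by rewrite /k0 (linearP (adj dot _)) (linearP (Theta1 z)) scalerBr opprD addrACA.
have B10 : B1 (k0 dot Theta1 0) = (fun=> 0) %[ae m].
  have := Blin 1 _ _ (k0_E 0) (k0_E 0).
  rewrite -k0lin !scale1r addr0; apply: filterS => z h _.
  have := h I; rewrite -[X in _ = X -> _]/(B1 (k0 dot Theta1 0) z + B1 (k0 dot Theta1 0) z).
  by rewrite -[in LHS](addr0 (B1 _ z)) => /addrI.
have gen (s : seq 'I_(\dim {:H})) :
    B1 (k0 dot Theta1 (\sum_(i <- s) dot x (u i) *: u i)) =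
    \sum_(i <- s) dot x (u i) *: B1 (k0 dot Theta1 (u i)) %[ae m].
  elim: s => [|i s IH]; first by rewrite !big_nil.
  rewrite !big_cons k0lin.
  have := Blin (dot x (u i)) _ _ (k0_E (u i)) (k0_E (\sum_(i <- s) dot x (u i) *: u i)).
  apply: filterS2 IH => z h1 h2 _; rewrite h2//.
  by rewrite -[LHS]/(dot x (u i) *: B1 (k0 dot Theta1 (u i)) z + B1 _ z) h1.
apply: filterS (gen (index_enum _)) => z h I'.
by rewrite -(h I') -(onb_sum dot x).
Qed.

(** These are the columns of Psi2. The first term is what <A f, h> loses when both arguments are
    shifted back, the second comes from pairing kt with B h; both involve h only through h(0). *)
Lemma gamma_exists i : exists g, K1 g /\ forall f, K1 f -> ip dot f g =
  dot (value0 (A f) - T0 (ct dot Theta2 (adjop dot E2 B2 f))) (u i).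
Proof.
have [w Kw wP] := A_adj inner1 bA (L2_cst dot (u i)).
pose y := adj dot T0 (u i).
exists (w - B2 (kt Theta2 y)); split.
  by apply: (modelB inner1) => //; exact: B2_kt_model.
move=> f Kf; have Lf := model_L2 Kf; have Lw := model_L2 Kw.
have LB := model_L2 (B2_kt_model y).
have [Ea aP] := adjopP inner2 kp2 bB2 Lf.
have Ka := E_model inner2 kp2 Ea.
rewrite (ipBr Lw LB Lf) -wP// dotBl dot_value0; last exact: (A_L2 bA).
congr (_ - _); rewrite adjP -/y dotC -(ip_kt inner2 _ Ka) aP.
exact: ipC.
Qed.

Definition gamma i := projT1 (cid (gamma_exists i)).

Lemma gamma_model i : K1 (gamma i).
Proof. by rewrite /gamma; case: cid => g []. Qed.

Lemma gammaP i f : K1 f -> ip dot f (gamma i) =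
  dot (value0 (A f) - T0 (ct dot Theta2 (adjop dot E2 B2 f))) (u i).
Proof. by rewrite /gamma; case: cid => g [_ h] /= /h. Qed.

Definition Psi2 := of_columns gamma.

Lemma Psi2_H2 x : H2 (fun z => Psi2 z x).
Proof. by apply: of_columns_H2 => i; exact/model_H2/gamma_model. Qed.

Lemma Psi1_L2 x : L2 (fun z => Psi1 z x).
Proof. exact/H2_L2/Psi1_H2. Qed.

Lemma Psi2_L2 x : L2 (fun z => Psi2 z x).
Proof. exact/H2_L2/Psi2_H2. Qed.

Lemma ip_bshift2 f g : H2 f -> H2 g ->
  ip dot (bshift f) (bshift g) = ip dot f g - dot (value0 f) (value0 g).
Proof.
move=> hf hg; have Lf := H2_L2 hf; have Lg := H2_L2 hg.
have c1 := L2_cst dot (value0 f); have c2 := L2_cst dot (value0 g).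
rewrite /bshift ip_zX zX_zX subrr zX0 (ipBl Lf c1 (L2B Lg c2)).
rewrite (ipBr Lg c2 Lf) (ipBr Lg c2 c1) ip_cst (ip_cst_H2 _ Lg) subrr subr0.
by rewrite -dot_value0.
Qed.

(* Condition (a) paired with S_Theta2^* h = bshift h. *)
Lemma step_identity f h : K1 f -> K2 h ->
  ip dot (A f) h = ip dot (A (bshift f)) (bshift h) +
    (ip dot (opmul Psi1 (cst (value0 f))) h + ip dot f (opmul Psi2 (cst (value0 h)))).
Proof.
move=> Kf Kh; have Lf := model_L2 Kf; have Lh := model_L2 Kh.
have hf := model_H2 Kf; have hh := model_H2 Kh.
have KA := A_model bA Kf; have Kbh := bshift_model inner2 Kh.
have Lbh := model_L2 Kbh; have Kbf := bshift_model inner1 Kf.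
have Kc := cshift_adj_model inner2 KA; have Kc1 := cshift_adj_model inner1 Kf.
have [Ea aP] := adjopP inner2 kp2 bB2 Lf.
have Ka := E_model inner2 kp2 Ea.
set g := adjop dot E2 B2 f in Ea aP Ka *.
pose c := ct dot Theta2 g.
have KB := B1_k0_model (value0 f); have LB := model_L2 KB.
have Lkt := kt_L2 inner2 c.
have main : ip dot (bshift (A f)) (bshift h) - ip dot (A (bshift f)) (bshift h) =
    ip dot (B1 (k0 dot Theta1 (value0 f))) (bshift h) + ip dot (kt Theta2 c) (bshift h).
  have LbA := bshift_L2 (model_L2 KA).
  have LAb := A_L2 bA Kbf.
  rewrite -(ipBl LbA LAb Lbh) -(ipDl LB Lkt Lbh).
  apply: (ip_ael (L2B LbA LAb) (L2D LB Lkt) Lbh).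
  have e1 := cshift_adjE inner2 KA.
  have e2 := A_ae bA Kc1 Kbf (cshift_adjE inner1 Kf).
  have Ed : E1 (defect dot Theta1 f).
    split; last by exists (value0 f); exact: defectE.
    apply: (L2B Lf); apply: model_L2; apply: (cshift_model inner1).
    exact: cshift_adj_model.
  have e3 : B1 (defect dot Theta1 f) = B1 (k0 dot Theta1 (value0 f)) %[ae m].
    by case: bB1 => _ h' _ _; apply: h' => //; [exact: k0_E|exact: defectE].
  have e4 := defect_tE inner2 Ka.
  have e12 : bshift (A f) - A (bshift f) =
      cshift_adj dot Theta2 (A f) - A (cshift_adj dot Theta1 f) %[ae m].
    by apply: filterS2 e1 e2 => z h1 h2 _; congr (_ - _); rewrite ?h1 ?h2.
  have e34 : B1 (defect dot Theta1 f) + defect_t dot Theta2 g =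
      B1 (k0 dot Theta1 (value0 f)) + kt Theta2 c %[ae m].
    by apply: filterS2 e3 e4 => z h1 h2 _; congr (_ + _); rewrite ?h1 ?h2.
  apply: filterS3 e12 (AB Kf) e34 => z h1 h2 h3 I'.
  exact: etrans (h1 I') (etrans (h2 I') (h3 I')).
(* Pairing with B h instead of h is what turns c(h) into h(0), by [ct_bshift]. *)
have t1 : ip dot (kt Theta2 c) (bshift h) = - dot (T0 c) (value0 h).
  by rewrite (ip_kt inner2 _ Kbh) (ct_bshift inner2 Kh) -scaleN1r dotZr rmorphN1 mulN1r -adjP.
have t2 : ip dot (B1 (k0 dot Theta1 (value0 f))) (bshift h) =
    ip dot (opmul Psi1 (cst (value0 f))) h.
  rewrite ipC//; rewrite (ip_bshift_H2 Lh (model_H2 KB)) -ipC//; last exact: L2_zX.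
  rewrite -[in LHS](opprK 1) -ip_zX opprK.
  have LP : L2 (opmul Psi1 (cst (value0 f))) by exact: Psi1_L2.
  apply: (ip_ael (L2_zX 1 LB) LP Lh).
  rewrite opmul_of_columns; apply: filterS (B1_k0_ae (value0 f)) => z e _.
  rewrite /zX e// !fct_sumE scaler_sumr; apply: eq_bigr => i _.
  rewrite -[LHS]/(sval z ^ 1 *: (dot (value0 f) (u i) *: B1 (k0 dot Theta1 (u i)) z)).
  by rewrite scalerA mulrC -scalerA.
have t3 : ip dot f (opmul Psi2 (cst (value0 h))) =
    dot (value0 (A f)) (value0 h) - dot (T0 c) (value0 h).
  rewrite opmul_of_columns ip_sumr//; last by move=> i; exact/L2Z/model_L2/gamma_model.
  rewrite -dotBl (dot_onb dot); apply: eq_bigr => i _.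
  by rewrite (ipZr _ (model_L2 (gamma_model i)) Lf) gammaP// mulrC.
move: main; rewrite (ip_bshift2 (model_H2 KA) hh).
rewrite t1 t2 t3.
move: (ip dot (A f) h) (ip dot (A (bshift f)) (bshift h)) => x y.
move: (dot (value0 (A f)) _) (dot (T0 c) _) (ip dot _ h) => a b p e.
(* Here x - a is <B A f, B h>, by [ip_bshift2]. *)
rewrite (_ : x = (x - a - y) + (y + a)); last by ring.
by rewrite e; ring.
Qed.

(** Against B h or B f, a function of H^2 can be multiplied by z instead. Multiplication by z
    commutes with Psi1 and Psi2, so the terms of the successive steps assemble into Taylor
    polynomials. *)
Lemma ip_A_iter n f h : K1 f -> K2 h ->
  ip dot (A f) h = ip dot (A (iter n (@bshift R H) f)) (iter n (@bshift R H) h) +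
    (ip dot (opmul Psi1 (psum n f)) h + ip dot f (opmul Psi2 (psum n h))).
Proof.
elim: n f h => [|n IH] f h Kf Kh.
  have e0 (Psi : circle R -> 'End(H)) : opmul Psi (0 : circle R -> H) = 0.
    by apply/funext => z; rewrite /opmul linear0.
  rewrite /= !e0 ip0l (ipC (model_L2 Kf) (L2_0 dot)) ip0l rmorph0.
  by rewrite !addr0.
have Kbf := bshift_model inner1 Kf; have Kbh := bshift_model inner2 Kh.
have Lf := model_L2 Kf; have Lh := model_L2 Kh.
rewrite (step_identity Kf Kh) (IH _ _ Kbf Kbh) -!iterSr.
have P1H := opmul_psum_H2 n Psi1_H2 (model_H2 Kbf).
have P2H := opmul_psum_H2 n Psi2_H2 (model_H2 Kbh).
have LP1 := L2_zX 1 (H2_L2 P1H); have LP2 := L2_zX 1 (H2_L2 P2H).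
have -> : ip dot (opmul Psi1 (psum n (bshift f))) (bshift h) =
    ip dot (zX 1 (opmul Psi1 (psum n (bshift f)))) h.
  rewrite ipC; [|exact: H2_L2|exact: model_L2 Kbh].
  by rewrite (ip_bshift_H2 Lh P1H) -ipC ?ip_zX ?opprK//; [exact: H2_L2|exact: L2_zX].
have -> : ip dot (bshift f) (opmul Psi2 (psum n (bshift h))) =
    ip dot f (zX 1 (opmul Psi2 (psum n (bshift h)))).
  by rewrite (ip_bshift_H2 Lf P2H) ip_zX opprK.
rewrite [psum n.+1 f]/= [psum n.+1 h]/= !opmulD !opmul_zX.
rewrite (ipDl (Psi1_L2 (value0 f)) LP1 Lh) (ipDr (Psi2_L2 (value0 h)) LP2 Lf).
by rewrite -addrA; congr (_ + _); rewrite addrC addrACA.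
Qed.

Definition symbol (z : circle R) : 'End(H) := Psi1 z + adj dot (Psi2 z).

Lemma symbol_L2 x : L2 (fun z => symbol z x).
Proof.
rewrite (_ : (fun z => _) = (fun z => Psi1 z x) + (fun z => adj dot (Psi2 z) x)).
  by apply: L2D; [exact: Psi1_L2|exact: (L2_adj Psi2_L2)].
by apply/funext => z; rewrite /symbol add_lfunE.
Qed.

(** Boundedness of h and f puts v1 and v2 in L^2, so the Taylor polynomials may converge inside the
    pairings. The remainder is at most |M| times the norms of B^n f and h. *)
Lemma Re_ip_symbol f h : model_oo dot Theta1 f -> model_oo dot Theta2 h ->
  complex.Re (ip dot (A f) h) = complex.Re (ip dot (opmul symbol f) h).
Proof.
move=> /model_ooP[Kf bf] /model_ooP[Kh bh].
have Lf := model_L2 Kf; have Lh := model_L2 Kh.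
have hf := model_H2 Kf; have hh := model_H2 Kh.
have [_ _ _ [M AM]] := bA.
pose v1 := opmul (fun z => adj dot (Psi1 z)) h.
pose v2 := opmul (fun z => adj dot (Psi2 z)) f.
have Lv1 : L2 v1.
  exact: (L2_opmul_bounded (L2_adj Psi1_L2) (L2_vmeasurable Lh) bh).
have Lv2 : L2 v2.
  exact: (L2_opmul_bounded (L2_adj Psi2_L2) (L2_vmeasurable Lf) bf).
have LP1 : L2 (opmul Psi1 f) by exact: (L2_opmul_bounded Psi1_L2 (L2_vmeasurable Lf) bf).
(* One summand for each of the three errors; the absolute value is taken because M is not known to
   be nonnegative. *)
pose c := `|M| * N h + N v1 + N v2.
apply: (@eq_of_small _ _ _ c); first by rewrite !addr_ge0 ?mulr_ge0 ?L2norm_ge0.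
move=> e e0.
have [n1 hn1] := iter_bshift_cvg0 hf e0.
have [n2 hn2] := psum_cvg hf e0; have [n3 hn3] := psum_cvg hh e0.
pose n := (n1 + n2 + n3)%N.
have le1 : (n1 <= n)%N by rewrite /n -addnA leq_addr.
have le2 : (n2 <= n)%N by rewrite /n addnAC leq_addl.
have le3 : (n3 <= n)%N by rewrite leq_addl.
pose fn := iter n (@bshift R H) f; pose hn := iter n (@bshift R H) h.
have Kfn : K1 fn by rewrite /fn; elim: (n) => //= k; exact: (bshift_model inner1).
have Khn : K2 hn by rewrite /hn; elim: (n) => //= k; exact: (bshift_model inner2).
have Lpf := H2_L2 (psum_H2 n hf); have Lph := H2_L2 (psum_H2 n hh).
have -> : ip dot (opmul symbol f) h = ip dot f v1 + ip dot v2 h.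
  have -> : opmul symbol f = opmul Psi1 f + v2.
    by apply/funext => z; rewrite /opmul /symbol add_lfunE.
  by rewrite (ipDl LP1 Lv2 Lh) ip_opmul.
rewrite (ip_A_iter n Kf Kh) ip_opmul -(ip_opmul_adj dot Psi2) -/v1 -/v2 -/fn -/hn !ReD.
have b1 : `|complex.Re (ip dot (A fn) hn)| <= e * (`|M| * N h).
  apply: (le_trans (Re_ip_le (A_L2 bA Kfn) (model_L2 Khn))).
  have := AM _ Kfn; have := L2norm_iter_bshift n hh; rewrite -/hn => h1 h2.
  rewrite mulrA; apply: ler_pM; rewrite ?L2norm_ge0//.
  apply: (le_trans h2); rewrite mulrC; apply: (le_trans (ler_norm _)).
  rewrite normrM ger0_norm ?L2norm_ge0// ler_wpM2r//; exact: hn1.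
have b2 : `|complex.Re (ip dot (psum n f) v1) - complex.Re (ip dot f v1)| <= e * N v1.
  rewrite -ReB -(ipBl Lpf Lf Lv1); apply: (le_trans (Re_ip_le (L2B Lpf Lf) Lv1)).
  by rewrite ler_wpM2r ?L2norm_ge0//; exact: hn2.
have b3 : `|complex.Re (ip dot v2 (psum n h)) - complex.Re (ip dot v2 h)| <= e * N v2.
  rewrite -ReB -(ipBr Lph Lh Lv2); apply: (le_trans (Re_ip_le Lv2 (L2B Lph Lh))).
  by rewrite mulrC ler_wpM2r ?L2norm_ge0//; exact: hn3.
rewrite /c !mulrDr opprD.
have -> (x y z s t : R) : x + (y + z) + (- s - t) = x + (y - s) + (z - t) by ring.
apply: (le_trans (ler_normD _ _)); apply: lerD => //.
by apply: (le_trans (ler_normD _ _)); apply: lerD.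
Qed.

Lemma ip_symbol f h : model_oo dot Theta1 f -> model_oo dot Theta2 h ->
  ip dot (A f) h = ip dot (opmul symbol f) h.
Proof.
move=> Kf Kh; apply: complex_eq; first exact: Re_ip_symbol.
have Kih : model_oo dot Theta2 ('i%C *: h).
  move: Kh => /model_ooP[Kh [M bh]]; apply/model_ooP; split; first exact: (modelZ inner2).
  by exists M; apply: filterS bh => z; rewrite -[('i%C *: h) z]/('i%C *: h z) hnormi.
have := Re_ip_symbol Kf Kih; move: Kf Kh => /model_ooP[Kf bf] /model_ooP[Kh bh].
have Lh := model_L2 Kh.
have Ls := L2_opmul_bounded symbol_L2 (L2_vmeasurable (model_L2 Kf)) bf.
rewrite (ipZr _ Lh (A_L2 bA Kf)) (ipZr _ Lh Ls) !ReM /= !mul0r !sub0r.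
by rewrite ?mulN1r ?opprK.
Qed.

(** The symbol identity holds for bounded h only; [model_oo_orth] in the second model space makes
    this enough. *)
Lemma sufficiency : MT dot Theta1 Theta2 A.
Proof.
split => //; exists symbol; split; first by apply/L2LP; exact: symbol_L2.
move=> f Kf; have /model_ooP[Kf' bf] := Kf.
have Ls := L2_opmul_bounded symbol_L2 (L2_vmeasurable (model_L2 Kf')) bf.
have Kp := proj_model inner2 Ls; have KA := A_model bA Kf'.
have Kd := modelB inner2 KA Kp.
have : A f - trunc_toeplitz dot Theta2 symbol f = (fun=> 0) %[ae m].
  apply: (model_oo_orth inner2 Kd) => g Kg.
  have /model_ooP[Kg' _] := Kg; have Lg := model_L2 Kg'.
  have LA := model_L2 KA; have Lp := model_L2 Kp.
  rewrite (ipBr LA Lp Lg) ipC// [X in _ - X]ipC// (ip_proj inner2 Ls Kg').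
  by rewrite ip_symbol// subrr.
by apply: filterS => z h I'; apply/eqP; rewrite -subr_eq0; apply/eqP/h.
Qed.

End Sufficiency.

(** * Ranges of the defect operators *)

Section Defects.
Variables (R : realType) (H : vectType R[i]) (dot : {dot H for Num.conj}).
Variable Theta : circle R -> 'End(H).
Hypothesis innerT : inner dot Theta.
Implicit Types f : circle R -> H.

Lemma defect_space_defect f : model dot Theta f ->
  defect_space dot Theta (defect dot Theta f).
Proof.
move=> Kf; split; last by exists (value0 f); exact: defectE.
apply: (L2B (model_L2 Kf)); apply: model_L2; apply: (cshift_model innerT).
exact: cshift_adj_model.
Qed.

Lemma defect_space_t_defect f : model dot Theta f ->
  defect_space_t dot Theta (defect_t dot Theta f).
Proof.
move=> Kf; split; last first.
  by exists (ct dot Theta f); have := defect_tE innerT Kf; rewrite (kt_pointE innerT).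
apply: (L2B (model_L2 Kf)); apply: model_L2; apply: (cshift_adj_model innerT).
exact: cshift_model.
Qed.

End Defects.

Theorem corollary5p7 (R : realType) (H : vectType R[i])
    (dot : {dot H for Num.conj})
    (Theta1 Theta2 : circle R -> 'End(H))
    (inner1 : inner dot Theta1) (pure1 : pure dot Theta1)
    (inner2 : inner dot Theta2) (pure2 : pure dot Theta2)
    (A : (circle R -> H) -> circle R -> H)
    (bA : bounded_linear dot (model dot Theta1) (model dot Theta2) A) :
  MT dot Theta1 Theta2 A <->
  (exists B1 B2 : (circle R -> H) -> circle R -> H,
    [/\ bounded_linear dot (defect_space dot Theta1) (model dot Theta2) B1,
        bounded_linear dot (defect_space_t dot Theta2) (model dot Theta1) B2 &
        forall f, model dot Theta1 f ->
          cshift_adj dot Theta2 (A f) - A (cshift_adj dot Theta1 f) =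
          B1 (defect dot Theta1 f) +
          defect_t dot Theta2 (adjop dot (defect_space_t dot Theta2) B2 f)
          %[ae circle_measure R]]) /\
  (exists B1 B2 : (circle R -> H) -> circle R -> H,
    [/\ bounded_linear dot (defect_space_t dot Theta1) (model dot Theta2) B1,
        bounded_linear dot (defect_space dot Theta2) (model dot Theta1) B2 &
        forall f, model dot Theta1 f ->
          cshift dot Theta2 (A f) - A (cshift dot Theta1 f) =
          B1 (defect_t dot Theta1 f) +
          defect dot Theta2 (adjop dot (defect_space dot Theta2) B2 f)
          %[ae circle_measure R]]).
Proof.
split=> [[_ [Phi [LPhi APhi]]]|[[B1 [B2 [bB1 bB2 AB]]] _]]; last first.
  exact: (sufficiency inner1 inner2 pure2 bA bB1 bB2 AB).
(* The necessity lemmas speak of [k0] and [kt]; this replaces them by the defect operators, which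
   agree with them only a.e. *)
have aux (x y a b c d : circle R -> H) :
    x = a + b %[ae circle_measure R] -> c = a %[ae circle_measure R] ->
    d = b %[ae circle_measure R] -> x = c + d %[ae circle_measure R].
  move=> h1 h2 h3; apply: filterS3 h1 h2 h3 => z e1 e2 e3 I'.
  by rewrite (e1 I') -[LHS]/(a z + b z) -(e2 I') -(e3 I').
split.
- have [B1 [B2 [bB1 bB2 AB]]] :=
    necessity_a inner1 pure1 inner2 pure2 bA LPhi APhi.
  exists B1, B2; split => // f Kf.
  have k1 := k0_pair inner1 pure1; have k2 := kt_pair inner2 pure2.
  have [Ea _] := adjopP inner2 k2 bB2 (model_L2 Kf).
  have Ka := E_model inner2 k2 Ea.
  have e1 : B1 (defect dot Theta1 f) = B1 (k0 dot Theta1 (value0 f)) %[ae circle_measure R].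
    case: bB1 => _ B1ae _ _; apply: B1ae; last exact: (defectE inner1 Kf).
      exact: defect_space_defect.
    exact: (E_k k1).
  exact: (aux _ _ _ _ _ _ (AB f Kf) e1 (defect_tE inner2 Ka)).
- have [B1 [B2 [bB1 bB2 AB]]] :=
    necessity_b inner1 pure1 inner2 pure2 bA LPhi APhi.
  exists B1, B2; split => // f Kf.
  have k1 := kt_pair inner1 pure1; have k2 := k0_pair inner2 pure2.
  have [Ea _] := adjopP inner2 k2 bB2 (model_L2 Kf).
  have Ka := E_model inner2 k2 Ea.
  have e1 : B1 (defect_t dot Theta1 f) = B1 (kt Theta1 (ct dot Theta1 f)) %[ae circle_measure R].
    case: bB1 => _ B1ae _ _; apply: B1ae; last exact: (defect_tE inner1 Kf).
      exact: defect_space_t_defect.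
    exact: (E_k k1).
  exact: (aux _ _ _ _ _ _ (AB f Kf) e1 (defectE inner2 Ka)).
Qed.
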